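(* Let $m$ be an integer with $5\le m\le 18$, let $B^m\subset\mathbb{R}^m$ be the unit ball, and let $v=(v_{ijk})_{1\le i,j,k\le m}\colon B^m\to\mathbb{S}^{m^3-1}\subset\mathbb{R}^{m^3}$ be the map $$v_{ijk}(x)=\frac{1}{\sqrt{(m-1)(m+2)}}\Big(\delta_{ij}\frac{x_k}{r}+\delta_{jk}\frac{x_i}{r}+\delta_{ik}\frac{x_j}{r}-(m+2)\frac{x_ix_jx_k}{r^3}\Big),\qquad r=|x|.$$ Let $\beta\in(0,\frac{\pi}{2})$ be determined by $\sin^2\beta=\frac{5}{6}\frac{m-1}{m+1}$. Then the proper weak biharmonic map $$\tilde v\colon B^m\to\mathbb{S}^{m^3}\subset\mathbb{R}^{m^3}\times\mathbb{R},\qquad x\mapsto\big(\sin\beta\;v(x),\cos\beta\big)$$ is an unstable critical point of the bienergy $E_2$.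
   Context: Maps are defined almost everywhere (here, for $x\neq0$); $\delta_{ij}$ is the Kronecker delta, $r=\sqrt{x_1^2+\dots+x_m^2}$, and $\Delta$ is the Euclidean Laplacian, acting componentwise; $|\nabla w|^2=\sum_k|\partial_kw|^2$. $W^{2,2}(B^m,\mathbb{S}^n)$ is the set of $w\in W^{2,2}(B^m,\mathbb{R}^{n+1})$ with $w(x)\in\mathbb{S}^n$ for a.e. $x$. The bienergy of $w\in W^{2,2}(B^m,\mathbb{S}^n)$ is $$E_2(w)=\frac12\int_{B^m}\big(|\Delta w|^2-|\nabla w|^4\big)\,dx,$$ and weak biharmonic maps are its critical points (distributional solutions in $W^{2,2}(B^m,\mathbb{S}^n)$ of its Euler–Lagrange equation); proper means not harmonic. A weak biharmonic map $w$ is unstable if there is a variation $(w_s)_{s\in(-\varepsilon,\varepsilon)}$ in $W^{2,2}(B^m,\mathbb{S}^n)$, depending smoothly on $s$, with $w_0=w$ and with the same boundary data as $w$, i.e. $(w_s-w)|_{\partial B^m}=0$ and $\nabla(w_s-w)|_{\partial B^m}=0$ in the sense of traces, such that $$\frac{d^2}{ds^2}\Big|_{s=0}E_2(w_s)<0.$$ *)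

(* Defs.v *)
From HB Require Import structures.
From mathcomp Require Import all_boot all_order all_algebra.
From mathcomp Require Import all_classical all_reals all_analysis.

Set Implicit Arguments.
Unset Strict Implicit.
Unset Printing Implicit Defensive.

Import Order.TTheory GRing.Theory Num.Theory.
Import numFieldNormedType.Exports.

Local Open Scope classical_set_scope.
Local Open Scope ring_scope.

(* The sigma-algebra of R^n is the one generated by the coordinate functions,
   as for [n.-tuple T]; it is the Borel sigma-algebra. *)
Section measurable_rV.
Context (R : realType) (n : nat).

Let coord (i : 'I_n) (x : 'rV[R]_n) : measurableTypeR R := x ord0 i.

Let rV_set0 : g_sigma_preimage coord set0.
Proof. exact: sigma_algebra0. Qed.

Let rV_setC A : g_sigma_preimage coord A -> g_sigma_preimage coord (~` A).
Proof. exact: sigma_algebraC. Qed.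

Let rV_bigcup (F : _^nat) : (forall i, g_sigma_preimage coord (F i)) ->
  g_sigma_preimage coord (\bigcup_i (F i)).
Proof. exact: sigma_algebra_bigcup. Qed.

HB.instance Definition _ := @isMeasurable.Build default_measure_display
  'rV[R]_n (g_sigma_preimage coord) rV_set0 rV_setC rV_bigcup.

Lemma measurable_rV_coord (i : 'I_n) :
  measurable_fun [set: 'rV[R]_n] (fun x => x ord0 i : measurableTypeR R).
Proof.
move=> _ Y mY; rewrite setTI; apply: sub_sigma_algebra => /=.
rewrite -bigcup_seq/=; exists i => /=; first by rewrite mem_index_enum.
by exists Y => //; rewrite setTI.
Qed.

Lemma measurable_fun_rVP d (T : measurableType d) (f : T -> 'rV[R]_n) :
  (forall i, measurable_fun [set: T] (fun t => f t ord0 i : measurableTypeR R))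
  -> measurable_fun [set: T] f.
Proof.
move=> mf _ A mA; rewrite setTI.
suff: preimage_set_system setT f (g_sigma_preimage coord) `<=` measurable.
  by apply; exists A => //; rewrite setTI.
rewrite -g_sigma_preimage_comp.
apply: smallest_sub; first exact: sigma_algebra_measurable.
rewrite -bigcup_seq => B [i _ [C mC <-]].
exact: (mf i).
Qed.

End measurable_rV.

Lemma sigma_finite_pushforward d1 d2 (T1 : measurableType d1)
    (T2 : measurableType d2) (R : realType) (mu : set T1 -> \bar R)
    (f : T1 -> T2) (g : T2 -> T1) :
  measurable_fun setT g -> cancel f g -> sigma_finite setT mu ->
  sigma_finite setT (pushforward mu f).
Proof.
move=> mg fK [F FT Foo].
exists (fun k => g @^-1` F k); first by rewrite -preimage_bigcup -FT.
move=> k; have [mFk Fk] := Foo k; split.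
  by rewrite -[X in measurable X]setTI; exact: mg.
by rewrite /pushforward -comp_preimage (_ : g \o f = id) //;
  apply/funext => p /=; rewrite fK.
Qed.

Lemma sigma_finite_prod d1 d2 (T1 : measurableType d1)
    (T2 : measurableType d2) (R : realType)
    (m1 : {sigma_finite_measure set T1 -> \bar R})
    (m2 : {sigma_finite_measure set T2 -> \bar R}) :
  sigma_finite setT (m1 \x m2)%E.
Proof.
have /sigma_finiteP[F [TF ndF Foo]] := sigma_finiteT m1.
have /sigma_finiteP[G [TG ndG Goo]] := sigma_finiteT m2.
exists (fun n => F n `*` G n).
  rewrite -setXTT TF TG predeqE => -[x y]; split.
    move=> [/= [n _ Fnx] [k _ Gky]]; exists (maxn n k) => //; split.
    - by move: x Fnx; exact/subsetPset/ndF/leq_maxl.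
    - by move: y Gky; exact/subsetPset/ndG/leq_maxr.
  by move=> [n _ []/= ? ?]; split; exists n.
move=> k; have [? ?] := Foo k; have [? ?] := Goo k.
split; first exact: measurableX.
by rewrite product_measure1E// lte_mul_pinfty// ge0_fin_numE.
Qed.

Lemma pushforward_sigma_finite_measure d1 d2 d3 (T1 : measurableType d1)
    (T2 : measurableType d2) (T3 : measurableType d3) (R : realType)
    (m1 : {sigma_finite_measure set T1 -> \bar R})
    (m2 : {sigma_finite_measure set T2 -> \bar R})
    (f : T1 * T2 -> T3) (g : T3 -> T1 * T2) :
  measurable_fun setT f -> measurable_fun setT g -> cancel f g ->
  exists mu : {sigma_finite_measure set T3 -> \bar R},
    mu = pushforward (m1 \x m2)%E f :> (set T3 -> \bar R).
Proof.
move=> mf mg fK; pose nu := pushforward (m1 \x m2)%E f.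
have sf : sigma_finite setT nu.
  exact: sigma_finite_pushforward mg fK (sigma_finite_prod _ _).
pose nuM : {measure set T3 -> \bar R} :=
  measure_function_pushforward__canonical__measure_function_Measure
    (m1 \x m2)%E mf.
pose H1 := isSFinite.Build _ _ _ nuM (sfinite_measure_sigma_finite sf).
pose H2 := isSigmaFinite.Build _ _ _ nuM sf.
by exists (HB.pack_for (SigmaFiniteMeasure.type T3 R) (Measure.sort nuM) H1 H2).
Qed.

Section lebesgue_rV.
Context (R : realType).

Definition consrV n (p : measurableTypeR R * 'rV[R]_n) : 'rV[R]_n.+1 :=
  row_mx (p.1%:M : 'M[R]_1) p.2.

Lemma measurable_consrV n : measurable_fun setT (@consrV n).
Proof.
apply: measurable_fun_rVP => i.
case: (unliftP ord0 i) => [j ->|->].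
- rewrite (_ : (fun t => _) = (fun x : 'rV[R]_n => x ord0 j : measurableTypeR R)
    \o snd); last first.
    apply/funext => t /=; rewrite /consrV.
    have -> : lift ord0 j = rshift 1 j :> 'I_(1 + n) by exact: val_inj.
    exact: row_mxEr.
  by apply: measurableT_comp => //; exact: measurable_rV_coord.
- rewrite (_ : (fun t => _) = fst) //.
  apply/funext => t /=; rewrite /consrV.
  have -> : ord0 = lshift n ord0 :> 'I_(1 + n) by exact: val_inj.
  by apply: etrans (row_mxEl _ _ _ _) _; rewrite mxE eqxx.
Qed.

(* Lebesgue measure on R^n as the n-fold product measure. *)
Fixpoint lebesgue_rV (n : nat) : set 'rV[R]_n -> \bar R :=
  match n return set 'rV[R]_n -> \bar R with
  | 0 => \d_(0 : 'rV[R]_0)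
  | n'.+1 => pushforward (lebesgue_measure \x @lebesgue_rV n')%E (@consrV n')
  end.


Let lebesgue_rVP n :
  exists mu : {sigma_finite_measure set 'rV[R]_n -> \bar R},
    mu = @lebesgue_rV n :> (set 'rV[R]_n -> \bar R).
Proof.
elim: n => [|n [mu muE]]; first by eexists (\d_(0 : 'rV[R]_0)).
rewrite /= -muE.
pose uncons (x : 'rV[R]_n.+1) :=
  ((x ord0 ord0 : measurableTypeR R), rsubmx (x : 'M[R]_(1, 1 + n))).
apply: (@pushforward_sigma_finite_measure _ _ _ _ _ _ _ _ _ _ uncons).
- exact: measurable_consrV.
- apply/measurable_fun_pairP; split; first exact: measurable_rV_coord.
  apply: measurable_fun_rVP => i /=.
  rewrite (_ : (fun t => _) = fun x : 'rV[R]_n.+1 => x ord0 (lift ord0 i)).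
    exact: measurable_rV_coord.
  apply/funext => x /=; rewrite mxE; congr (x _ _); exact: val_inj.
- case=> a y; rewrite /uncons /consrV /= row_mxKr.
  have -> : ord0 = lshift n ord0 :> 'I_(1 + n) by exact: val_inj.
  by congr pair; apply: etrans (row_mxEl _ _ _ _) _; rewrite mxE eqxx.
Qed.

Section lebesgue_rV_measure.
Context (n : nat).

Let lebesgue_rV0 : @lebesgue_rV n set0 = 0%E.
Proof. by have [mu <-] := lebesgue_rVP n. Qed.

Let lebesgue_rV_ge0 A : (0 <= @lebesgue_rV n A)%E.
Proof. by have [mu <-] := lebesgue_rVP n. Qed.

Let lebesgue_rV_sigma_additive : semi_sigma_additive (@lebesgue_rV n).
Proof.
by have [mu <-] := lebesgue_rVP n; exact: measure_semi_sigma_additive.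
Qed.

HB.instance Definition _ := isMeasure.Build _ _ _ (@lebesgue_rV n)
  lebesgue_rV0 lebesgue_rV_ge0 lebesgue_rV_sigma_additive.

Let sigma_finite_lebesgue_rV : sigma_finite setT (@lebesgue_rV n).
Proof. by have [mu <-] := lebesgue_rVP n; exact: sigma_finiteT. Qed.

HB.instance Definition _ := @Measure_isSigmaFinite.Build _ _ _ (@lebesgue_rV n)
  sigma_finite_lebesgue_rV.

End lebesgue_rV_measure.
End lebesgue_rV.

Section functions_on_ball.
Context (R : realType) (m : nat).
Local Notation E := 'rV[R]_m.
Local Notation leb := (@lebesgue_rV R m).
Implicit Types (u g : E -> R) (Du : 'I_m -> E -> R) (D2u : 'I_m -> 'I_m -> E -> R).

(* The norm of the normed module ['rV[R]_m] is the sup norm. *)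
Definition enorm (x : E) : R := Num.sqrt (\sum_i x ord0 i ^+ 2).

Definition uball : set E := [set x | enorm x < 1].

Definition pd (k : 'I_m) (f : E -> R) : E -> R :=
  fun x => 'D_(delta_mx ord0 k : E) f x.

Definition laplacian (f : E -> R) : E -> R := fun x => \sum_k pd k (pd k f) x.

(* C^infinity: all iterated partial derivatives exist and are continuous. *)
Definition smooth (f : E -> R) : Prop :=
  forall s : seq 'I_m,
    continuous (foldr pd f s) /\
    forall (k : 'I_m) (x : E), derivable (foldr pd f s) x (delta_mx ord0 k : E).

(* C_c^infinity(B^m) *)
Definition test_fun (f : E -> R) : Prop :=
  smooth f /\
  exists K : set E, [/\ compact K, K `<=` uball & forall x, ~ K x -> f x = 0].

Definition L2 u : Prop :=
  measurable_fun uball u /\ (\int[leb]_(x in uball) (u x ^+ 2)%:E < +oo)%E.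

Definition weak_pd (k : 'I_m) u g : Prop :=
  forall phi, test_fun phi ->
    \int[leb]_(x in uball) (u x * pd k phi x) =
    - \int[leb]_(x in uball) (g x * phi x).

(* u is in W^{1,2}(B^m) and Du is its weak gradient; weak derivatives are
   unique up to null sets. *)
Definition W12_jet u Du : Prop :=
  L2 u /\ forall k, L2 (Du k) /\ weak_pd k u (Du k).

(* u is in W^{2,2}(B^m), D2u k l = \partial_l \partial_k u. *)
Definition W22_jet u Du D2u : Prop :=
  W12_jet u Du /\ forall k, W12_jet (Du k) (D2u k).

(* The integral over the unit sphere for its surface measure, which gives a
   Borel set A the mass m * |{t y : y \in A, 0 < t < 1}|. *)
Definition sphere_integral (f : E -> R) : \bar R :=
  ((m%:R)%:E * \int[leb]_(x in uball) (f ((enorm x)^-1 *: x))%:E)%E.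

(* u in W^{1,2}(B^m) has trace g: the trace operator is the continuous extension
   to W^{1,2}(B^m) of the restriction map from functions smooth up to the boundary
   to L^2 of the sphere. *)
Definition trace u g : Prop :=
  exists Du, W12_jet u Du /\
  exists f : nat -> E -> R,
    [/\ forall j, smooth (f j),
        (fun j => \int[leb]_(x in uball)
           ((f j x - u x) ^+ 2 + \sum_k (pd k (f j) x - Du k x) ^+ 2)%:E)%E
          @ \oo --> 0%E
      & (fun j => sphere_integral (fun x => (f j x - g x) ^+ 2)) @ \oo --> 0%E].

End functions_on_ball.

(* A map w : B^m -> R^I is given by its components w a, a : I. *)
Section maps_to_sphere.
Context (R : realType) (m : nat) (I : finType).
Local Notation E := 'rV[R]_m.
Local Notation B := (@uball R m).
Local Notation mu := (@lebesgue_rV R m).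
Local Notation map := (I -> E -> R).
Implicit Types (w u phi : map) (Dw : I -> 'I_m -> E -> R)
  (D2w : I -> 'I_m -> 'I_m -> E -> R).

Definition W12_map_jet w Dw : Prop := forall a, W12_jet (w a) (Dw a).

Definition W22_map_jet w Dw D2w : Prop :=
  forall a, W22_jet (w a) (Dw a) (D2w a).

Definition sphere_valued w : Prop :=
  {ae mu, forall x, B x -> \sum_a w a x ^+ 2 = 1}.

(* W^{2,2}(B^m, S^n) with n = #|I| - 1. *)
Definition W22_sphere w : Prop :=
  sphere_valued w /\ exists Dw D2w, W22_map_jet w Dw D2w.

(* |\nabla w|^2, given the weak gradient of w *)
Definition grad_sq Dw (x : E) : R := \sum_a \sum_k Dw a k x ^+ 2.

(* (\Delta w)_a, given the weak Hessian of w *)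
Definition lap D2w (a : I) (x : E) : R := \sum_k D2w a k k x.

Definition bienergy_density Dw D2w (x : E) : R :=
  (\sum_a lap D2w a x ^+ 2) - grad_sq Dw x ^+ 2.

(* E_2(w) = e. *)
Definition is_bienergy w (e : R) : Prop :=
  exists Dw D2w,
    [/\ W22_map_jet w Dw D2w,
        mu.-integrable B (EFin \o bienergy_density Dw D2w)
      & e = 2^-1 * \int[mu]_(x in B) bienergy_density Dw D2w x].

(* \Delta w + |\nabla w|^2 w = 0 in the sense of distributions *)
Definition weakly_harmonic w : Prop :=
  sphere_valued w /\
  exists Dw, W12_map_jet w Dw /\
  forall phi, (forall a, test_fun (phi a)) ->
    \int[mu]_(x in B)
      (\sum_a ((\sum_k Dw a k x * pd k (phi a) x) -
               grad_sq Dw x * w a x * phi a x)) = 0.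

(* For f = <w, phi>: \partial_k f and \Delta f by the product rule. *)
Definition pd_dot w Dw phi (k : 'I_m) (x : E) : R :=
  \sum_a (Dw a k x * phi a x + w a x * pd k (phi a) x).

Definition lap_dot w Dw D2w phi (x : E) : R :=
  \sum_a (lap D2w a x * phi a x
          + 2 * (\sum_k Dw a k x * pd k (phi a) x)
          + w a x * laplacian (phi a) x).

(* The Euler-Lagrange equation of E_2 for maps into the sphere is
     \Delta^2 w + 2 div(|\nabla w|^2 \nabla w)
       - <\Delta^2 w + 2 div(|\nabla w|^2 \nabla w), w> w = 0.
   Since <w, \nabla w> = 0 and <w, \Delta w> = - |\nabla w|^2, it is
     \Delta^2 w + 2 div(|\nabla w|^2 \nabla w)
       + (|\Delta w|^2 + \Delta |\nabla w|^2 + 2 <\nabla w, \nabla \Delta w>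
          + 2 |\nabla w|^4) w = 0,
   where 2 <\nabla w, \nabla \Delta w> = 2 div <\Delta w, \nabla w> - 2 |\Delta w|^2.
   This is its integrand against phi once all derivatives that do not make sense
   for w in W^{2,2} are moved onto phi and f = <w, phi>. *)
Definition biharmonic_integrand w Dw D2w phi (x : E) : R :=
  (\sum_a lap D2w a x * laplacian (phi a) x)
  - 2 * grad_sq Dw x * (\sum_a \sum_k Dw a k x * pd k (phi a) x)
  + (2 * grad_sq Dw x ^+ 2 - \sum_a lap D2w a x ^+ 2) * (\sum_a w a x * phi a x)
  + grad_sq Dw x * lap_dot w Dw D2w phi x
  - 2 * (\sum_k (\sum_a lap D2w a x * Dw a k x) * pd_dot w Dw phi k x).

(* Integrability of the integrand is automatic, as W^{2,2} maps to the sphere are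
   in W^{1,4}; it is recorded because integrals of non-integrable functions have
   a default value. *)
Definition weakly_biharmonic w : Prop :=
  sphere_valued w /\
  exists Dw D2w, W22_map_jet w Dw D2w /\
  forall phi, (forall a, test_fun (phi a)) ->
    mu.-integrable B (EFin \o biharmonic_integrand w Dw D2w phi) /\
    \int[mu]_(x in B) biharmonic_integrand w Dw D2w phi x = 0.

Definition proper_weakly_biharmonic w : Prop :=
  weakly_biharmonic w /\ ~ weakly_harmonic w.

(* u is in W^{2,2}(B^m, R^I) and has norm at most c there. *)
Definition W22_norm_le u (c : R) : Prop :=
  exists Du D2u, W22_map_jet u Du D2u /\
    (\int[mu]_(x in B)
       (\sum_a (u a x ^+ 2 + \sum_k Du a k x ^+ 2 +
                \sum_k \sum_l D2u a k l x ^+ 2))%:E <= (c ^+ 2)%:E)%E.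

(* s |-> W s is C^infinity from ]-eps, eps[ to the Banach space W^{2,2}(B^m, R^I),
   with p-th derivative J p. *)
Definition smooth_W22_curve (eps : R) (W : R -> map) : Prop :=
  exists J : nat -> R -> map,
    J 0%N = W /\
    forall (p : nat) (s : R), `|s| < eps ->
      (exists Dw D2w, W22_map_jet (J p s) Dw D2w) /\
      forall d : R, 0 < d -> \forall h \near 0^',
        W22_norm_le
          (fun a x => h^-1 * (J p (s + h) a x - J p s a x) - J p.+1 s a x) d.

(* u and \nabla u vanish on the boundary in the sense of traces *)
Definition zero_boundary_data u : Prop :=
  exists Du D2u, W22_map_jet u Du D2u /\
  forall a, trace (u a) (fun=> 0) /\ forall k, trace (Du a k) (fun=> 0).

Definition unstable w : Prop :=
  exists (eps : R) (W : R -> map) (e : R -> R),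
    0 < eps /\
    {ae mu, forall x, B x -> forall a, W 0 a x = w a x} /\
    smooth_W22_curve eps W /\
    (forall s, `|s| < eps ->
       [/\ W22_sphere (W s),
           zero_boundary_data (fun a x => W s a x - w a x)
         & is_bienergy (W s) (e s)]) /\
    (\forall s \near 0, derivable e s 1) /\
    derivable (derive1 e) 0 1 /\
    derive1n 2 e 0 < 0.

End maps_to_sphere.

Section the_map.
Context (R : realType) (m : nat).
Local Notation E := 'rV[R]_m.

(* Division by zero gives v 0 = 0; the maps matter only for x != 0. *)
Definition v (i j k : 'I_m) (x : E) : R :=
  let r := enorm x in
  (Num.sqrt ((m%:R - 1) * (m%:R + 2)))^-1 *
  ((i == j)%:R * (x ord0 k / r) + (j == k)%:R * (x ord0 i / r)
   + (i == k)%:R * (x ord0 j / r)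
   - (m%:R + 2) * (x ord0 i * x ord0 j * x ord0 k / r ^+ 3)).

(* R^{m^3} x R is R^I with I = option ('I_m * 'I_m * 'I_m). *)
Definition vtilde (beta : R) (a : option ('I_m * 'I_m * 'I_m)) : E -> R :=
  match a with
  | Some (i, j, k) => fun x => sin beta * v i j k x
  | None => fun=> cos beta
  end.

End the_map.

(* Main.v *)
(* Replacing r = |x| by rho = sqrt(eps + |x|^2) makes v and all the maps built
   from it smooth; as eps -> 0 their derivatives converge off the origin and are
   dominated by powers of 1/r.  Since r^-4 is integrable for m >= 5, every
   integration by parts needed for the singular maps follows from the divergence
   theorem for smooth functions and dominated convergence.

   One has |v| = 1 and Delta v = - lam v / r^2 with lam = 3 (m + 1), so that
   vtilde is biharmonic iff 2 lam sin^2 beta = lam + 2 (m - 4), which is the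
   choice of beta.  It is not harmonic, since its last component is a nonzero
   constant and its gradient does not vanish.

   For the instability, turn the angle: w_s = (sin (beta + s eta) v,
   cos (beta + s eta)) with eta = (1 - r^2)^8.  With alpha = beta + s eta the
   bienergy density of w_s is (Delta alpha - lam sin alpha cos alpha / r^2)^2,
   so the second derivative of the bienergy at s = 0 is the integral of
     (Delta eta + 2 (m - 4) eta / r^2)^2 - (lam^2 - 4 (m - 4)^2) eta^2 / r^4.
   The divergence of r^-4 (1 - r^2)^n x shows that the integrals I_n of
   r^-4 (1 - r^2)^n satisfy (m - 4 + 2 n) I_n = 2 n I_(n-1); hence the second
   derivative is a rational function of m times I_12, and it is negative for
   5 <= m <= 18. *)
Require Import Defs.
From HB Require Import structures.
From mathcomp Require Import all_boot all_order all_algebra.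
From mathcomp Require Import all_classical all_reals all_analysis.
From mathcomp Require Import measurable_realfun ring lra.

Set Implicit Arguments.
Unset Strict Implicit.
Unset Printing Implicit Defensive.

Import Order.TTheory GRing.Theory Num.Theory.
Import numFieldNormedType.Exports.

Local Open Scope classical_set_scope.
Local Open Scope ring_scope.

(** * Integration over R^n and the divergence theorem on the ball *)

(** Two demands pull against each other. Integration by parts, and the approximation in the
    definition of traces, call for smooth maps, hence [eps > 0]; the geometry, starting with
    [|v| = 1], holds only at [eps = 0] and off the origin. A single syntax evaluated at both kinds
    of [eps] reconciles them: derivatives are computed once, on expressions; analytic facts are
    proved for [eps > 0] and carried to the limit; algebraic identities are proved at [eps = 0] and
    differentiated as identities between functions on the punctured space. Integrability then
    becomes a count. An expression of pole at most 4 is integrable on the ball, each derivative in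
    space costs one, and a derivative in the parameter costs nothing. The components of the maps
    have pole 0, so [|Delta w|^2] and [|grad w|^4] have pole at most 4, and every integration by
    parts starts from pole at most 3, which leaves no contribution of the origin. *)

Section rV_integration.
Context (R : realType).
Implicit Types (n : nat).

Definition cube n (a : R) : set 'rV[R]_n := [set x | forall i, `|x ord0 i| <= a].
Arguments cube : clear implicits.

Lemma measurable_cube n a : measurable (cube n a).
Proof.
have -> : cube n a = \big[setI/setT]_(i < n)
    ((fun x : 'rV[R]_n => x ord0 i : measurableTypeR R) @^-1` `[- a, a]).
  rewrite -bigcap_seq /=; apply/seteqP; split=> [x xa i _|x xa i] /=.
    by rewrite in_itv/= -ler_norml.
  by have := xa i (mem_index_enum i); rewrite /= in_itv/= -ler_norml.
apply: bigsetI_measurable => i _; rewrite -[X in measurable X]setTI.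
exact: measurable_rV_coord.
Qed.

Lemma consrV0 n (t : R) (y : 'rV[R]_n) : consrV (t, y) ord0 ord0 = t.
Proof.
have -> : ord0 = lshift n ord0 :> 'I_(1 + n) by exact: val_inj.
by apply: etrans (row_mxEl _ _ _ _) _; rewrite mxE eqxx.
Qed.

Lemma consrVS n (t : R) (y : 'rV[R]_n) i : consrV (t, y) ord0 (lift ord0 i) = y ord0 i.
Proof.
have -> : lift ord0 i = rshift 1 i :> 'I_(1 + n) by exact: val_inj.
exact: row_mxEr.
Qed.

Lemma lebesgue_rV_cubeS n a : 0 <= a ->
  (lebesgue_rV (cube n.+1 a) = (2 * a)%:E * lebesgue_rV (cube n a))%E.
Proof.
move=> a0; rewrite /= /pushforward.
have -> : (@consrV R n) @^-1` (cube n.+1 a) = `[- a, a] `*` cube n a.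
  apply/seteqP; split=> [[t y] /= ty|[t y] [/= ta ya] i].
    split=> [|i]; first by have := ty ord0; rewrite consrV0 in_itv/= -ler_norml.
    by have := ty (lift ord0 i); rewrite consrVS.
  case: (unliftP ord0 i) => [j ->|->]; first by rewrite consrVS.
  by rewrite consrV0; move: ta; rewrite in_itv/= -ler_norml.
rewrite product_measure1E//; last exact: measurable_cube.
congr (_ * _)%E; apply: etrans (lebesgue_measure_itv `[- a, a]%R) _.
rewrite /= lte_fin; case: ltP => [|aa]; first by rewrite -EFinB opprK -mulr2n mulr_natl.
have -> : a = 0 by lra.
by rewrite mulr0.
Qed.

Lemma lebesgue_rV_cube n a : 0 <= a -> lebesgue_rV (cube n a) = ((2 * a) ^+ n)%:E.
Proof.
move=> a0; elim: n => [|n IH]; last by rewrite lebesgue_rV_cubeS// IH -EFinM exprS.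
by rewrite expr0 /lebesgue_rV diracE mem_set// => -[].
Qed.

Definition upd n (x : 'rV[R]_n) (k : 'I_n) (t : R) : 'rV[R]_n :=
  \row_i (if i == k then t else x ord0 i).

Lemma measurable_consr n (t : R) : measurable_fun setT (fun y : 'rV[R]_n => consrV (t, y)).
Proof. by apply: (measurableT_comp (@measurable_consrV R n)); exact: pair1_measurable. Qed.

Lemma bounded_integrable_rV n (F : 'rV[R]_n -> R) (M : R) :
  measurable_fun setT F -> (forall x, `|F x| <= M) ->
  (forall x, ~ cube n 1 x -> F x = 0) ->
  (@lebesgue_rV R n).-integrable setT (EFin \o F).
Proof.
move=> mF FM F0.
have M0 : 0 <= M by exact: le_trans (FM 0).
have -> : EFin \o F = (EFin \o F) \_ (cube n 1).
  apply/funext => x; rewrite patchE; case: ifPn => // /negP xc /=.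
  by rewrite F0// => /mem_set.
apply/(integrable_mkcond _ _).1; first exact: measurable_cube.
apply: measurable_bounded_integrable.
- exact: measurable_cube.
- by rewrite [X in (X < _)%E]lebesgue_rV_cube// ltry.
- exact: measurable_funS mF.
- exists M; split; first by rewrite realE M0.
  by move=> x Mx y _ /=; exact: le_trans (FM y) (ltW Mx).
Qed.

Lemma integral_rVS n (F : 'rV[R]_n.+1 -> R) :
  (@lebesgue_rV R n.+1).-integrable setT (EFin \o F) ->
  let G := fun p => (F (consrV p))%:E in
  (lebesgue_measure \x @lebesgue_rV R n)%E.-integrable setT G /\
  (\int[@lebesgue_rV R n.+1]_x (F x)%:E =
   \int[(lebesgue_measure \x @lebesgue_rV R n)%E]_p G p)%E.
Proof.
move=> iF G.
have mc := @measurable_consrV R n.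
have [mF iF'] := integrableP _ _ _ iF.
have iG : (lebesgue_measure \x @lebesgue_rV R n)%E.-integrable setT G.
  apply/integrableP; split.
    by apply/measurable_EFinP; apply: (measurableT_comp _ mc); apply/measurable_EFinP.
  case/integrableP : iF => _; apply: le_lt_trans.
  have := @ge0_integral_pushforward _ _ _ _ _ _ mc (lebesgue_measure \x @lebesgue_rV R n)%E setT (fun x => `|(F x)%:E|%E) measurableT.
  rewrite preimage_setT => <- //.
  exact: measurableT_comp.
split=> //.
have := @integral_pushforward _ _ _ _ _ _ mc (lebesgue_measure \x @lebesgue_rV R n)%E setT _ mF.
rewrite preimage_setT => <- //.
Qed.

Lemma upd_consrV0 n (s t : R) (y : 'rV[R]_n) : upd (consrV (s, y)) ord0 t = consrV (t, y).
Proof.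
apply/rowP => i; rewrite mxE; case: (unliftP ord0 i) => [j ->|->].
  by rewrite eq_sym (negbTE (neq_lift _ _)) !consrVS.
by rewrite eqxx consrV0.
Qed.

Lemma upd_consrVS n (s t : R) (y : 'rV[R]_n) (j : 'I_n) :
  upd (consrV (s, y)) (lift ord0 j) t = consrV (s, upd y j t).
Proof.
apply/rowP => i; rewrite mxE; case: (unliftP ord0 i) => [l ->|->].
  by rewrite (inj_eq lift_inj) !consrVS mxE.
by rewrite (negbTE (neq_lift _ _)) !consrV0.
Qed.

(* Fubini, with the coordinate [k] integrated first. *)
Lemma integral_slice0 n (k : 'I_n) (F : 'rV[R]_n -> R) (M : R) :
  measurable_fun setT F -> (forall x, `|F x| <= M) ->
  (forall x, ~ cube n 1 x -> F x = 0) ->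
  (forall x, (\int[lebesgue_measure]_t (F (upd x k t))%:E = 0)%E) ->
  (\int[@lebesgue_rV R n]_x (F x)%:E = 0)%E.
Proof.
elim: n k F => [[]//|n IH] k F mF FM F0 kF.
have [iG ->] := integral_rVS (bounded_integrable_rV mF FM F0).
case: (unliftP ord0 k) kF => [j ->|->] kF.
  rewrite -(integral12_prod_meas1 iG) integral0_eq// => t _.
  apply: (IH j) => //.
  - exact: measurableT_comp mF (measurable_consr t).
  - by move=> y yc; apply: F0 => /= c; apply: yc => i; have := c (lift ord0 i); rewrite consrVS.
  - by move=> y; under eq_integral do rewrite -upd_consrVS; exact: kF.
(* The distinguished coordinate is now the first factor of the product, so the order of integration
   is exchanged to make it the inner one. *)
rewrite -(integral21_prod_meas1 iG) integral0_eq// => y _.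
rewrite /fubini_G; under eq_integral do rewrite -(upd_consrV0 0).
exact: kF.
Qed.
End rV_integration.
Arguments cube {R} n a.

(** * Open sets in the sigma-algebra of the coordinates *)

Section rV_topology.
Context (R : realType) (n : nat).
Local Notation E := 'rV[R]_n.

Lemma measurable_box (q : E) (e : R) :
  measurable [set x : E | forall i, `|q ord0 i - x ord0 i| < e].
Proof.
have -> : [set x : E | forall i, `|q ord0 i - x ord0 i| < e] = \big[setI/setT]_(i < n)
    ((fun x : 'rV[R]_n => x ord0 i : measurableTypeR R) @^-1` ball (q ord0 i) e).
  rewrite -bigcap_seq /=; apply/seteqP; split=> [x xa i _|x xa i] /=.
    exact: xa.
  exact: (xa i (mem_index_enum i)).
apply: bigsetI_measurable => i _; rewrite -[X in measurable X]setTI.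
apply: measurable_rV_coord => //; exact: measurable_ball.
Qed.

(** Boxes with rational centre and radius [1 / (j + 1)] are measurable and can be enumerated. Around
    a point of [A] with a sup-norm ball of radius [e] inside [A], a box of radius below [e / 2]
    whose centre is that close to the point stays in [A]. *)
Lemma open_measurable_rV (A : set E) : open A -> measurable A.
Proof.
move=> oA.
pose q (p : 'rV[rat]_n) : E := map_mx ratr p.
pose box (p : E) (j : nat) := [set x : E | forall i, `|p ord0 i - x ord0 i| < j.+1%:R^-1].
pose F (k : nat) := if unpickle k is Some (p, j) then
  (if pselect (box (q p) j `<=` A) then box (q p) j else set0) else set0.
have -> : A = \bigcup_k F k; last first.
  apply: bigcupT_measurable => k; rewrite /F/box; case: (unpickle k) => // -[p j].
  case: pselect => ? /=; last exact: measurable0.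
  exact (measurable_box (q p) j.+1%:R^-1).
apply/seteqP; split=> [x Ax|x [k _]]; last first.
  by rewrite /F/box; case: (unpickle k) => // -[p j]; case: pselect => // bA; exact: bA.
have /nbhs_ballP[e /= e0 eA] : nbhs x A by exact: open_nbhs_nbhs.
have [j je] : exists j : nat, j.+1%:R^-1 < e / 2.
  have e20 : 0 < e / 2 by lra.
  exists (Num.truncn (e / 2)^-1).
  rewrite invf_plt ?posrE//; exact: (real_truncnS_gt (num_real _)).
have j0 : 0 < j.+1%:R^-1 :> R by rewrite invr_gt0.
rewrite /F /box; set a := j.+1%:R^-1 in je j0.
have [p Hp] : exists p : 'rV[rat]_n, forall i, `|q p ord0 i - x ord0 i| < a.
  have H i : exists r : rat, `|ratr r - x ord0 i| < a.
    have [r] := @rat_in_itvoo R (x ord0 i - a) (x ord0 i + a) ltac:(lra).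
    by rewrite in_itv/= => /andP[? ?]; exists r; rewrite ltr_norml; lra.
  have [f Hf] := choice H.
  by exists (\row_i f i) => i; rewrite !mxE.
exists (pickle (p, j)) => //; rewrite pickleK -/a.
case: pselect => // -[] y yb; apply: eA; split=> // i0 i; rewrite (ord1 i0).
have := Hp i; have := yb i; rewrite /ball/= !ltr_norml => ? ?; lra.
Qed.

Lemma continuous_measurable_rV (f : E -> R) : continuous f -> measurable_fun setT f.
Proof.
move=> /continuousP cf; apply: (measurability _ (RGenOpens.measurableE R)).
move=> _ [_ [a [b ->] <-]]; rewrite setTI; apply: open_measurable_rV.
by apply: cf; exact: interval_open.
Qed.

End rV_topology.

(** * The divergence theorem on the unit ball *)

Section ball.
Context (R : realType) (n : nat).
Local Notation E := 'rV[R]_n.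
Local Notation leb := (@lebesgue_rV R n).

Definition nr2 (x : E) : R := \sum_i x ord0 i ^+ 2.

Lemma nr2_ge0 x : 0 <= nr2 x.
Proof. by apply: sumr_ge0 => i _; exact: sqr_ge0. Qed.

Lemma enorm_ge0 (x : E) : 0 <= enorm x.
Proof. exact: sqrtr_ge0. Qed.

Lemma enorm_sqr (x : E) : enorm x ^+ 2 = nr2 x.
Proof. by rewrite sqr_sqrtr// nr2_ge0. Qed.

Lemma uballE : @uball R n = [set x | nr2 x < 1].
Proof.
apply/seteqP; split => x; rewrite /uball /=.
  by move=> x1; rewrite -enorm_sqr expr_lt1// enorm_ge0.
by move=> x1; rewrite -(@expr_lt1 _ 2)// ?enorm_ge0// enorm_sqr.
Qed.

Lemma coord_le_nr2 (x : E) i : x ord0 i ^+ 2 <= nr2 x.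
Proof. by rewrite /nr2 (bigD1 i)//= lerDl sumr_ge0// => j _; exact: sqr_ge0. Qed.

Lemma nr2_cube (x : E) : nr2 x <= 1 -> cube n 1 x.
Proof.
move=> x1 i; rewrite -(@expr_le1 _ 2)// real_normK ?num_real//.
exact: le_trans (coord_le_nr2 _ _) x1.
Qed.

Lemma uball_cube (x : E) : uball x -> cube n 1 x.
Proof. by rewrite uballE => /ltW/nr2_cube. Qed.

Lemma measurable_nr2 : measurable_fun setT nr2.
Proof.
apply: measurable_sum => i; apply: measurable_funX; exact: measurable_rV_coord.
Qed.

Lemma measurable_uball : measurable (@uball R n).
Proof.
rewrite uballE (_ : [set x | _] = nr2 @^-1` `]-oo, 1[).
  by rewrite -[X in measurable X]setTI; apply: measurable_nr2.
by apply/seteqP; split => x /=; rewrite in_itv.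
Qed.

Lemma lebesgue_uball_fin : (leb (@uball R n) < +oo)%E.
Proof.
apply: (@le_lt_trans _ _ (leb (cube n 1))); last by rewrite lebesgue_rV_cube// ltry.
apply: le_measure; rewrite ?inE; [exact: measurable_uball|exact: measurable_cube|].
exact: uball_cube.
Qed.

Lemma compact_cube : compact (cube n 1 : set E).
Proof.
have -> : cube n 1 = [set v : E | forall i, v ord0 i \in `[(- 1 : R), 1]].
  by apply/seteqP; split => x xc i; have := xc i; rewrite /= in_itv/= ler_norml.
apply: (@rV_compact R n (fun=> `[(- 1), 1]%classic)) => _; exact: segment_compact.
Qed.

Lemma continuous_bounded_cube (f : E -> R) : continuous f ->
  exists2 M : R, 0 <= M & forall x, cube n 1 x -> `|f x| <= M.
Proof.
move=> cf.
have : compact (f @` cube n 1).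
  apply: continuous_compact; last exact: compact_cube.
  exact: continuous_subspaceT.
move/compact_bounded => [M [Mr HM]]; exists (`|M| + 1); first by rewrite addr_ge0.
move=> x xc; apply: HM; last by exists x.
by rewrite (le_lt_trans (ler_norm M))// ltrDl.
Qed.

Lemma updE (x : E) k t : upd x k t = t *: (delta_mx ord0 k : E) + upd x k 0.
Proof.
apply/rowP => i; rewrite !mxE eqxx/=; case: eqP => _ /=.
  by rewrite mulr1 addr0.
by rewrite mulr0 add0r.
Qed.

Lemma nr2_upd (x : E) k t : nr2 (upd x k t) = \sum_(i | i != k) x ord0 i ^+ 2 + t ^+ 2.
Proof.
rewrite /nr2 (bigD1 k)//= mxE eqxx addrC; congr (_ + _).
by apply: eq_bigr => i /negPf ik; rewrite mxE ik.
Qed.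

Lemma continuous_upd (x : E) k : continuous (upd x k).
Proof.
move=> t; rewrite (_ : upd x k = fun t => t *: (delta_mx ord0 k : E) + upd x k 0).
  apply: cvgD; last exact: cvg_cst.
  by apply: cvgZr_tmp; exact: cvg_id.
by apply/funext => s; rewrite updE.
Qed.

Lemma is_derive_upd (f : E -> R) (x : E) k t :
  derivable f (upd x k t) (delta_mx ord0 k) ->
  is_derive t 1 (fun s => f (upd x k s)) (pd k f (upd x k t)).
Proof.
move=> df.
have e : (fun h : R => h^-1 *: ((f \o shift (upd x k t)) (h *: (delta_mx ord0 k : E)) - f (upd x k t))) =
   (fun h => h^-1 *: (((fun s => f (upd x k s)) \o shift t) (h *: 1) - f (upd x k t))).
  apply/funext => h /=; congr (_ *: (f _ - _)).
  by rewrite (updE x k t) (updE x k (_ + _)) addrA -scalerDl [h *: 1]mulr1.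
by split; [rewrite /derivable -e|rewrite /pd /derive -e].
Qed.

Lemma integral_pd_eq0 (k : 'I_n) (f : E -> R) :
  continuous f -> (forall x, derivable f x (delta_mx ord0 k : E)) ->
  continuous (pd k f) -> (forall x, nr2 x = 1 -> f x = 0) ->
  (\int[leb]_(x in @uball R n) (pd k f x)%:E = 0)%E.
Proof.
move=> cf df cpf f0.
have [M M0 HM] := continuous_bounded_cube cpf.
rewrite integral_mkcond.
have -> : ((fun x => (pd k f x)%:E) \_ (@uball R n)) = EFin \o (pd k f \_ (@uball R n)).
  by apply/funext => x; rewrite /= !patchE; case: ifP.
apply: (@integral_slice0 R n k _ M).
- apply/(measurable_restrictT _ measurable_uball).
  by apply: measurable_funTS; exact: continuous_measurable_rV.
- move=> x; rewrite patchE; case: ifPn => [/set_mem/uball_cube/HM//|_].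
  by rewrite normr0.
- by move=> x xc; rewrite patchE; case: ifPn => // /set_mem/uball_cube.
move=> x; set c := \sum_(i | i != k) x ord0 i ^+ 2.
(* [c] is the squared distance of the line from the origin; for [c >= 1] the line misses the open
   ball. *)
have [c1|c1] := leP 1 c.
  rewrite integral0_eq// => t _; rewrite patchE; case: ifPn => // /set_mem.
  by rewrite uballE /= nr2_upd -/c => ct; exfalso; have := sqr_ge0 t; lra.
set l : R := Num.sqrt (1 - c).
have l0 : 0 < l by rewrite sqrtr_gt0; lra.
have ll : l ^+ 2 = 1 - c by rewrite sqr_sqrtr; lra.
transitivity (\int[lebesgue_measure]_(t in `](- l)%R, l[) (pd k f (upd x k t))%:E)%E.
  rewrite [RHS]integral_mkcond; apply: eq_integral => t _; rewrite !patchE.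
  have -> : (upd x k t \in @uball R n) = (t \in `]- l, l[%classic).
    apply: asbool_equiv_eq; rewrite uballE /= nr2_upd -/c in_itv/= -ltr_norml.
    have -> : (`|t| < l) = (t ^+ 2 < 1 - c).
      by rewrite -ll -(real_normK (num_real t)) ltr_pXn2r// nnegrE ltW.
    by split => ?; lra.
  by case: ifP.
rewrite -(@integral_itv_bndoo _ _ _ _ true false); last first.
  apply: measurable_funTS; apply/measurable_EFinP.
  apply: continuous_measurable_fun => t.
  by apply: continuous_comp; [exact: continuous_upd|exact: cpf].
have dG (t : R) : is_derive t 1 (fun s => f (upd x k s)) (pd k f (upd x k t)).
  by apply: is_derive_upd.
rewrite (@continuous_FTC2 _ _ (fun t => f (upd x k t))).
- by rewrite !f0 ?subee// nr2_upd -/c ?sqrrN ll; lra.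
- lra.
- apply: continuous_subspaceT => t.
  by apply: continuous_comp; [exact: continuous_upd|exact: cpf].
- split => [t _||].
  + by have [] := dG t.
  + apply: cvg_at_right_filter; apply: continuous_comp; [exact: continuous_upd|exact: cf].
  + apply: cvg_at_left_filter; apply: continuous_comp; [exact: continuous_upd|exact: cf].
- by move=> t _; rewrite derive1E; have [] := dG t.
Qed.
End ball.

(** * Expressions closed under differentiation *)

Section flat_function.
Context (R : realType).

(** A remainder bounded by [C h^2] is the form in which differentiability becomes available for the
    flat functions at 0 and for integrals depending on the parameter. *)
Lemma is_derive_quadratic (f : R -> R) (t d C : R) :
  (forall h, `|h| <= 1 -> `|f (h + t) - f t - h * d| <= C * h ^+ 2) ->
  is_derive t 1 f d.
Proof.
move=> H.
suff c : h^-1 *: ((f \o shift t) (h *: 1) - f t) @[h --> 0^'] --> d.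
  by split; [apply/cvg_ex; exists d|exact: cvg_lim].
apply/cvgrPdist_le => e e0; near=> h.
have h0 : h != 0 by near: h; exact: nbhs_dnbhs_neq.
rewrite /= -[X in _ - X]/(h^-1 * _) [h *: 1]mulr1.
have -> : d - h^-1 * (f (h + t) - f t) = - h^-1 * (f (h + t) - f t - h * d) by field.
rewrite normrM normrN normfV ler_pdivrMl ?normr_gt0//.
apply: (le_trans (H h _)).
  by near: h; apply: dnbhs0_le.
have -> : C * h ^+ 2 = `|h| * (`|h| * C) by rewrite mulrA -expr2 real_normK ?num_real// mulrC.
rewrite ler_wpM2l//.
have C0 : `|C| + 1 > 0 by rewrite ltr_wpDl.
have hC : `|h| <= e / (`|C| + 1) by near: h; apply: dnbhs0_le; rewrite divr_gt0.
rewrite ler_pdivlMr// in hC.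
apply: le_trans hC; rewrite ler_wpM2l//.
by rewrite (le_trans (ler_norm _))// lerDl.
Unshelve. all: by end_near. Qed.

Lemma exprM_expRN_le (k : nat) (u : R) : 0 <= u -> u ^+ k * expR (- u) <= k`!%:R.
Proof.
move=> u0; case: k => [|k].
  by rewrite mul1r expR_le1 oppr_le0.
rewrite expRN ler_pdivrMr ?expR_gt0//.
have := expR_ge1Dxn k u0.
have f0 : 0 < (k.+1`!%:R : R) by rewrite ltr0n fact_gt0.
rewrite -(ler_pM2l f0) mulrDr mulr1 mulrCA divff ?gt_eqF// mulr1.
by apply: le_trans; rewrite lerDr ltW.
Qed.

(** The index [n] makes the family closed under differentiation: the derivative of [t^-n exp(-1/t)]
    combines the indices [n + 1] and [n + 2]. *)
Definition flat (n : nat) (t : R) : R :=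
  if 0 < t then t^-1 ^+ n * expR (- t^-1) else 0.

Lemma flat_ge0 n t : 0 <= flat n t.
Proof. by rewrite /flat; case: ifP => // t0; rewrite mulr_ge0 ?expR_ge0// exprn_ge0// invr_ge0 ltW. Qed.

Lemma flat_le n t : flat n t <= n`!%:R.
Proof.
rewrite /flat; case: ifP => // t0; apply: exprM_expRN_le.
by rewrite invr_ge0 ltW.
Qed.

Lemma flatS n t : flat n t = t * flat n.+1 t.
Proof.
rewrite /flat; case: ifPn => [t0|_]; last by rewrite mulr0.
by rewrite exprS !mulrA mulfV ?gt_eqF// mul1r.
Qed.

Lemma is_derive_flat n (t : R) : is_derive t 1 (flat n) (flat n.+2 t - n%:R * flat n.+1 t).
Proof.
have [t0|t0|t0] := ltgtP t 0.
- have -> : flat n.+2 t - n%:R * flat n.+1 t = 0.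
    by rewrite /flat ltNge (ltW t0) mulr0 subr0.
  apply: (@near_eq_is_derive _ _ _ (cst 0)).
  near=> s; rewrite /flat /cst ltNge (_ : s <= 0)//.
  by apply: ltW; near: s; exact: lt_nbhsl.
- have tn0 : t != 0 by rewrite gt_eqF.
  have dV : is_derive t 1 (fun s : R => s^-1) (- t ^- 2).
    have := @is_deriveV R id t 1 1 tn0 (is_derive_id t 1).
    by rewrite [_ *: 1]mulr1.
  have dE : is_derive t 1 (fun s : R => expR (- s^-1)) (expR (- t^-1) * t ^- 2).
    apply: (@is_derive1_comp R expR (fun s => - s^-1)).
    by apply: is_derive_eq; rewrite opprK.
  have dX := @is_deriveX R R (fun s : R => s^-1) n t 1 _ dV.
  apply: (@near_eq_is_derive _ _ _ ((fun s : R => s^-1) ^+ n * (fun s : R => expR (- s^-1)))).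
    near=> s; rewrite /flat (_ : 0 < s)/=; last by near: s; exact: lt_nbhsr.
    by rewrite exprfctE.
  apply: is_derive_eq; rewrite /flat t0 -![_ *: _]/(_ * _) exprfctE.
  case: n dX => [|n] dX; first by rewrite !mul0r mulr0 addr0 subr0 expr0 mul1r exprVn mulrC.
  rewrite /= -[t ^- 2]exprVn; set u := t^-1; set e := expR _.
  rewrite !exprS; move: n.+1%:R (u ^+ n) => N w; ring.
- have -> : flat n.+2 t - n%:R * flat n.+1 t = 0.
    by rewrite /flat t0 ltxx mulr0 subr0.
  (* At the origin [flat n h] equals [h^2 * flat n.+2 h] with a bounded second factor, so the
     derivative is 0 by the quadratic criterion. *)
  set C : R := n.+2`!%:R; have HC : forall h, flat n.+2 h <= C by exact: flat_le.
  clearbody C; apply: (is_derive_quadratic (C := C)) => h _.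
  rewrite t0 addr0 mulr0 subr0 {2}/flat ltxx subr0 flatS flatS mulrA -expr2.
  by rewrite normrM !ger0_norm ?sqr_ge0 ?flat_ge0// mulrC ler_wpM2r ?sqr_ge0.
Unshelve. all: by end_near. Qed.

End flat_function.

Section directional_derivatives.
Context (R : realType) (m : nat).
Local Notation E := 'rV[R]_m.

Lemma cvg_sumr (I : finType) (T : Type) (F : set_system T) (f : I -> T -> R) (l : I -> R) :
  Filter F -> (forall i, f i x @[x --> F] --> l i) ->
  (\sum_i f i x) @[x --> F] --> \sum_i l i.
Proof.
move=> FF fl; rewrite unlock; elim: (index_enum I) => [|i r IH] /=; first exact: cvg_cst.
by apply: cvgD; [exact: fl|exact: IH].
Qed.

Lemma contD (f g : E -> R) : continuous f -> continuous g -> continuous (fun x => f x + g x).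
Proof. by move=> cf cg x; have := @cvgD _ _ _ _ (nbhs_filter x) _ _ _ _ (cf x) (cg x). Qed.

Lemma contM (f g : E -> R) : continuous f -> continuous g -> continuous (fun x => f x * g x).
Proof. by move=> cf cg x; have := @cvgM _ _ _ (nbhs_filter x) _ _ _ _ (cf x) (cg x). Qed.

Lemma cont_comp (g : R -> R) (f : E -> R) (x : E) :
  {for x, continuous f} -> {for f x, continuous g} -> {for x, continuous (fun x => g (f x))}.
Proof. by move=> cf cg; exact: (@continuous_comp _ _ _ f g). Qed.

Lemma cont_cst (c : R) : continuous (fun _ : E => c).
Proof. by move=> x; exact: cst_continuous. Qed.

Lemma is_derive_lineP (f : E -> R) (x v : E) (d : R) :
  is_derive x v f d <-> is_derive (0 : R) 1 (fun h => f (h *: v + x)) d.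
Proof.
have e : (fun h : R => h^-1 *: ((f \o shift x) (h *: v) - f x)) =
   (fun h => h^-1 *: (((fun t => f (t *: v + x)) \o shift 0) (h *: 1) - f (0 *: v + x))).
  apply/funext => h /=.
  by rewrite addr0 scale0r add0r [h *: 1]mulr1.
split=> -[df <-]; (split; last by rewrite /derive e).
- by rewrite /derivable -e.
- by rewrite /derivable e.
Qed.

Lemma is_derive_comp1 (g : R -> R) (f : E -> R) (x v : E) (a b : R) :
  is_derive (f x) 1 g a -> is_derive x v f b -> is_derive x v (g \o f) (a * b).
Proof.
move=> dg /is_derive_lineP df; apply/is_derive_lineP.
have -> : (fun h : R => (g \o f) (h *: v + x)) = g \o (fun h => f (h *: v + x)) by [].
by apply: is_derive1_comp; rewrite scale0r add0r.
Qed.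

Lemma is_derive_coord (x : E) (i k : 'I_m) :
  is_derive x (delta_mx ord0 k : E) (fun x : E => x ord0 i) (i == k)%:R.
Proof.
apply/is_derive_lineP.
have -> : (fun h : R => (h *: delta_mx ord0 k + x) ord0 i) =
    (fun h : R => (i == k)%:R *: h + x ord0 i).
  by apply/funext => h; rewrite !mxE eqxx/= mulrC.
by apply: is_derive_eq; rewrite addr0 [_ *: 1]mulr1.
Qed.

Lemma is_derive_nr2 (x : E) (k : 'I_m) :
  is_derive x (delta_mx ord0 k : E) (@nr2 R m) (2 * x ord0 k).
Proof.
rewrite (_ : @nr2 R m = \sum_(i < m) (fun y : E => y ord0 i) ^+ 2); last first.
  by apply/funext => y; rewrite fct_sumE; apply: eq_bigr => i _; rewrite exprfctE.
have H (i : 'I_m) : is_derive x (delta_mx ord0 k : E) ((fun y : E => y ord0 i) ^+ 2)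
    ((2 * x ord0 i ^+ 1) *: (i == k)%:R).
  by apply: is_deriveX; exact: is_derive_coord.
have := is_derive_sum H; congr is_derive.
rewrite (bigD1 k)//= eqxx [_ *: 1]mulr1 expr1 big1 ?addr0// => i /negPf ->.
by rewrite scaler0.
Qed.

Lemma continuous_coord (i : 'I_m) : continuous (fun x : E => x ord0 i).
Proof. exact: coord_continuous. Qed.

Lemma continuous_nr2 : continuous (@nr2 R m).
Proof.
move=> x; apply: (cvg_sumr (nbhs_filter x)) => i.
apply: (@continuous_comp _ _ _ (fun y : E => y ord0 i) (fun t : R => t ^+ 2)).
  exact: continuous_coord.
exact: exprn_continuous.
Qed.

End directional_derivatives.

Section flat_continuity.
Context (R : realType).

Lemma continuous_flat n : continuous (@flat R n).
Proof.
move=> t; apply: differentiable_continuous; apply/derivable1_diffP.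
by have [] := is_derive_flat n t.
Qed.

End flat_continuity.

Lemma is_derive_affine (R : realType) (a b t : R) : is_derive t 1 (fun s => a + b * s) b.
Proof.
apply: (@is_derive_quadratic _ _ _ _ 0) => h _.
by rewrite (_ : _ - _ - _ = 0) ?normr0 ?mul0r//; ring.
Qed.

(** * Expressions: derivatives, growth at the origin, limits *)

Section expressions.
Context (R : realType) (m : nat) (beta : R).
Local Notation E := 'rV[R]_m.

(* All maps of the proof are values [ev eps s e] of expressions [e]: the
   constructors are closed under the derivatives [dX] in [x] and [ds] in the
   parameter [s] of the variation, so smoothness, domination and convergence as
   [eps -> 0] are proved by induction.  [Ri] is [1 / rho], [Yc i] is [x_i / rho],
   [Uc] is [1 - |x|^2], [Fl n] gives cutoff functions, [Sn] and [Cn] are the sine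
   and cosine of [angle s], and [At c e] is [e] frozen at [s = c].  At [eps = 0]
   and [x = 0] the inverse of [rho] is [0]. *)
Inductive ex : Type :=
| Cst of R | Xc of 'I_m | Yc of 'I_m | Ri | Uc | Fl of nat | Sv | Sn | Cn
| Add of ex & ex | Mul of ex & ex | At of R & ex.

Fixpoint pw (e : ex) (n : nat) : ex := if n is n'.+1 then Mul e (pw e n') else Cst 1.

Definition rho (eps : R) (x : E) : R := Num.sqrt (eps + nr2 x).

(* With an exponent smaller than 8 the second variation is not negative for
   [m = 18]. *)
Definition angle (s : R) (x : E) : R := beta + s * (1 - nr2 x) ^+ 8.

Fixpoint ev (eps s : R) (e : ex) (x : E) : R :=
  match e with
  | Cst c => c
  | Xc i => x ord0 i
  | Yc i => x ord0 i * (rho eps x)^-1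
  | Ri => (rho eps x)^-1
  | Uc => 1 - nr2 x
  | Fl n => flat n (2^-1 - nr2 x)
  | Sv => s
  | Sn => sin (angle s x)
  | Cn => cos (angle s x)
  | Add e1 e2 => ev eps s e1 x + ev eps s e2 x
  | Mul e1 e2 => ev eps s e1 x * ev eps s e2 x
  | At c e => ev eps c e x
  end.

Fixpoint dX (k : 'I_m) (e : ex) : ex :=
  match e with
  | Cst _ | Sv => Cst 0
  | Xc i => Cst (i == k)%:R
  | Yc i => Add (Mul (Cst (i == k)%:R) Ri) (Mul (Cst (-1)) (Mul Ri (Mul (Yc i) (Yc k))))
  | Ri => Mul (Cst (-1)) (Mul (Yc k) (Mul Ri Ri))
  | Uc => Mul (Cst (-2)) (Xc k)
  | Fl n => Mul (Add (Fl n.+2) (Mul (Cst (- n%:R)) (Fl n.+1))) (Mul (Cst (-2)) (Xc k))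
  | Sn => Mul Cn (Mul Sv (Mul (Mul (Cst (-16)) (pw Uc 7)) (Xc k)))
  | Cn => Mul (Mul (Cst (-1)) Sn) (Mul Sv (Mul (Mul (Cst (-16)) (pw Uc 7)) (Xc k)))
  | Add e1 e2 => Add (dX k e1) (dX k e2)
  | Mul e1 e2 => Add (Mul (dX k e1) e2) (Mul e1 (dX k e2))
  | At c e => At c (dX k e)
  end.

Fixpoint ds (e : ex) : ex :=
  match e with
  | Sv => Cst 1
  | Sn => Mul Cn (pw Uc 8)
  | Cn => Mul (Mul (Cst (-1)) Sn) (pw Uc 8)
  | Add e1 e2 => Add (ds e1) (ds e2)
  | Mul e1 e2 => Add (Mul (ds e1) e2) (Mul e1 (ds e2))
  | _ => Cst 0
  end.

(* [ev 0 s e x] is [O(|x|^- pole e)] as [x] tends to [0]. *)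
Fixpoint pole (e : ex) : nat :=
  match e with
  | Ri => 1
  | Add e1 e2 => maxn (pole e1) (pole e2)
  | Mul e1 e2 => pole e1 + pole e2
  | At _ e => pole e
  | _ => 0
  end.

Lemma ev_pw eps s e n x : ev eps s (pw e n) x = ev eps s e x ^+ n.
Proof. by elim: n => //= n ->; rewrite exprS. Qed.

(** [Yc] is bounded and its derivatives are products of one [Ri] with bounded factors; this is why
    [x_i / rho] is an atom of its own and not a product of [Xc] and [Ri]. *)
Lemma pole_dX k e : (pole (dX k e) <= (pole e).+1)%N.
Proof.
elim: e => //= e1 h1 e2 h2.
  by rewrite geq_max (leq_trans h1) ?ltnS ?leq_maxl//= (leq_trans h2)// ltnS leq_maxr.
by rewrite geq_max; apply/andP; split; [rewrite -addSn leq_add2r|rewrite -addnS leq_add2l].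
Qed.

Lemma pole_ds e : (pole (ds e) <= pole e)%N.
Proof.
elim: e => //= e1 h1 e2 h2.
  by rewrite geq_max (leq_trans h1) ?leq_maxl//= (leq_trans h2)// leq_maxr.
by rewrite geq_max !leq_add.
Qed.

Lemma rho_gt0 eps x : 0 < eps + nr2 x -> 0 < rho eps x.
Proof. by move=> h; rewrite sqrtr_gt0. Qed.

Lemma rho_sqr eps x : 0 <= eps + nr2 x -> rho eps x ^+ 2 = eps + nr2 x.
Proof. by move=> h; rewrite sqr_sqrtr. Qed.

Lemma is_derive_comp_nr2 (g : R -> R) (x : E) k (a : R) : is_derive (nr2 x) 1 g a ->
  is_derive x (delta_mx ord0 k : E) (fun y => g (nr2 y)) (a * (2 * x ord0 k)).
Proof. by move=> dg; apply: is_derive_comp1; exact: is_derive_nr2. Qed.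

Lemma is_derive_rinv eps (x : E) k : 0 < eps + nr2 x ->
  is_derive x (delta_mx ord0 k : E) (fun y => (rho eps y)^-1)
    (- (x ord0 k * (rho eps x)^-1 * ((rho eps x)^-1 * (rho eps x)^-1))).
Proof.
move=> x0; have r0 := rho_gt0 x0; have rn0 : rho eps x != 0 by rewrite gt_eqF.
have d1 : is_derive (nr2 x) 1 (fun t => Num.sqrt (eps + t)) (2 * rho eps x)^-1.
  have := @is_derive1_comp R Num.sqrt (fun t => eps + t) (nr2 x) (2 * rho eps x)^-1 1
    (is_derive1_sqrt x0).
  rewrite mulr1; apply.
  by have := is_derive_affine eps 1 (nr2 x); under eq_fun do rewrite mul1r.
have d2 := @is_deriveV R (fun t => Num.sqrt (eps + t)) (nr2 x) _ 1 rn0 d1.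
have := is_derive_comp_nr2 k d2; congr is_derive.
rewrite -[_ *: _]/(_ * _) -/(rho eps x); field.
by rewrite rn0.
Qed.

Lemma is_derive_ev eps s e (x : E) k : 0 < eps + nr2 x ->
  is_derive x (delta_mx ord0 k : E) (ev eps s e) (ev eps s (dX k e) x).
Proof.
move=> x0; have dcst (c : R) : is_derive x (delta_mx ord0 k : E) (fun _ : E => c) 0.
  exact: is_derive_cst.
have dangle (s0 : R) : is_derive (nr2 x) 1 (fun t => beta + s0 * (1 - t) ^+ 8)
    (s0 * (- 8 * (1 - nr2 x) ^+ 7)).
  rewrite (_ : (fun t => _) = cst beta + s0 \*: ((cst 1 - id : R -> R) ^+ 8)); last first.
    by apply/funext => t; rewrite /= !fctE.
  apply: is_derive_eq; rewrite -![_ *: _]/(_ * _) !fctE/=.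
  ring.
elim: e s => //=.
- by move=> i s; exact: is_derive_coord.
- move=> i s.
  have := is_deriveM (is_derive_coord x i k) (is_derive_rinv k x0).
  congr is_derive; rewrite -![_ *: _]/(_ * _); ring.
- move=> s; have := is_derive_rinv k x0; congr is_derive; ring.
- move=> s.
  have dU : is_derive (nr2 x) 1 (fun t => 1 - t) (-1 : R).
    by have := is_derive_affine 1 (-1) (nr2 x); under eq_fun do rewrite mulN1r.
  have := is_derive_comp_nr2 k dU; congr is_derive; ring.
- move=> n s.
  have dU : is_derive (nr2 x) 1 (fun t => 2^-1 - t) (-1 : R).
    by have := is_derive_affine 2^-1 (-1) (nr2 x); under eq_fun do rewrite mulN1r.
  have := is_derive_comp_nr2 k (@is_derive1_comp R (flat n) (fun t => 2^-1 - t) _ _ _ (is_derive_flat n _) dU).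
  congr is_derive; ring.
- move=> s; have da := dangle s.
  have := is_derive_comp_nr2 k (@is_derive1_comp R sin (fun t => beta + s * (1 - t) ^+ 8) _ _ _ (is_derive_sin _) da).
  congr is_derive; rewrite /angle; ring.
- move=> s; have da := dangle s.
  have := is_derive_comp_nr2 k (@is_derive1_comp R cos (fun t => beta + s * (1 - t) ^+ 8) _ _ _ (is_derive_cos _) da).
  congr is_derive; rewrite /angle; ring.
- by move=> e1 h1 e2 h2 s; exact: (is_deriveD (h1 s) (h2 s)).
- move=> e1 h1 e2 h2 s; have := is_deriveM (h1 s) (h2 s).
  congr is_derive; rewrite -![_ *: _]/(_ * _); ring.
Qed.

Lemma is_derive_s (eps s : R) e (x : E) : is_derive s 1 (fun s => ev eps s e x) (ev eps s (ds e) x).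
Proof.
have dcst (c : R) : is_derive s 1 (fun _ : R => c) 0 by exact: is_derive_cst.
have dangle : is_derive s 1 (fun s => angle s x) ((1 - nr2 x) ^+ 8).
  have := is_derive_affine beta ((1 - nr2 x) ^+ 8) s; congr is_derive.
  by apply/funext => t; rewrite /angle mulrC.
elim: e => //=.
- exact: is_derive_id.
- have := @is_derive1_comp R sin (angle^~ x) _ _ _ (is_derive_sin _) dangle.
  congr is_derive; ring.
- have := @is_derive1_comp R cos (angle^~ x) _ _ _ (is_derive_cos _) dangle.
  congr is_derive; ring.
- by move=> e1 h1 e2 h2; exact: (is_deriveD h1 h2).
- move=> e1 h1 e2 h2; have := is_deriveM h1 h2.
  congr is_derive; rewrite -![_ *: _]/(_ * _); ring.
Qed.

(** The two derivatives commute in value only: as expressions the two sides differ by the order of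
    factors and by zero terms. *)
Lemma dsdX eps s e k x : ev eps s (ds (dX k e)) x = ev eps s (dX k (ds e)) x.
Proof.
elim: e => //=; rewrite ?(mul0r, mulr0, addr0, add0r)//.
1-4: by move=> *; ring.
- by move=> e1 -> e2 ->.
- by move=> e1 h1 e2 h2; rewrite h1 h2; ring.
Qed.

Lemma continuous_ev (eps s : R) e : 0 < eps -> continuous (ev eps s e).
Proof.
move=> e0.
have cr : continuous (fun x => (rho eps x)^-1).
  move=> x; have rn : rho eps x != 0 by rewrite gt_eqF// rho_gt0// ltr_wpDr// nr2_ge0.
  apply: (cont_comp (g := GRing.inv)); last exact: inv_continuous.
  apply: (cont_comp (g := Num.sqrt)); last exact: sqrt_continuous.
  by apply: contD; [exact: cont_cst|exact: continuous_nr2].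
have cU (c : R) : continuous (fun x : E => c - nr2 x).
  apply: contD; first exact: cont_cst.
  move=> x; apply: (cont_comp (g := -%R)); [exact: continuous_nr2|exact: opp_continuous].
have ca (t : R) : continuous (angle t).
  apply: contD; first exact: cont_cst.
  apply: contM; first exact: cont_cst.
  move=> x; apply: (cont_comp (g := fun t => t ^+ 8)); first exact: cU.
  exact: exprn_continuous.
elim: e s => //=.
- by move=> c s; exact: cont_cst.
- by move=> i s; exact: continuous_coord.
- by move=> i s; apply: contM; [exact: continuous_coord|exact: cr].
- move=> n s x; apply: (cont_comp (g := flat n)); first exact: cU.
  exact: continuous_flat.
- by move=> s; exact: cont_cst.
- by move=> s x; apply: (cont_comp (g := sin)); [exact: ca|exact: continuous_sin].
- by move=> s x; apply: (cont_comp (g := cos)); [exact: ca|exact: continuous_cos].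
- by move=> e1 h1 e2 h2 s; apply: contD; [exact: h1|exact: h2].
- by move=> e1 h1 e2 h2 s; apply: contM; [exact: h1|exact: h2].
Qed.

Lemma measurable_ev (eps s : R) e : 0 <= eps -> measurable_fun setT (ev eps s e).
Proof.
move=> e0.
have mr : measurable_fun setT (fun x : E => (rho eps x)^-1).
  rewrite (_ : (fun x => _) = (fun t => t `^ (- 2^-1)) \o (fun x => eps + nr2 x)).
    apply: measurableT_comp => //; apply: measurable_funD => //; exact: measurable_nr2.
  by apply/funext => x; rewrite /= powRN powR12_sqrt// addr_ge0// nr2_ge0.
have mU (c : R) : measurable_fun setT (fun x : E => c - nr2 x).
  by apply: measurable_funB => //; exact: measurable_nr2.
have ma (t : R) : measurable_fun setT (angle t).
  apply: measurable_funD => //; apply: measurable_funM => //.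
  exact: measurable_funX.
elim: e s => //=.
- by move=> i s; exact: measurable_rV_coord.
- by move=> i s; apply: measurable_funM => //; exact: measurable_rV_coord.
- move=> n s; apply: (measurableT_comp _ (mU 2^-1)).
  by apply: continuous_measurable_fun; exact: continuous_flat.
- move=> s; apply: (measurableT_comp _ (ma s)).
  by apply: continuous_measurable_fun; exact: continuous_sin.
- move=> s; apply: (measurableT_comp _ (ma s)).
  by apply: continuous_measurable_fun; exact: continuous_cos.
- by move=> e1 h1 e2 h2 s; exact: measurable_funD.
- by move=> e1 h1 e2 h2 s; exact: measurable_funM.
Qed.

(** Adding 1 keeps the weight at least 1, so a bound with a small exponent implies one with a larger
    exponent, and sums may take the maximum of two poles. *)
Definition wt (x : E) : R := 1 + (enorm x)^-1.

Lemma wt_ge1 x : 1 <= wt x.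
Proof. by rewrite lerDl invr_ge0 enorm_ge0. Qed.

Lemma rho_inv_le (eps : R) (x : E) : 0 <= eps -> (nr2 x = 0 -> eps = 0) ->
  (rho eps x)^-1 <= (enorm x)^-1.
Proof.
move=> e0 x0; have [nx|nx] := eqVneq (nr2 x) 0.
  by rewrite /rho x0// add0r.
have n0 : 0 < nr2 x by rewrite lt_neqAle eq_sym nx nr2_ge0.
rewrite lef_pV2 ?posrE ?sqrtr_gt0//; last by rewrite ltr_wpDl.
by rewrite ler_wsqrtr// lerDr.
Qed.

Lemma Yc_le1 (eps : R) (x : E) i : 0 <= eps -> `|x ord0 i * (rho eps x)^-1| <= 1.
Proof.
move=> e0; have : 0 <= rho eps x by exact: sqrtr_ge0.
rewrite le_eqVlt => /predU1P[<-|r0]; first by rewrite invr0 mulr0 normr0.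
rewrite normrM normfV (ger0_norm (ltW r0)) ler_pdivrMr// mul1r.
rewrite -(@ler_pXn2r _ 2)// ?nnegrE ?(ltW r0)// real_normK ?num_real//.
rewrite rho_sqr ?addr_ge0 ?nr2_ge0//.
by rewrite (le_trans (coord_le_nr2 _ _))// lerDr.
Qed.

(** The majorant is uniform in [eps] and in bounded [s], as dominated convergence requires. The last
    condition excludes the origin when [eps > 0]: there [wt] is 1 by the convention for the inverse
    of 0, while [1 / rho] is [eps^(-1/2)]. *)
Lemma ev_bound e (M : R) : exists2 C, 0 <= C &
  forall (eps s : R) (x : E), 0 <= eps -> `|s| <= M -> nr2 x <= 1 -> (nr2 x = 0 -> eps = 0) ->
  `|ev eps s e x| <= C * wt x ^+ pole e.
Proof.
elim: e M => /=.
- by move=> c M; exists `|c| => // eps s x *; rewrite expr0 mulr1.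
- move=> i M; exists 1 => // eps s x *; rewrite expr0 mulr1.
  exact: nr2_cube.
- move=> i M; exists 1 => // eps s x e0 *; rewrite expr0 mulr1; exact: Yc_le1.
- move=> M; exists 1 => // eps s x e0 _ _ x0; rewrite mul1r expr1.
  rewrite ger0_norm ?invr_ge0 ?sqrtr_ge0//.
  by rewrite (le_trans (rho_inv_le e0 x0))// lerDr.
- move=> M; exists 1 => // eps s x _ _ x1 _; rewrite mul1r expr0.
  have := nr2_ge0 x; rewrite ler_norml; lra.
- move=> n M; exists n`!%:R => // eps s x *; rewrite expr0 mulr1.
  by rewrite ger0_norm ?flat_ge0// flat_le.
- by move=> M; exists `|M| => // eps s x _ sM *; rewrite expr0 mulr1 (le_trans sM)// ler_norm.
- move=> M; exists 1 => // eps s x *; rewrite mul1r expr0 ler_norml sin_geN1 sin_le1//.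
- move=> M; exists 1 => // eps s x *; rewrite mul1r expr0 ler_norml cos_geN1 cos_le1//.
- move=> e1 h1 e2 h2 M; have [C1 C10 H1] := h1 M; have [C2 C20 H2] := h2 M.
  exists (C1 + C2); first exact: addr_ge0.
  move=> eps s x e0 sM x1 x0; rewrite (le_trans (ler_normD _ _))// mulrDl lerD//.
    by rewrite (le_trans (H1 _ _ _ e0 sM x1 x0))// ler_wpM2l// ler_weXn2l ?wt_ge1// leq_maxl.
  by rewrite (le_trans (H2 _ _ _ e0 sM x1 x0))// ler_wpM2l// ler_weXn2l ?wt_ge1// leq_maxr.
- move=> e1 h1 e2 h2 M; have [C1 C10 H1] := h1 M; have [C2 C20 H2] := h2 M.
  exists (C1 * C2); first exact: mulr_ge0.
  by move=> eps s x e0 sM x1 x0; rewrite normrM exprD mulrACA ler_pM// ?H1// H2.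
- move=> c e h M; have [C C0 H] := h `|c|.
  by exists C => // eps s x e0 _ x1 x0; exact: H.
Qed.

Lemma ev_cvg (s : R) e (x : E) : nr2 x != 0 -> ev (n.+1%:R^-1) s e x @[n --> \oo] --> ev 0 s e x.
Proof.
move=> x0.
have cr : (rho (n.+1%:R^-1) x)^-1 @[n --> \oo] --> (rho 0 x)^-1.
  have rn : rho 0 x != 0 by rewrite gt_eqF// rho_gt0// add0r lt_neqAle eq_sym x0 nr2_ge0.
  apply: cvgV => //.
  apply: (@continuous_cvg _ _ _ _ _ _ Num.sqrt); first exact: sqrt_continuous.
  by apply: cvgD; [exact: cvg_harmonic|exact: cvg_cst].
elim: e s => /=; try by move=> *; exact: cvg_cst.
- by move=> i s; apply: cvgM => //; exact: cvg_cst.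
- by [].
- by move=> e1 h1 e2 h2 s; exact: cvgD.
- by move=> e1 h1 e2 h2 s; exact: cvgM.
- by move=> c e h s; exact: h.
Qed.

Lemma pd_ev (eps s : R) e k (x : E) : 0 < eps + nr2 x -> pd k (ev eps s e) x = ev eps s (dX k e) x.
Proof. by move=> x0; have [] := is_derive_ev s e k x0. Qed.

Lemma pd_evE (eps s : R) e k : 0 < eps -> pd k (ev eps s e) = ev eps s (dX k e).
Proof. by move=> e0; apply/funext => x; rewrite pd_ev// ltr_wpDr// nr2_ge0. Qed.

Lemma smooth_ev (eps s : R) e : 0 < eps -> smooth (ev eps s e).
Proof.
move=> e0 l.
have -> : foldr (@pd R m) (ev eps s e) l = ev eps s (foldr dX e l).
  by elim: l => //= k l ->; rewrite pd_evE.
split; first exact: continuous_ev.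
move=> k x; have x0 : 0 < eps + nr2 x by rewrite ltr_wpDr// nr2_ge0.
by have [] := is_derive_ev s (foldr dX e l) k x0.
Qed.
End expressions.

(** * Integrals with a singularity at the origin *)

Section integration_on_ball.
Context (R : realType) (m : nat).
Local Notation E := 'rV[R]_m.
Local Notation leb := (@lebesgue_rV R m).
Local Notation B := (@uball R m).
Local Notation ex := (ex R m).

Definition ball_integrable (f : E -> R) := leb.-integrable B (EFin \o f).
Definition ball_int (f : E -> R) : R := \int[leb]_(x in B) f x.

Lemma eq_ball_int (f g : E -> R) : (forall x, B x -> f x = g x) -> ball_int f = ball_int g.
Proof. by move=> fg; apply: eq_Rintegral => x /set_mem; exact: fg. Qed.

Lemma eq_ball_integrable (f g : E -> R) : (forall x, B x -> f x = g x) ->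
  ball_integrable f -> ball_integrable g.
Proof.
move=> fg; apply: eq_integrable; first exact: measurable_uball.
by move=> x /set_mem Bx /=; rewrite fg.
Qed.

Lemma le_ball_integrable (f g : E -> R) : measurable_fun B f ->
  (forall x, B x -> `|f x| <= g x) -> ball_integrable g -> ball_integrable f.
Proof.
move=> mf fg; apply: le_integrable; first exact: measurable_uball.
  exact/measurable_EFinP.
by move=> x Bx /=; rewrite lee_fin (le_trans (fg _ Bx))// ler_norm.
Qed.

Lemma ball_integrable_bounded (f : E -> R) (M : R) : measurable_fun B f ->
  (forall x, B x -> `|f x| <= M) -> ball_integrable f.
Proof.
move=> mf fM; apply: measurable_bounded_integrable => //.
- exact: measurable_uball.
- exact: lebesgue_uball_fin.
- exists M; split; first exact: num_real.
  by move=> x Mx y By /=; exact: le_trans (fM y By) (ltW Mx).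
Qed.

Lemma continuous_ball_integrable (f : E -> R) : continuous f -> ball_integrable f.
Proof.
move=> cf; have [M _ HM] := continuous_bounded_cube cf.
apply: (ball_integrable_bounded (M := M)).
  by apply: measurable_funTS; exact: continuous_measurable_rV.
by move=> x /uball_cube; exact: HM.
Qed.

Lemma ball_integrableD (f g : E -> R) :
  ball_integrable f -> ball_integrable g -> ball_integrable (fun x => f x + g x).
Proof. by move=> i1 i2; have := integrableD (@measurable_uball R m) i1 i2. Qed.

Lemma ball_integrableZ (c : R) (f : E -> R) : ball_integrable f -> ball_integrable (fun x => c * f x).
Proof. by move=> i1; have := integrableZl (@measurable_uball R m) c i1. Qed.

Lemma ball_integrable_sum (I : finType) (f : I -> E -> R) :
  (forall i, ball_integrable (f i)) -> ball_integrable (fun x => \sum_i f i x).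
Proof.
move=> fi; rewrite unlock; elim: (index_enum I) => [|i r IH] /=.
  by apply: (ball_integrable_bounded (M := 0)) => // x _; rewrite normr0.
by apply: ball_integrableD.
Qed.

Lemma ball_intD (f g : E -> R) : ball_integrable f -> ball_integrable g ->
  ball_int (fun x => f x + g x) = ball_int f + ball_int g.
Proof. by move=> i1 i2; apply: RintegralD => //; exact: measurable_uball. Qed.

Lemma ball_intZ (c : R) (f : E -> R) : ball_integrable f -> ball_int (fun x => c * f x) = c * ball_int f.
Proof. by move=> i1; apply: RintegralZl => //; exact: measurable_uball. Qed.

Lemma ball_int_sum (I : finType) (f : I -> E -> R) : (forall i, ball_integrable (f i)) ->
  ball_int (fun x => \sum_i f i x) = \sum_i ball_int (f i).
Proof.
move=> fi; rewrite unlock; elim: (index_enum I) => [|i r IH] /=.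
  by rewrite /ball_int /Rintegral integral0_eq.
rewrite ball_intD ?IH//.
elim: r {IH} => [|j r IH] /=.
  by apply: (ball_integrable_bounded (M := 0)) => // x _; rewrite normr0.
exact: ball_integrableD.
Qed.

Lemma le_ball_int (f g : E -> R) : ball_integrable f -> ball_integrable g ->
  (forall x, B x -> f x <= g x) -> ball_int f <= ball_int g.
Proof. by move=> i1 i2 fg; apply: le_Rintegral => //; exact: measurable_uball. Qed.

Lemma ball_int_EFin (f : E -> R) : ball_integrable f -> (\int[leb]_(x in B) (f x)%:E = (ball_int f)%:E)%E.
Proof.
move=> fi; rewrite /ball_int /Rintegral fineK//.
by apply: integrable_fin_num => //; exact: measurable_uball.
Qed.

Lemma ball_int_pd_eq0 (k : 'I_m) (f : E -> R) :
  continuous f -> (forall x, derivable f x (delta_mx ord0 k : E)) ->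
  continuous (pd k f) -> (forall x, nr2 x = 1 -> f x = 0) ->
  ball_int (pd k f) = 0.
Proof. by move=> *; rewrite /ball_int /Rintegral integral_pd_eq0. Qed.

Lemma measurable_nr2_eq0 : measurable [set x : E | nr2 x = 0].
Proof.
have := @measurable_nr2 R m measurableT [set 0] (measurable_set1 0).
by rewrite setTI.
Qed.

Lemma cube0_null : (0 < m)%N -> leb [set x | nr2 x = 0] = 0%E.
Proof.
move=> m0; apply/eqP; rewrite eq_le measure_ge0 andbT.
have <- : leb (cube m 0) = 0%E.
  by rewrite lebesgue_rV_cube// mulr0 expr0n; case: m m0.
apply: le_measure; rewrite ?inE; last first.
- move=> x /= x0 i; have := coord_le_nr2 x i; rewrite x0 => h.
  have /eqP : x ord0 i ^+ 2 = 0 by apply/eqP; rewrite eq_le h sqr_ge0.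
  by rewrite sqrf_eq0 => /eqP ->; rewrite normr0.
- exact: measurable_cube.
exact: measurable_nr2_eq0.
Qed.

Lemma ae_nr2_neq0 : (0 < m)%N -> {ae leb, forall x, nr2 x != 0}.
Proof.
move=> m0; exists [set x | nr2 x = 0]; split.
- exact measurable_nr2_eq0.
- exact: cube0_null.
- by move=> x /= /negP/negPn/eqP.
Qed.

(* The divergence of [x rho^-4 (1 - |x|^2)] is at least [rho^-4 / 2] up to a
   constant, uniformly in [eps]. *)
Lemma ball_int_rho4_le (eps : R) : (5 <= m)%N -> 0 < eps ->
  ball_int (fun x => (rho eps x)^-1 ^+ 4) <= (m%:R - 2) ^+ 2 * ball_int (fun=> 1).
Proof.
move=> m5 e0.
pose G (k : 'I_m) : ex := Mul (Xc _ k) (Mul (pw (Ri R m) 4) (Uc R m)).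
have M5 : (5 : R) <= m%:R by rewrite ler_nat.
have cG k : continuous (ev 0 eps 0 (G k)) by exact: continuous_ev.
have cdG k : continuous (ev 0 eps 0 (dX k (G k))) by exact: continuous_ev.
have iG k : ball_int (ev 0 eps 0 (dX k (G k))) = 0.
  rewrite -pd_evE//; apply: ball_int_pd_eq0.
  - exact: cG.
  - move=> x; have x0 : 0 < eps + nr2 x by rewrite ltr_wpDr// nr2_ge0.
    by have [] := is_derive_ev 0 0 (G k) k x0.
  - by rewrite pd_evE.
  - by move=> x x1; rewrite /= x1 subrr !mulr0.
have cr' : continuous (fun x : E => (rho eps x)^-1 ^+ 4).
  rewrite (_ : (fun x => _) = ev 0 eps 0 (pw (Ri R m) 4)); first exact: continuous_ev.
  by apply/funext => x; rewrite ev_pw.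
have i1 := continuous_ball_integrable cr'.
have ic : ball_integrable (fun=> 1) by apply: continuous_ball_integrable; exact: cont_cst.
pose c : R := (m%:R - 2) ^+ 2.
have : ball_int (fun x => 2^-1 * (rho eps x)^-1 ^+ 4 + (- (c / 2)) * 1) <=
       ball_int (fun x => \sum_k ev 0 eps 0 (dX k (G k)) x).
  apply: le_ball_int.
  - by apply: ball_integrableD; exact: ball_integrableZ.
  - by apply: ball_integrable_sum => k; exact: continuous_ball_integrable.
  move=> x; rewrite uballE /= => x1.
  have x0 := nr2_ge0 x.
  have e0' : 0 < eps + nr2 x by lra.
  have := rho_sqr (ltW e0'); have := rho_gt0 e0'; move: (rho eps x) => r r0 r2.
  have rn : r != 0 by rewrite gt_eqF.
  under eq_bigr => k _ do rewrite eqxx.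
  set P := r^-1 ^+ 2.
  have P0 : 0 <= P by exact: sqr_ge0.
  have rP : nr2 x * P <= 1.
    rewrite /P exprVn ler_pdivrMr ?exprn_gt0// mul1r; lra.
  have -> : \sum_k (1%:R * (r^-1 * (r^-1 * (r^-1 * (r^-1 * 1))) * (1 - nr2 x)) +
      x ord0 k * ((-1 * (x ord0 k * r^-1 * (r^-1 * r^-1)) * (r^-1 * (r^-1 * (r^-1 * 1))) +
        r^-1 * (-1 * (x ord0 k * r^-1 * (r^-1 * r^-1)) * (r^-1 * (r^-1 * 1)) +
        r^-1 * (-1 * (x ord0 k * r^-1 * (r^-1 * r^-1)) * (r^-1 * 1) +
        r^-1 * (-1 * (x ord0 k * r^-1 * (r^-1 * r^-1)) * 1 + r^-1 * 0)))) * (1 - nr2 x) +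
        r^-1 * (r^-1 * (r^-1 * (r^-1 * 1))) * (-2 * x ord0 k))) =
     m%:R * P ^+ 2 * (1 - nr2 x) + nr2 x * (- 4 * P ^+ 3 * (1 - nr2 x) - 2 * P ^+ 2).
    rewrite big_split /= sumr_const card_ord -mulr_natl; congr (_ + _).
      by rewrite /P; ring.
    set K := _ - 2 * P ^+ 2; rewrite [in RHS]/nr2 mulr_suml.
    by apply: eq_bigr => k _; rewrite /K /P; ring.
  have -> : r^-1 ^+ 4 = P ^+ 2 by rewrite -exprM.
  (* With [t = |x|^2] and [t P <= 1] the divergence is at least [(m - 4) P^2 - (m - 2) P]. As
     [m >= 5] this is at least [P^2 - (m - 2) P], and the square in [h4] absorbs the linear term at
     the price of half of [P^2]. *)
  have h1 : 0 <= P * (1 - nr2 x * P) by rewrite mulr_ge0// subr_ge0.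
  have h2 : 0 <= P ^+ 2 * (1 - nr2 x * P) * (1 - nr2 x).
    by apply: mulr_ge0; [apply: mulr_ge0; rewrite ?sqr_ge0 ?subr_ge0|lra].
  have h3 : 0 <= (m%:R - 5) * P ^+ 2 by rewrite mulr_ge0 ?sqr_ge0// subr_ge0.
  have h4 : 0 <= (P - (m%:R - 2)) ^+ 2 by exact: sqr_ge0.
  have h5 : 0 <= (m%:R - 4) * (P * (1 - nr2 x * P)).
    by rewrite mulr_ge0//; lra.
  rewrite /c; nra.
rewrite ball_int_sum; last by move=> k; exact: continuous_ball_integrable.
rewrite big1; last by move=> k _; exact: iG.
rewrite ball_intD; [|exact: ball_integrableZ..].
rewrite !ball_intZ// -/c; move: (ball_int _) (ball_int _) c => I0 I4 c' h.
have -> : c' * I0 = 2 * (c' / 2 * I0) by field.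
lra.
Qed.
(** Fatou's lemma along [eps = 1 / (n + 1)] passes the uniform bound on the integrals of [rho^-4] to
    [r^-4]; this replaces polar coordinates. *)
Lemma ball_integrable_wt4 : (5 <= m)%N -> ball_integrable (fun x : E => wt x ^+ 4).
Proof.
move=> m5; have ri (n : nat) : n.+1%:R^-1 > 0 :> R by rewrite invr_gt0.
pose F (n : nat) (x : E) : \bar R := ((rho n.+1%:R^-1 x)^-1 ^+ 4)%:E.
have mF n : measurable_fun setT (fun x : E => (rho n.+1%:R^-1 x)^-1 ^+ 4).
  rewrite (_ : (fun x => _) = ev 0 n.+1%:R^-1 0 (pw (Ri R m) 4)).
    by apply: measurable_ev; exact: ltW.
  by apply/funext => x; rewrite ev_pw.
have cF n : continuous (fun x : E => (rho n.+1%:R^-1 x)^-1 ^+ 4).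
  rewrite (_ : (fun x => _) = ev 0 n.+1%:R^-1 0 (pw (Ri R m) 4)).
    by apply: continuous_ev.
  by apply/funext => x; rewrite ev_pw.
have iF n : (\int[leb]_(x in B) F n x <= ((m%:R - 2) ^+ 2 * ball_int (fun=> 1))%:E)%E.
  rewrite [leLHS](ball_int_EFin (continuous_ball_integrable (@cF n))) lee_fin.
  exact: (ball_int_rho4_le m5 (ri n)).
have mr : measurable_fun B (fun x : E => (enorm x)^-1 ^+ 4).
  apply: (eq_measurable_fun (ev 0 0 0 (pw (Ri R m) 4))).
    by move=> x _; rewrite ev_pw /= /rho add0r.
  by apply: measurable_funTS; exact: measurable_ev.
have ir : ball_integrable (fun x : E => (enorm x)^-1 ^+ 4).
  apply/integrableP; split; first exact/measurable_EFinP.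
  apply: (@le_lt_trans _ _ ((m%:R - 2) ^+ 2 * ball_int (fun=> 1))%:E); last exact: ltry.
  apply: (@le_trans _ _ (\int[leb]_(x in B) limn_einf (F ^~ x))%E).
    apply: ge0_le_integral => //.
    - exact: measurable_uball.
    - by apply: measurableT_comp => //; exact/measurable_EFinP.
    - rewrite /limn_einf; apply: measurableT_comp => //.
      apply: measurable_fun_limn_esup => n; apply: measurableT_comp => //.
      by apply/measurable_EFinP; apply: measurable_funTS.
    (* At the origin the left side is 0 by convention and lies below any limit inferior of
       nonnegative terms; elsewhere the sequence converges. *)
    - move=> x Bx /=; have [x0|x0] := eqVneq (nr2 x) 0.
        have -> : enorm x = 0 by rewrite -[enorm x]/(Num.sqrt (nr2 x)) x0 sqrtr0.
        rewrite invr0 expr0n /= limn_einf_lim.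
        apply: lime_ge; first exact: is_cvg_einfs.
        near=> n; apply: le_ereal_inf_tmp => _ [k _ <-].
        rewrite /F lee_fin mulr0n normr0; by rewrite exprn_ge0// invr_ge0 sqrtr_ge0.
      rewrite ger0_norm ?exprn_ge0 ?invr_ge0 ?enorm_ge0//.
      suff /cvg_limn_einf_sup[-> _] : F n x @[n --> \oo] --> ((enorm x)^-1 ^+ 4)%:E by [].
      apply: cvg_EFin; first exact: nearW.
      have -> : (enorm x)^-1 ^+ 4 = ev 0 0 0 (pw (Ri R m) 4) x by rewrite ev_pw /= /rho add0r.
      rewrite (_ : _ \o _ = fun n => ev 0 n.+1%:R^-1 0 (pw (Ri R m) 4) x); first exact: ev_cvg.
      by apply/funext => n; rewrite ev_pw.
  apply: (le_trans (fatou _ _ _ _)).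
  - exact: measurable_uball.
  - by move=> n; apply/measurable_EFinP; apply: measurable_funTS.
  - by move=> n x _; rewrite lee_fin exprn_ge0// invr_ge0 sqrtr_ge0.
  rewrite limn_einf_lim; apply: lime_le; first exact: is_cvg_einfs.
  near=> n; apply: le_trans (iF n); apply: ereal_inf_lbound.
  by exists n => /=.
apply: (@le_ball_integrable _ (fun x => 8 * (1 + (enorm x)^-1 ^+ 4))).
- apply: (eq_measurable_fun (ev 0 0 0 (pw (Add (Cst m 1) (Ri R m)) 4))).
    by move=> x _; rewrite ev_pw /= /rho add0r.
  by apply: measurable_funTS; exact: measurable_ev.
- move=> x _; rewrite /wt; have : 0 <= (enorm x)^-1 by rewrite invr_ge0 enorm_ge0.
  move: (_^-1) => a a0; rewrite ger0_norm ?exprn_ge0 ?addr_ge0//.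
  (* This product is [8 (1 + a^4) - (1 + a)^4]. *)
  have h : 0 <= (a - 1) ^+ 2 * (7 * a ^+ 2 + 10 * a + 7).
    by rewrite mulr_ge0 ?sqr_ge0// !addr_ge0// mulr_ge0// sqr_ge0.
  rewrite -subr_ge0; move: h; congr (_ <= _); ring.
apply: ball_integrableZ; apply: ball_integrableD => //.
by apply: continuous_ball_integrable; exact: cont_cst.
Unshelve. all: by end_near. Qed.

Lemma wt_le4 (k : nat) (x : E) : (k <= 4)%N -> wt x ^+ k <= wt x ^+ 4.
Proof. by move=> k4; rewrite ler_weXn2l// wt_ge1. Qed.

Lemma ball_integrable_wt (g : E -> R) (C : R) (k : nat) : (5 <= m)%N -> (k <= 4)%N ->
  measurable_fun B g -> (forall x, B x -> `|g x| <= C * wt x ^+ k) -> ball_integrable g.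
Proof.
move=> m5 k4 mg gC; apply: (le_ball_integrable (g := fun x => `|C| * wt x ^+ 4)) => //.
  move=> x Bx; rewrite (le_trans (gC x Bx))// (@le_trans _ _ (`|C| * wt x ^+ k))//.
    by rewrite ler_wpM2r ?ler_norm// exprn_ge0// (le_trans _ (wt_ge1 x)).
  by rewrite ler_wpM2l// wt_le4.
exact: (ball_integrableZ `|C| (ball_integrable_wt4 m5)).
Qed.

End integration_on_ball.

(** * The limit [eps -> 0] and weak derivatives *)

Section singular_integrals.
Context (R : realType) (m : nat) (m5 : (5 <= m)%N) (beta : R).
Local Notation E := 'rV[R]_m.
Local Notation leb := (@lebesgue_rV R m).
Local Notation B := (@uball R m).
Local Notation ex := (ex R m).
Local Notation ev := (ev beta).
Implicit Types (e : ex) (s : R) (f g : E -> R).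

Lemma measurable_evB s e : measurable_fun B (ev 0 s e).
Proof. by apply: measurable_funTS; exact: measurable_ev. Qed.

Lemma uball_nr2 (x : E) : B x -> nr2 x <= 1.
Proof. by rewrite uballE => /ltW. Qed.

Lemma ev_boundB s e : exists2 C, 0 <= C &
  forall x, B x -> `|ev 0 s e x| <= C * wt x ^+ pole e.
Proof.
have [C C0 H] := ev_bound beta e `|s|; exists C => // x Bx.
by apply: H => //; exact: uball_nr2.
Qed.

Lemma ball_integrable_ev s e : (pole e <= 4)%N -> ball_integrable (ev 0 s e).
Proof.
move=> e4; have [C C0 H] := ev_boundB s e.
by apply: (ball_integrable_wt m5 e4 _ H); exact: measurable_evB.
Qed.

Lemma ball_integrable_evM s e g (C : R) (k : nat) : (pole e + k <= 4)%N ->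
  measurable_fun B g -> (forall x, B x -> `|g x| <= C * wt x ^+ k) ->
  ball_integrable (fun x => ev 0 s e x * g x).
Proof.
move=> e4 mg gC; have [C' C0 H] := ev_boundB s e.
apply: (@ball_integrable_wt _ _ _ (C' * C) _ m5 e4).
  by apply: measurable_funM => //; exact: measurable_evB.
by move=> x Bx; rewrite normrM exprD mulrACA ler_pM// ?H ?gC.
Qed.

(** Dominated convergence with majorant a multiple of [wt^4]. The factor [g] is a test function or 1
    ([k = 0]), or the singular function itself when convergence in L^2 is at stake. *)
Lemma ball_int_ev_cvg s e g (C : R) (k : nat) : (pole e + k <= 4)%N ->
  measurable_fun B g -> (forall x, B x -> `|g x| <= C * wt x ^+ k) ->
  ball_int (fun x => ev n.+1%:R^-1 s e x * g x) @[n --> \oo] -->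
  ball_int (fun x => ev 0 s e x * g x).
Proof.
move=> e4 mg gC; have [C' C'0 H] := ev_bound beta e `|s|.
have m0 : (0 < m)%N by exact: leq_trans m5.
have ae0 := ae_nr2_neq0 R m0.
have n0 (n : nat) : 0 <= n.+1%:R^-1 :> R by rewrite invr_ge0.
have mn (n : nat) : measurable_fun B (fun x => ev n.+1%:R^-1 s e x * g x).
  by apply: measurable_funM => //; apply: measurable_funTS; exact: measurable_ev.
have [] := @dominated_convergence _ _ R leb B (@measurable_uball R m)
  (fun n x => (ev n.+1%:R^-1 s e x * g x)%:E) (fun x => (ev 0 s e x * g x)%:E)
  (fun x => (C' * `|C| * wt x ^+ 4)%:E).
- by move=> n; exact/measurable_EFinP.
- apply/measurable_EFinP; apply: measurable_funM => //; exact: measurable_evB.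
- apply: filterS ae0 => x x0 Bx; apply: cvg_EFin; first exact: nearW.
  by apply: cvgM; [exact: ev_cvg|exact: cvg_cst].
- exact: (ball_integrableZ (C' * `|C|) (@ball_integrable_wt4 R m m5)).
- apply: filterS ae0 => x x0 n Bx; rewrite lee_fin normrM.
  have h1 : `|ev n.+1%:R^-1 s e x| <= C' * wt x ^+ pole e.
    by apply: H => //; [exact: uball_nr2|move=> x00; rewrite x00 eqxx in x0].
  have w0 : 0 <= wt x by exact: le_trans (wt_ge1 x).
  have h2 : `|g x| <= `|C| * wt x ^+ k.
    by rewrite (le_trans (gC _ Bx))// ler_wpM2r ?ler_norm// exprn_ge0.
  rewrite (le_trans (ler_pM _ _ h1 h2))// mulrACA -exprD ler_wpM2l ?mulr_ge0//.
  exact: wt_le4.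
move=> i0 _ H3; rewrite /ball_int /Rintegral.
apply: fine_cvg; rewrite fineK//.
by apply: integrable_fin_num => //; exact: measurable_uball.
Qed.

Lemma test_fun_pd k f : test_fun f -> test_fun (pd k f).
Proof.
move=> [sf [K [cK KB f0]]]; split.
  by move=> l; have := sf (rcons l k); rewrite foldr_rcons.
exists K; split=> // x xK.
have cl : closed K by apply: compact_closed => //; exact: norm_hausdorff.
have nK : \near x, 0 = f x.
  have : nbhs x (~` K) by apply: open_nbhs_nbhs; split => //; exact: closed_openC.
  by apply: filterS => y yK; rewrite f0.
rewrite /pd -(near_eq_derive _ nK).
exact: derive_cst.
Qed.

Lemma test_fun_cont f : test_fun f -> continuous f.
Proof. by move=> [sf _]; have [] := sf [::]. Qed.

Lemma test_fun_derivable f k (x : E) : test_fun f -> derivable f x (delta_mx ord0 k : E).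
Proof. by move=> [sf _]; have [_] := sf [::]; exact. Qed.

Lemma test_fun_sphere f (x : E) : test_fun f -> nr2 x = 1 -> f x = 0.
Proof.
move=> [_ [K [_ KB f0]]] x1; apply: f0 => /KB; rewrite uballE /= x1.
by rewrite ltxx.
Qed.

Lemma test_fun_bound f : test_fun f -> exists2 C, 0 <= C & forall x, B x -> `|f x| <= C * wt x ^+ 0.
Proof.
move=> /test_fun_cont/continuous_bounded_cube [C C0 H]; exists C => // x Bx.
by rewrite mulr1; apply: H; exact: uball_cube.
Qed.

Lemma test_fun_measurable f : test_fun f -> measurable_fun B f.
Proof. by move=> /test_fun_cont cf; apply: measurable_funTS; exact: continuous_measurable_rV. Qed.

(** For [eps > 0] the two integrals add up to that of a partial derivative of a function vanishing
    on the sphere. Pole 3 leaves the derivative with pole 4, so both integrals pass to the limit and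
    no Dirac mass appears at the origin. *)
Lemma weak_pd_ev s e k : (pole e <= 3)%N -> weak_pd k (ev 0 s e) (ev 0 s (dX k e)).
Proof.
move=> e3 phi tphi.
have tphi' := test_fun_pd k tphi.
have e4 : (pole (dX k e) + 0 <= 4)%N by rewrite addn0 (leq_trans (pole_dX _ _)).
have e3' : (pole e + 0 <= 4)%N by rewrite addn0 ltnW.
have [C C0 HC] := test_fun_bound tphi; have [C' C'0 HC'] := test_fun_bound tphi'.
have c1 := ball_int_ev_cvg (s := s) e4 (test_fun_measurable tphi) HC.
have c2 := ball_int_ev_cvg (s := s) e3' (test_fun_measurable tphi') HC'.
apply/eqP; rewrite -addr_eq0; apply/eqP.
rewrite -(cvg_lim (@Rhausdorff R) (cvgD c2 c1)).
apply/lim_near_cst => //; apply: nearW => n /=.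
have n0 : 0 < n.+1%:R^-1 :> R by rewrite invr_gt0.
have cM f1 f2 : continuous f1 -> continuous f2 -> ball_integrable (fun x => f1 x * f2 x).
  by move=> ? ?; apply: continuous_ball_integrable; exact: contM.
rewrite fctE/= -ball_intD; last 2 first.
- by apply: cM; [exact: continuous_ev|exact: test_fun_cont].
- by apply: cM; [exact: continuous_ev|exact: test_fun_cont].
have dprod x : is_derive x (delta_mx ord0 k : E) (fun x => ev n.+1%:R^-1 s e x * phi x)
    (ev n.+1%:R^-1 s e x * pd k phi x + ev n.+1%:R^-1 s (dX k e) x * phi x).
  have x0 : 0 < n.+1%:R^-1 + nr2 x by rewrite ltr_wpDr// nr2_ge0.
  have dphi : is_derive x (delta_mx ord0 k : E) phi (pd k phi x).
    by split => //; exact: test_fun_derivable.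
  have := is_deriveM (is_derive_ev beta s e k x0) dphi; congr is_derive.
  by rewrite -![_ *: _]/(_ * _) [phi x * _]mulrC.
have pdE : pd k (fun x => ev n.+1%:R^-1 s e x * phi x) = fun x =>
    ev n.+1%:R^-1 s e x * pd k phi x + ev n.+1%:R^-1 s (dX k e) x * phi x.
  by apply/funext => x; have [] := dprod x.
rewrite -pdE; apply: ball_int_pd_eq0.
- by apply: contM; [exact: continuous_ev|exact: test_fun_cont].
- by move=> x; have [] := dprod x.
- by rewrite pdE; apply: contD; apply: contM; do ?exact: continuous_ev; exact: test_fun_cont.
- by move=> x x1; rewrite (test_fun_sphere tphi x1) mulr0.
Qed.

Lemma L2_ev s e : (pole e <= 2)%N -> L2 (ev 0 s e).
Proof.
move=> e2; split; first exact: measurable_evB.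
have i : ball_integrable (ev 0 s (Mul e e)) by apply: ball_integrable_ev => /=; rewrite (leq_add e2 e2).
rewrite (_ : (fun x => _) = fun x => (ev 0 s (Mul e e) x)%:E); last first.
  by apply/funext => x; rewrite /= expr2.
by rewrite ball_int_EFin// ltry.
Qed.

Lemma W12_jet_ev s e : (pole e <= 1)%N -> W12_jet (ev 0 s e) (fun k => ev 0 s (dX k e)).
Proof.
move=> e1; split; first by apply: L2_ev; rewrite (leq_trans e1).
move=> k; split; first by apply: L2_ev; rewrite (leq_trans (pole_dX _ _)).
by apply: weak_pd_ev; rewrite (leq_trans e1).
Qed.

Lemma W22_jet_ev s e : (pole e <= 0)%N ->
  W22_jet (ev 0 s e) (fun k => ev 0 s (dX k e)) (fun k l => ev 0 s (dX l (dX k e))).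
Proof.
move=> e0; split; first by apply: W12_jet_ev; rewrite (leq_trans e0).
by move=> k; apply: W12_jet_ev; rewrite (leq_trans (pole_dX _ _)).
Qed.

Lemma ball_int_dX_eq0 s e k : (pole e <= 3)%N ->
  (forall eps x, nr2 x = 1 -> ev eps s e x = 0) -> ball_int (ev 0 s (dX k e)) = 0.
Proof.
move=> e3 e0; have e4 : (pole (dX k e) + 0 <= 4)%N by rewrite addn0 (leq_trans (pole_dX _ _)).
have m1 : measurable_fun B (fun=> 1 : R) by [].
have H1 x : B x -> `|1 : R| <= 1 * wt x ^+ 0 by rewrite mulr1 normr1.
have E0 (eps : R) : ball_int (fun x => ev eps s (dX k e) x * 1) = ball_int (ev eps s (dX k e)).
  by congr ball_int; apply/funext => x; rewrite mulr1.
rewrite -E0 -(cvg_lim (@Rhausdorff R) (ball_int_ev_cvg (s := s) e4 m1 H1)).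
apply/lim_near_cst => //; apply: nearW => n /=.
have n0 : 0 < n.+1%:R^-1 :> R by rewrite invr_gt0.
rewrite E0 -pd_evE//; apply: ball_int_pd_eq0.
- exact: continuous_ev.
- move=> x; have x0 : 0 < n.+1%:R^-1 + nr2 x by rewrite ltr_wpDr// nr2_ge0.
  by have [] := is_derive_ev beta s e k x0.
- by rewrite pd_evE//; exact: continuous_ev.
- by move=> x; exact: e0.
Qed.

End singular_integrals.

(** * The map v *)

Lemma big_option (V : nmodType) (T : finType) (F : option T -> V) :
  \sum_a F a = F None + \sum_p F (Some p).
Proof.
rewrite (bigD1 None)//=; congr (_ + _).
rewrite (reindex_omap Some id) /=; last by case.
by apply: eq_bigl => p; rewrite eqxx.
Qed.

Lemma sum_delta (V : pzRingType) (n : nat) (j : 'I_n) (F : 'I_n -> V) :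
  \sum_k (j == k)%:R * F k = F j.
Proof.
rewrite (bigD1 j)//= eqxx mul1r big1 ?addr0// => k kj.
by rewrite eq_sym (negPf kj) mul0r.
Qed.

Section differential_identities.
Context (R : realType) (m : nat) (beta : R).
Local Notation E := 'rV[R]_m.
Local Notation ex := (ex R m).
Local Notation ev := (ev beta).
Implicit Types (e : ex) (s : R).

Definition Sum (I : finType) (F : I -> ex) : ex := \big[@Add R m/Cst m 0]_i F i.

Lemma ev_Sum eps s (I : finType) (F : I -> ex) x :
  ev eps s (Sum F) x = \sum_i ev eps s (F i) x.
Proof. exact: (big_morph (fun e => ev eps s e x)). Qed.

Lemma dX_Sum k (I : finType) (F : I -> ex) : dX k (Sum F) = Sum (fun i => dX k (F i)).
Proof. exact: (big_morph (dX k)). Qed.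

Lemma pole_Sum (I : finType) (F : I -> ex) n : (forall i, (pole (F i) <= n)%N) ->
  (pole (Sum F) <= n)%N.
Proof.
move=> Fn; rewrite /Sum; apply: (big_ind (fun e => (pole e <= n)%N)) => //= e1 e2 h1 h2.
by rewrite geq_max h1.
Qed.

(** Relations such as [sum_Y2] are equalities of values at [eps = 0], not of expressions. The
    punctured space being open, such a relation may still be differentiated by applying [dX] to both
    sides. *)
Lemma ev_dX_eq s e1 e2 k (x : E) :
  (forall y, nr2 y != 0 -> ev 0 s e1 y = ev 0 s e2 y) -> nr2 x != 0 ->
  ev 0 s (dX k e1) x = ev 0 s (dX k e2) x.
Proof.
move=> e12 x0; have x0' : 0 < 0 + nr2 x by rewrite add0r lt_neqAle eq_sym x0 nr2_ge0.
have [_ <-] := is_derive_ev beta s e1 k x0'.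
have [_ <-] := is_derive_ev beta s e2 k x0'.
apply: near_eq_derive.
have : nbhs x [set y : E | nr2 y != 0].
  apply: open_nbhs_nbhs; split => //.
  have -> : [set y : E | nr2 y != 0] = (@nr2 R m) @^-1` [set~ 0].
    by apply/seteqP; split => y /= /eqP.
  apply: open_comp => [y _|]; first exact: continuous_nr2.
  exact/closed_openC/accessible_closed_set1/hausdorff_accessible/Rhausdorff.
by apply: filterS => y y0; exact: e12.
Qed.

Definition grad2 s e1 e2 (x : E) : R := \sum_k ev 0 s (dX k e1) x * ev 0 s (dX k e2) x.
Definition lapl s e (x : E) : R := \sum_k ev 0 s (dX k (dX k e)) x.

Lemma grad2C s e1 e2 x : grad2 s e1 e2 x = grad2 s e2 e1 x.
Proof. by apply: eq_bigr => k _; rewrite mulrC. Qed.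

Lemma grad2M s a b e x :
  grad2 s (Mul a b) e x = ev 0 s a x * grad2 s b e x + ev 0 s b x * grad2 s a e x.
Proof. by rewrite /grad2 !mulr_sumr -big_split; apply: eq_bigr => k _ /=; ring. Qed.

Lemma grad2D s a b e x : grad2 s (Add a b) e x = grad2 s a e x + grad2 s b e x.
Proof. by rewrite /grad2 -big_split; apply: eq_bigr => k _ /=; ring. Qed.

Lemma grad2_Cst s c e x : grad2 s (Cst m c) e x = 0.
Proof. by rewrite /grad2 big1// => k _; rewrite mul0r. Qed.

Lemma laplM s a b x : lapl s (Mul a b) x =
  lapl s a x * ev 0 s b x + 2 * grad2 s a b x + ev 0 s a x * lapl s b x.
Proof.
by rewrite /lapl /grad2 !mulr_sumr mulr_suml -!big_split; apply: eq_bigr => k _ /=; ring.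
Qed.

Lemma laplD s a b x : lapl s (Add a b) x = lapl s a x + lapl s b x.
Proof. by rewrite /lapl -big_split. Qed.

Lemma lapl_Cst s c x : lapl s (Cst m c) x = 0.
Proof. by rewrite /lapl big1. Qed.

Section at_point.
Context (s : R) (x : E) (x0 : nr2 x != 0).
Local Notation y i := (ev 0 s (Yc R i) x).
Local Notation r1 := (ev 0 s (Ri R m) x).

Lemma sum_Y2 : \sum_i y i ^+ 2 = 1.
Proof.
have r0 : 0 < 0 + nr2 x by rewrite add0r lt_neqAle eq_sym x0 nr2_ge0.
under eq_bigr do rewrite /= exprMn.
rewrite -mulr_suml -/(nr2 x) exprVn rho_sqr ?ltW// add0r mulfV//.
Qed.

Lemma sum_Y2l (c : R) : \sum_i c * y i ^+ 2 = c.
Proof. by rewrite -mulr_sumr sum_Y2 mulr1. Qed.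

Lemma grad2_Y i j : grad2 s (Yc R i) (Yc R j) x = r1 ^+ 2 * ((i == j)%:R - y i * y j).
Proof.
rewrite /grad2.
transitivity (\sum_k ((i == k)%:R * ((j == k)%:R * r1 ^+ 2) + (i == k)%:R * (- r1 ^+ 2 * y j * y k)
   + (j == k)%:R * (- r1 ^+ 2 * y i * y k) + r1 ^+ 2 * y i * y j * y k ^+ 2)).
  by apply: eq_bigr => k _ /=; ring.
rewrite !big_split /= !sum_delta sum_Y2l eq_sym; ring.
Qed.

Lemma lapl_Y i : lapl s (Yc R i) x = - (m%:R - 1) * r1 ^+ 2 * y i.
Proof.
transitivity (\sum_k (r1 ^+ 2 * (- y i) + (i == k)%:R * (- 2 * r1 ^+ 2 * y k) +
   3 * r1 ^+ 2 * y i * y k ^+ 2)).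
  by apply: eq_bigr => k _ /=; rewrite eqxx /=; ring.
rewrite !big_split /= sum_delta sum_Y2l sumr_const card_ord -mulr_natl; ring.
Qed.

(** [x_i / r] is constant along rays, so its gradient is orthogonal to that of a radial function;
    the same holds with [Uc] below. *)
Lemma grad2_YR i : grad2 s (Yc R i) (Ri R m) x = 0.
Proof.
transitivity (\sum_k ((i == k)%:R * (- r1 ^+ 3 * y k) + r1 ^+ 3 * y i * y k ^+ 2)).
  by apply: eq_bigr => k _ /=; ring.
rewrite big_split /= sum_delta sum_Y2l; ring.
Qed.

Lemma grad2_YU i : grad2 s (Yc R i) (Uc R m) x = 0.
Proof.
have xk k : x ord0 k = rho 0 x * y k.
  have r0 : rho 0 x != 0 by rewrite gt_eqF// rho_gt0// add0r lt_neqAle eq_sym x0 nr2_ge0.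
  by rewrite /= mulrCA mulfV// mulr1.
transitivity (\sum_k ((i == k)%:R * (- 2 * r1 * rho 0 x * y k) + 2 * r1 * rho 0 x * y i * y k ^+ 2)).
  apply: eq_bigr => k _.
  have -> : ev 0 s (dX k (Uc R m)) x = -2 * (rho 0 x * y k) by rewrite -xk.
  by rewrite /=; ring.
rewrite big_split /= sum_delta sum_Y2l; ring.
Qed.

Lemma lapl_R2 : lapl s (Mul (Ri R m) (Ri R m)) x = - 2 * (m%:R - 4) * r1 ^+ 4.
Proof.
transitivity (\sum_k (- 2 * r1 ^+ 4 + 8 * r1 ^+ 4 * y k ^+ 2)).
  by apply: eq_bigr => k _ /=; rewrite eqxx /=; ring.
rewrite big_split /= sum_Y2l sumr_const card_ord -mulr_natl; ring.
Qed.

Definition vc : R := (Num.sqrt ((m%:R - 1) * (m%:R + 2)))^-1.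

Definition vex (p : 'I_m * 'I_m * 'I_m) : ex :=
  let: (i, j, k) := p in
  Mul (Cst m vc) (Add (Add (Add (Mul (Cst m (i == j)%:R) (Yc R k))
    (Mul (Cst m (j == k)%:R) (Yc R i))) (Mul (Cst m (i == k)%:R) (Yc R j)))
    (Mul (Cst m (- (m%:R + 2))) (Mul (Yc R i) (Mul (Yc R j) (Yc R k))))).

(** The eigenvalue [k (k + m - 2)] of the spherical harmonics of degree [k = 3], to which the
    components of [v] belong. *)
Definition lam : R := 3 * (m%:R + 1).

Lemma lapl_v p : lapl s (vex p) x = - lam * r1 ^+ 2 * ev 0 s (vex p) x.
Proof.
case: p => -[i j] k; rewrite /vex /lam.
rewrite !(laplM, laplD, lapl_Cst, grad2_Cst, grad2M, grad2D, lapl_Y).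
rewrite ![grad2 s (Yc R i) _ x]grad2C !(grad2M, grad2_Y).
rewrite ?(eq_sym j i) ?(eq_sym k i) ?(eq_sym k j) /=.
ring.
Qed.

Lemma grad2_v e p : (forall i, grad2 s (Yc R i) e x = 0) -> grad2 s (vex p) e x = 0.
Proof.
case: p => -[i j] k h; rewrite /vex !(grad2M, grad2D, grad2_Cst, h).
by rewrite !(mulr0, addr0).
Qed.

Lemma sum_v2 : (1 < m)%N -> \sum_p ev 0 s (vex p) x ^+ 2 = 1.
Proof.
move=> m1; have M1 : 1 < m%:R :> R by rewrite ltr1n.
pose N : R := m%:R + 2.
have vc2 : vc ^+ 2 * ((m%:R - 1) * N) = 1.
  by rewrite /vc exprVn sqr_sqrtr ?mulVf//; [rewrite mulf_neq0// gt_eqF// /N; lra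
    |rewrite mulr_ge0//; lra].
have d2 (b : bool) : b%:R ^+ 2 = b%:R :> R by case: b; rewrite ?expr1n ?expr0n.
pose Y i := y i.
transitivity (\sum_i \sum_j \sum_k vc ^+ 2 * ((i == j)%:R * Y k + (j == k)%:R * Y i + (i == k)%:R * Y j
   - N * (Y i * Y j * Y k)) ^+ 2).
  rewrite !pair_bigA /=; apply: eq_bigr => -[[i j] k] _ /=.
  by rewrite /Y /N /=; ring.
have sum3 i j : \sum_k vc ^+ 2 * ((i == j)%:R * Y k + (j == k)%:R * Y i + (i == k)%:R * Y j
   - N * (Y i * Y j * Y k)) ^+ 2 = vc ^+ 2 * ((i == j)%:R * (1 + (6 - 2 * N) * (Y i * Y j)) +
    (N ^+ 2 - 4 * N) * Y i ^+ 2 * Y j ^+ 2 + Y i ^+ 2 + Y j ^+ 2).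
  rewrite -mulr_sumr; congr (_ * _).
  set A : R := (i == j)%:R; have A2 : A ^+ 2 = A by exact: d2.
  transitivity (\sum_k ((A - N * (Y i * Y j)) ^+ 2 * Y k ^+ 2 + (j == k)%:R * (Y i ^+ 2 +
     2 * (A - N * (Y i * Y j)) * Y i * Y k + 2 * Y i * Y j * (i == k)%:R) +
     (i == k)%:R * (Y j ^+ 2 + 2 * (A - N * (Y i * Y j)) * Y j * Y k))).
    apply: eq_bigr => k _; have := d2 (j == k); have := d2 (i == k).
    move: (i == k)%:R (j == k)%:R => u w u2 w2.
    (* The Kronecker deltas are idempotent; their squares, produced by expanding the left side, have
       to be matched with the linear terms on the right. *)
    rewrite -[X in _ + X * (Y i ^+ 2 + _ + _) + _]w2 -[X in _ + _ + X * (Y j ^+ 2 + _)]u2.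
    have e1 : w ^+ 2 = w by [].
    ring: e1 u2.
  rewrite !big_split /= !sum_delta sum_Y2l -/A.
  ring: A2.
under eq_bigr => i _ do under eq_bigr => j _ do rewrite sum3.
have sum2 i : \sum_j vc ^+ 2 * ((i == j)%:R * (1 + (6 - 2 * N) * (Y i * Y j)) +
    (N ^+ 2 - 4 * N) * Y i ^+ 2 * Y j ^+ 2 + Y i ^+ 2 + Y j ^+ 2) =
    vc ^+ 2 * 2 + vc ^+ 2 * (6 - 6 * N + N ^+ 2 + m%:R) * Y i ^+ 2.
  rewrite -mulr_sumr !big_split /= sum_delta sum_Y2l sum_Y2 sumr_const card_ord -mulr_natl.
  by rewrite /Y; ring.
under eq_bigr => i _ do rewrite sum2.
rewrite big_split /= sum_Y2l sumr_const card_ord -mulr_natl -[RHS]vc2 /N; ring.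
Qed.

End at_point.

(** Half the derivative of [|v|^2 = 1]. *)
Lemma sum_v_grad s k (x : E) : (1 < m)%N -> nr2 x != 0 ->
  \sum_p ev 0 s (vex p) x * ev 0 s (dX k (vex p)) x = 0.
Proof.
move=> m1 x0.
have h y : nr2 y != 0 -> ev 0 s (Sum (fun p => Mul (vex p) (vex p))) y = ev 0 s (Cst m 1) y.
  by move=> y0; rewrite ev_Sum /= -[RHS](sum_v2 s y0 m1); apply: eq_bigr => p _ /=; rewrite expr2.
have := ev_dX_eq k h x0; rewrite dX_Sum ev_Sum /=.
rewrite (eq_bigr (fun p => 2 * (ev 0 s (vex p) x * ev 0 s (dX k (vex p)) x))); last first.
  by move=> p _ /=; ring.
by rewrite -mulr_sumr => /eqP; rewrite mulf_eq0 pnatr_eq0 => /eqP.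
Qed.

(** Differentiating the orthogonality of [v] and its derivatives once more and summing over [k]
    gives [|grad v|^2 = - <v, Delta v>], to which [lapl_v] applies. *)
Lemma sum_grad_v2 s (x : E) : (1 < m)%N -> nr2 x != 0 ->
  \sum_p grad2 s (vex p) (vex p) x = lam * ev 0 s (Ri R m) x ^+ 2.
Proof.
move=> m1 x0.
have h k y : nr2 y != 0 ->
    ev 0 s (Sum (fun p => Mul (vex p) (dX k (vex p)))) y = ev 0 s (Cst m 0) y.
  by move=> y0; rewrite ev_Sum; exact: sum_v_grad.
have : \sum_k ev 0 s (dX k (Sum (fun p => Mul (vex p) (dX k (vex p))))) x = 0.
  by rewrite big1// => k _; exact: (ev_dX_eq k (h k) x0).
under eq_bigr => k _ do rewrite dX_Sum ev_Sum.
rewrite exchange_big /=.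
rewrite (eq_bigr (fun p => grad2 s (vex p) (vex p) x - lam * (rho 0 x)^-1 ^+ 2 * ev 0 s (vex p) x ^+ 2)).
  rewrite sumrB -mulr_sumr sum_v2// mulr1 => /eqP; rewrite subr_eq0 => /eqP.
  by [].
move=> p _; rewrite big_split /=; congr (_ + _).
have := lapl_v s x0 p; rewrite /lapl -mulr_sumr => ->.
by rewrite /=; ring.
Qed.
End differential_identities.

(** * The rotated maps and their bienergy density *)

Section the_variation.
Context (R : realType) (m : nat) (m5 : (5 <= m)%N) (beta : R).
Local Notation E := 'rV[R]_m.
Local Notation B := (@uball R m).
Local Notation ex := (ex R m).
Local Notation ev := (ev beta).
Local Notation I := (option ('I_m * 'I_m * 'I_m)).
Local Notation lam := (lam R m).
Local Notation r1 x := (ev 0 0 (Ri R m) x).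
Local Notation gr2 := (grad2 beta).
Local Notation lpl := (lapl beta).
Implicit Types (e : ex) (s : R) (f g : E -> R).

Let m1 : (1 < m)%N. Proof. exact: leq_trans m5. Qed.
Let m0 : (0 < m)%N. Proof. exact: leq_trans m5. Qed.

Definition Wex (a : I) : ex :=
  match a with Some p => Mul (Sn R m) (vex R p) | None => Cn R m end.

Lemma vtildeE : vtilde beta = fun (a : I) (x : E) => ev 0 0 (Wex a) x.
Proof.
apply/funext => -[[[i j] k]|]; apply/funext => x /=; last first.
  by rewrite /angle mul0r addr0.
rewrite /angle mul0r addr0 /v /vc; congr (_ * (_ * _)).
have -> : rho 0 x = enorm x by rewrite /rho add0r.
rewrite mulNr; congr (_ - _ * _).
by rewrite !exprS expr0 mulr1 !invfM; ring.
Qed.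

Lemma pole_vex (p : 'I_m * 'I_m * 'I_m) : pole (vex R p) = 0%N.
Proof. by case: p => -[i j] k. Qed.

Lemma pole_Wex a : pole (Wex a) = 0%N.
Proof. by case: a => //= p; rewrite pole_vex. Qed.

Lemma pole_dW a k : (pole (dX k (Wex a)) <= 1)%N.
Proof. by rewrite (leq_trans (pole_dX _ _))// pole_Wex. Qed.

Lemma pole_ddW a k l : (pole (dX l (dX k (Wex a))) <= 2)%N.
Proof. by rewrite (leq_trans (pole_dX _ _))// ltnS pole_dW. Qed.

Lemma W22_map_jet_W s : W22_map_jet (fun a => ev 0 s (Wex a))
  (fun a k => ev 0 s (dX k (Wex a))) (fun a k l => ev 0 s (dX l (dX k (Wex a)))).
Proof. by move=> a; apply: W22_jet_ev => //; rewrite pole_Wex. Qed.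

Lemma eq_ball_int_neq0 f g : measurable_fun B f -> measurable_fun B g ->
  (forall x, nr2 x != 0 -> f x = g x) -> ball_int f = ball_int g.
Proof.
move=> mf mg fg; rewrite /ball_int /Rintegral; congr fine.
apply: ae_eq_integral.
- exact: measurable_uball.
- exact/measurable_EFinP.
- exact/measurable_EFinP.
- by apply: filterS (ae_nr2_neq0 R m0) => x x0 _; rewrite fg.
Qed.

Lemma sphere_valued_W s : sphere_valued (fun a => ev 0 s (Wex a)).
Proof.
apply: filterS (ae_nr2_neq0 R m0) => x x0 _.
rewrite big_option /=; under eq_bigr do rewrite exprMn.
by rewrite -mulr_sumr (sum_v2 _ _ x0)// mulr1 cos2Dsin2.
Qed.

(* The gradient of the angle [beta + s (1 - |x|^2)^8], and its Laplacian
   divided by [s]. *)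
Definition dangle (k : 'I_m) : ex :=
  Mul (Sv R m) (Mul (Mul (Cst m (-16)) (pw (Uc R m) 7)) (Xc R k)).

Definition lapl_eta : ex :=
  Add (Mul (Cst m 224) (Mul (pw (Uc R m) 6) (Add (Cst m 1) (Mul (Cst m (-1)) (Uc R m)))))
      (Mul (Cst m (-16 * m%:R)) (pw (Uc R m) 7)).

Definition dangle2 s x : R := \sum_k ev 0 s (dangle k) x ^+ 2.

Lemma grad2_Sn s e x : gr2 s (Sn R m) e x =
  cos (angle beta s x) * (s * 8 * (1 - nr2 x) ^+ 7) * gr2 s (Uc R m) e x.
Proof. by rewrite /grad2 mulr_sumr; apply: eq_bigr => k _ /=; ring. Qed.

Lemma grad2_vSn s p x : nr2 x != 0 -> gr2 s (vex R p) (Sn R m) x = 0.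
Proof.
move=> x0; rewrite (grad2C beta) grad2_Sn (grad2C beta) grad2_v ?mulr0// => i.
exact: grad2_YU.
Qed.

Lemma lapl_angle s x : \sum_k ev 0 s (dX k (dangle k)) x = s * ev 0 s lapl_eta x.
Proof.
transitivity (\sum_k (s * 224 * (1 - nr2 x) ^+ 6 * x ord0 k ^+ 2 + s * -16 * (1 - nr2 x) ^+ 7)).
  by apply: eq_bigr => k _ /=; rewrite eqxx /=; ring.
rewrite big_split /= -mulr_sumr -/(nr2 x) sumr_const card_ord -mulr_natl; ring.
Qed.

Lemma lapl_Sn s x : lpl s (Sn R m) x = cos (angle beta s x) * (s * ev 0 s lapl_eta x)
  - sin (angle beta s x) * dangle2 s x.
Proof.
rewrite -lapl_angle /dangle2 !mulr_sumr -sumrB; apply: eq_bigr => k _.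
by rewrite /=; ring.
Qed.

Lemma lapl_Cn s x : lpl s (Cn R m) x = - sin (angle beta s x) * (s * ev 0 s lapl_eta x)
  - cos (angle beta s x) * dangle2 s x.
Proof.
rewrite -lapl_angle /dangle2 !mulr_sumr -sumrB; apply: eq_bigr => k _.
by rewrite /=; ring.
Qed.

Lemma lapl_W s p x : nr2 x != 0 -> lpl s (Wex (Some p)) x =
  (lpl s (Sn R m) x - lam * ev 0 s (Ri R m) x ^+ 2 * ev 0 s (Sn R m) x) * ev 0 s (vex R p) x.
Proof.
move=> x0; rewrite laplM (grad2C beta) grad2_vSn// lapl_v//.
by rewrite -/lam; ring.
Qed.

(** The mixed terms vanish because the angle is radial and [v] is constant along rays; [|v| = 1]
    makes the rotation contribute the squared gradient of the angle. *)
Lemma grad_sq_W s x : nr2 x != 0 ->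
  grad_sq (fun a k => ev 0 s (dX k (Wex a))) x =
  dangle2 s x + lam * ev 0 s (Ri R m) x ^+ 2 * sin (angle beta s x) ^+ 2.
Proof.
move=> x0; rewrite /grad_sq big_option /=.
have -> : \sum_k (-1 * sin (angle beta s x) * ev 0 s (dangle k) x) ^+ 2 =
    sin (angle beta s x) ^+ 2 * dangle2 s x.
  by rewrite mulr_sumr; apply: eq_bigr => k _; ring.
have -> : \sum_p \sum_k (cos (angle beta s x) * ev 0 s (dangle k) x * ev 0 s (vex R p) x +
    sin (angle beta s x) * ev 0 s (dX k (vex R p)) x) ^+ 2 =
  \sum_p \sum_k (cos (angle beta s x) ^+ 2 * ev 0 s (dangle k) x ^+ 2 * ev 0 s (vex R p) x ^+ 2)
  + sin (angle beta s x) ^+ 2 * \sum_p gr2 s (vex R p) (vex R p) x.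
  transitivity (\sum_p (\sum_k (cos (angle beta s x) ^+ 2 * ev 0 s (dangle k) x ^+ 2 * ev 0 s (vex R p) x ^+ 2) +
     sin (angle beta s x) ^+ 2 * gr2 s (vex R p) (vex R p) x +
     2 * sin (angle beta s x) * ev 0 s (vex R p) x * gr2 s (vex R p) (Sn R m) x)).
    apply: eq_bigr => p _; rewrite /grad2 !mulr_sumr -!big_split.
    by apply: eq_bigr => k _ /=; ring.
  rewrite big_split /= [X in _ + X]big1; last by move=> p _; rewrite grad2_vSn ?mulr0.
  by rewrite addr0 big_split /= mulr_sumr.
rewrite sum_grad_v2//.
under eq_bigr do rewrite -mulr_suml -mulr_sumr.
rewrite -mulr_sumr sum_v2// mulr1 -/(dangle2 s x).
have := cos2Dsin2 (angle beta s x).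
move: (cos _) (sin _) => c t h.
by rewrite -[X in _ = X + _]mul1r -h /=; ring.
Qed.

Definition Pex : ex := Add (Mul (Sv R m) lapl_eta)
  (Mul (Cst m (- lam)) (Mul (Mul (Ri R m) (Ri R m)) (Mul (Sn R m) (Cn R m)))).

(** For [w = (sin alpha v, cos alpha)] the Laplacian lies in the plane spanned by [w] and the unit
    tangent [(cos alpha v, - sin alpha)]. Its component along [w] is [- |grad w|^2], whose square
    cancels the quartic term; the tangential component is [Pex]. *)
Lemma bienergy_density_W s x : nr2 x != 0 ->
  bienergy_density (fun a k => ev 0 s (dX k (Wex a)))
    (fun a k l => ev 0 s (dX l (dX k (Wex a)))) x = ev 0 s Pex x ^+ 2.
Proof.
move=> x0; rewrite /bienergy_density grad_sq_W// big_option.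
rewrite -[lap _ None x]/(lpl s (Cn R m) x).
under eq_bigr => p _ do rewrite -[lap _ _ x]/(lpl s (Wex (Some p)) x) lapl_W// exprMn.
rewrite -mulr_sumr sum_v2// mulr1 lapl_Cn lapl_Sn.
have -> : ev 0 s Pex x = s * ev 0 s lapl_eta x - lam * (r1 x ^+ 2 *
    (sin (angle beta s x) * cos (angle beta s x))) by rewrite /Pex /=; ring.
rewrite -[ev 0 s (Sn R m) x]/(sin (angle beta s x)) -[ev 0 s (Ri R m) x]/(r1 x).
have := cos2Dsin2 (angle beta s x).
move: (cos _) (sin _) (dangle2 _ _) (r1 x) (ev 0 s lapl_eta x) => c t G r L h.
have h' : c ^+ 2 = 1 - t ^+ 2 by rewrite -h addrK.
ring: h'.
Qed.
End the_variation.

(** * Biharmonicity *)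

Section biharmonicity.
Context (R : realType) (m : nat) (m5 : (5 <= m)%N) (beta : R).
Local Notation E := 'rV[R]_m.
Local Notation B := (@uball R m).
Local Notation ex := (ex R m).
Local Notation ev := (ev beta).
Local Notation I := (option ('I_m * 'I_m * 'I_m)).
Local Notation lam := (lam R m).
Local Notation r1 x := (ev 0 0 (Ri R m) x).
Local Notation gr2 := (grad2 beta).
Local Notation lpl := (lapl beta).
Local Notation Wex := (@Wex R m).
Implicit Types (e : ex) (s : R) (f g : E -> R).

Let m1 : (1 < m)%N. Proof. exact: leq_trans m5. Qed.

(** At [eps = 0] and off the origin, [Lex] stands for [Delta w], [Gex] for [|grad w|^2], [Hex k] for
    the product of [Delta w] with the [k]-th partial derivative of [w], and [Qex] for [|Delta w|^2].
    As expressions they can receive derivatives moved back from a test map. *)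
Definition Lex (a : I) : ex := Sum (fun k => dX k (dX k (Wex a))).
Definition Gex : ex := Sum (fun a => Sum (fun k => Mul (dX k (Wex a)) (dX k (Wex a)))).
Definition Hex (k : 'I_m) : ex := Sum (fun a => Mul (Lex a) (dX k (Wex a))).
Definition Qex : ex := Sum (fun a => Mul (Lex a) (Lex a)).

(* The integrand of the weak biharmonic equation is the sum over [a] of
   [Aex a * phi a + \sum_k Bex a k * pd k (phi a) + Cex a * laplacian (phi a)]. *)
Definition Cex (a : I) : ex := Add (Lex a) (Mul Gex (Wex a)).
Definition Bex (a : I) (k : 'I_m) : ex := Mul (Cst m (-2)) (Mul (Hex k) (Wex a)).
Definition Aex (a : I) : ex :=
  Add (Mul (Add (Mul (Cst m 2) (Mul Gex Gex)) (Mul (Cst m (-1)) Qex)) (Wex a))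
  (Add (Mul Gex (Lex a)) (Mul (Cst m (-2)) (Sum (fun k => Mul (Hex k) (dX k (Wex a)))))).

Lemma pole_Lex a : (pole (Lex a) <= 2)%N.
Proof. by apply: pole_Sum => k; exact: pole_ddW. Qed.

Lemma pole_Gex : (pole Gex <= 2)%N.
Proof.
by apply: pole_Sum => a; apply: pole_Sum => k /=; rewrite (leq_add (pole_dW R a k) (pole_dW R a k)).
Qed.

Lemma pole_Hex k : (pole (Hex k) <= 3)%N.
Proof. by apply: pole_Sum => a /=; rewrite (leq_add (pole_Lex a) (pole_dW R a k)). Qed.

Lemma pole_Qex : (pole Qex <= 4)%N.
Proof. by apply: pole_Sum => a /=; rewrite (leq_add (pole_Lex a) (pole_Lex a)). Qed.

Lemma pole_Cex a : (pole (Cex a) <= 2)%N.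
Proof. by rewrite /= pole_Wex addn0 geq_max pole_Lex pole_Gex. Qed.

Lemma pole_Bex a k : (pole (Bex a k) <= 3)%N.
Proof. by rewrite /= pole_Wex addn0 add0n pole_Hex. Qed.

Lemma pole_Aex a : (pole (Aex a) <= 4)%N.
Proof.
rewrite /= pole_Wex addn0 !add0n !geq_max pole_Qex (leq_add pole_Gex pole_Gex).
rewrite (leq_add pole_Gex (pole_Lex a))/=.
by apply: pole_Sum => k /=; rewrite (leq_add (pole_Hex k) (pole_dW R a k)).
Qed.

Lemma biharmonic_integrandE phi x :
  biharmonic_integrand (fun a => ev 0 0 (Wex a)) (fun a k => ev 0 0 (dX k (Wex a)))
    (fun a k l => ev 0 0 (dX l (dX k (Wex a)))) phi x =
  \sum_a (ev 0 0 (Aex a) x * phi a x + \sum_k ev 0 0 (Bex a k) x * pd k (phi a) x +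
          \sum_k ev 0 0 (Cex a) x * pd k (pd k (phi a)) x).
Proof.
pose l a := ev 0 0 (Lex a) x; pose G := ev 0 0 Gex x; pose H k := ev 0 0 (Hex k) x.
pose Q := ev 0 0 Qex x; pose w a := ev 0 0 (Wex a) x; pose d a k := ev 0 0 (dX k (Wex a)) x.
have lE a : lap (fun a k l => ev 0 0 (dX l (dX k (Wex a)))) a x = l a by rewrite /l ev_Sum.
have GE : grad_sq (fun a k => ev 0 0 (dX k (Wex a))) x = G.
  rewrite /G ev_Sum; apply: eq_bigr => a _; rewrite ev_Sum; apply: eq_bigr => k _.
  by rewrite expr2.
have QE : \sum_a l a ^+ 2 = Q.
  by rewrite /Q ev_Sum; apply: eq_bigr => a _; rewrite expr2.
have HE k : \sum_a l a * d a k = H k by rewrite /H ev_Sum.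
rewrite /biharmonic_integrand /lap_dot /pd_dot GE.
under eq_bigr do rewrite lE.
under [\sum_a lap _ a x ^+ 2]eq_bigr do rewrite lE.
under [\sum_a (lap _ a x * _ + _ + _)]eq_bigr do rewrite lE.
under [\sum_k ((\sum_a lap _ a x * _) * _)]eq_bigr => k _.
  under eq_bigr do rewrite lE.
  rewrite HE mulr_sumr; over.
rewrite QE (exchange_big _ _ _ _ _ (fun k a => H k * _)) /= !mulr_sumr -!sumrN -!big_split /=.
apply: eq_bigr => a _.
rewrite -[ev 0 0 (Wex a) x]/(w a).
have -> : \sum_k H k * (d a k * phi a x + w a * pd k (phi a) x) =
   phi a x * (\sum_k H k * d a k) + w a * \sum_k H k * pd k (phi a) x.
  by rewrite !mulr_sumr -big_split; apply: eq_bigr => k _ /=; ring.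
have -> : \sum_k -2 * (H k * w a) * pd k (phi a) x = -2 * w a * \sum_k H k * pd k (phi a) x.
  by rewrite mulr_sumr; apply: eq_bigr => k _; ring.
rewrite -mulr_sumr -/(laplacian (phi a) x) ev_Sum /=.
rewrite -/(H _) -/G -/Q -/(l a).
ring.
Qed.

Lemma lapl_eq e1 e2 (x : E) : (forall y, nr2 y != 0 -> ev 0 0 e1 y = ev 0 0 e2 y) ->
  nr2 x != 0 -> lpl 0 e1 x = lpl 0 e2 x.
Proof.
move=> e12 x0; apply: eq_bigr => k _; apply: ev_dX_eq => // y y0.
exact: ev_dX_eq.
Qed.

Lemma dangle0 (x : E) : dangle2 beta 0 x = 0.
Proof. by rewrite /dangle2 big1// => k _; rewrite /= mul0r expr0n. Qed.

Lemma lapl_Sn0 (x : E) : lpl 0 (Sn R m) x = 0.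
Proof. by rewrite lapl_Sn dangle0 mul0r !mulr0 subr0. Qed.

Lemma lapl_Cn0 (x : E) : lpl 0 (Cn R m) x = 0.
Proof. by rewrite lapl_Cn dangle0 mul0r !mulr0 subr0. Qed.

Lemma ev_Lex_Some p (x : E) : nr2 x != 0 ->
  ev 0 0 (Lex (Some p)) x = - lam * r1 x ^+ 2 * ev 0 0 (Wex (Some p)) x.
Proof.
move=> x0; rewrite ev_Sum -[LHS]/(lpl 0 (Wex (Some p)) x) lapl_W// lapl_Sn0 /=; ring.
Qed.

Lemma ev_Lex_None (x : E) : ev 0 0 (Lex None) x = 0.
Proof. by rewrite ev_Sum -[LHS]/(lpl 0 (Cn R m) x) lapl_Cn0. Qed.

Lemma ev_Sn0 (x : E) : ev 0 0 (Sn R m) x = sin beta.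
Proof. by rewrite /= /angle mul0r addr0. Qed.

Lemma ev_Gex (x : E) : nr2 x != 0 -> ev 0 0 Gex x = lam * sin beta ^+ 2 * r1 x ^+ 2.
Proof.
move=> x0; have := grad_sq_W m5 beta 0 x0; rewrite dangle0 add0r /angle mul0r addr0 => H.
rewrite ev_Sum; transitivity (grad_sq (fun a k => ev 0 0 (dX k (Wex a))) x).
  by apply: eq_bigr => a _; rewrite ev_Sum; apply: eq_bigr => k _; rewrite expr2.
by rewrite H; ring.
Qed.

Lemma ev_Qex (x : E) : nr2 x != 0 -> ev 0 0 Qex x = lam ^+ 2 * sin beta ^+ 2 * r1 x ^+ 4.
Proof.
move=> x0; rewrite ev_Sum big_option /= ev_Lex_None mul0r add0r.
rewrite (eq_bigr (fun p => lam ^+ 2 * sin beta ^+ 2 * r1 x ^+ 4 * ev 0 0 (vex R p) x ^+ 2)).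
  by rewrite -mulr_sumr (sum_v2 _ _ x0)// mulr1.
move=> p _; rewrite ev_Lex_Some// -[ev 0 0 (Wex _) x]/(ev 0 0 (Sn R m) x * ev 0 0 (vex R p) x).
by rewrite ev_Sn0; ring.
Qed.

(** At parameter 0 [Delta w] is a multiple of [(v, 0)], which is orthogonal to every derivative of
    [w]; so the first-order terms of the equation disappear. *)
Lemma ev_Hex k (x : E) : nr2 x != 0 -> ev 0 0 (Hex k) x = 0.
Proof.
move=> x0; rewrite ev_Sum big_option /= ev_Lex_None mul0r add0r.
rewrite (eq_bigr (fun p => - lam * sin beta ^+ 2 * r1 x ^+ 2 *
    (ev 0 0 (vex R p) x * ev 0 0 (dX k (vex R p)) x))).
  by rewrite -mulr_sumr sum_v_grad// mulr0.
move=> p _; rewrite ev_Lex_Some// -[ev 0 0 (Wex _) x]/(ev 0 0 (Sn R m) x * ev 0 0 (vex R p) x).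
by rewrite ev_Sn0 /= /angle mul0r addr0; ring.
Qed.

(** At parameter 0 the map is constant along rays while [r^-2] is radial, so the product rule has no
    mixed term. *)
Lemma lapl_R2W a (x : E) : nr2 x != 0 ->
  lpl 0 (Mul (Mul (Ri R m) (Ri R m)) (Wex a)) x =
  - 2 * (m%:R - 4) * r1 x ^+ 4 * ev 0 0 (Wex a) x + r1 x ^+ 2 * ev 0 0 (Lex a) x.
Proof.
move=> x0; rewrite laplM (lapl_R2 _ _ x0).
have -> : gr2 0 (Mul (Ri R m) (Ri R m)) (Wex a) x = 0.
  have Sn0 e : gr2 0 e (Sn R m) x = 0 by rewrite (grad2C beta) grad2_Sn !(mul0r, mulr0).
  case: a => [p|] /=.
    rewrite (grad2C beta) grad2M [gr2 _ (Sn R m) _ _](grad2C beta) Sn0 mulr0 addr0.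
    have gv : gr2 0 (vex R p) (Ri R m) x = 0 by apply: grad2_v => i; exact: grad2_YR.
    by rewrite (grad2C beta) grad2M [gr2 _ (Ri R m) _ _](grad2C beta) gv !(mulr0, addr0).
  by rewrite /grad2 big1// => k _ /=; ring.
by rewrite ev_Sum -/(lpl 0 (Wex a) x) /=; ring.
Qed.

(** This is the coefficient of [phi a] after all derivatives are moved back. With [q = sin^2 beta]
    it is [r^-4] times the component times [2 lam q - lam - 2 (m - 4)], up to the factor
    [lam (q - 1)] for the components of [v] and [lam q] for the last one; hence one condition on
    [beta] serves both. *)
Lemma ev_biharmonic_coef a (x : E) :
  sin beta ^+ 2 = 5 / 6 * ((m%:R - 1) / (m%:R + 1)) -> nr2 x != 0 ->
  ev 0 0 (Aex a) x - \sum_k ev 0 0 (dX k (Bex a k)) x +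
  \sum_k ev 0 0 (dX k (dX k (Cex a))) x = 0.
Proof.
move=> hq x0; have M5 : 5 <= m%:R :> R by rewrite ler_nat.
have hl : 2 * lam * sin beta ^+ 2 = lam + 2 * (m%:R - 4).
  by rewrite hq /lam; field; lra.
rewrite big1 ?subr0; last first.
  move=> k _; rewrite (@ev_dX_eq _ _ _ _ _ (Cst m 0))// => y y0.
  by rewrite -[LHS]/(-2 * (ev 0 0 (Hex k) y * ev 0 0 (Wex a) y)) ev_Hex// mul0r mulr0.
have AE : ev 0 0 (Aex a) x = (2 * ev 0 0 Gex x ^+ 2 - ev 0 0 Qex x) * ev 0 0 (Wex a) x +
    ev 0 0 Gex x * ev 0 0 (Lex a) x.
  rewrite -[LHS]/((2 * (ev 0 0 Gex x * ev 0 0 Gex x) + -1 * ev 0 0 Qex x) * ev 0 0 (Wex a) x +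
    (ev 0 0 Gex x * ev 0 0 (Lex a) x + -2 * ev 0 0 (Sum (fun k => Mul (Hex k) (dX k (Wex a)))) x)).
  rewrite [X in -2 * X]ev_Sum [X in -2 * X]big1; last first.
    by move=> k _; rewrite -[LHS]/(ev 0 0 (Hex k) x * _) ev_Hex// mul0r.
  ring.
rewrite AE ev_Gex// ev_Qex//.
pose c : R := if a is Some _ then lam * (sin beta ^+ 2 - 1) else lam * sin beta ^+ 2.
have -> : \sum_k ev 0 0 (dX k (dX k (Cex a))) x =
    lpl 0 (Mul (Cst m c) (Mul (Mul (Ri R m) (Ri R m)) (Wex a))) x.
  apply: lapl_eq => // y y0.
  rewrite -[LHS]/(ev 0 0 (Lex a) y + ev 0 0 Gex y * ev 0 0 (Wex a) y) ev_Gex//.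
  rewrite -[RHS]/(c * ((r1 y * r1 y) * ev 0 0 (Wex a) y)) /c.
  by case: a {AE c} => [p|]; rewrite ?ev_Lex_None ?ev_Lex_Some//; ring.
rewrite laplM lapl_Cst grad2_Cst lapl_R2W// mulr0 mul0r !add0r -[ev 0 0 (Cst m c) x]/c.
rewrite /c; case: a {AE c} => [p|]; rewrite ?ev_Lex_None ?ev_Lex_Some//.
  move: (ev 0 0 (Wex _) x) (r1 x) (sin beta ^+ 2) lam hl => w r q l hl.
  have -> : m%:R - 4 = (2 * l * q - l) / 2 by rewrite hl; field.
  by field.
move: (ev 0 0 (Wex _) x) (r1 x) (sin beta ^+ 2) lam hl => w r q l hl.
have -> : m%:R - 4 = (2 * l * q - l) / 2 by rewrite hl; field.
by field.
Qed.

Lemma ball_integrable_ev_test e f : (pole e <= 4)%N -> test_fun f ->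
  ball_integrable (fun x => ev 0 0 e x * f x).
Proof.
move=> e4 tf; have [C C0 HC] := test_fun_bound tf.
have e40 : (pole e + 0 <= 4)%N by rewrite addn0.
exact: (ball_integrable_evM m5 beta 0 e40 (test_fun_measurable tf) HC).
Qed.

Lemma ball_int_by_parts e f k : (pole e <= 3)%N -> test_fun f ->
  ball_int (fun x => ev 0 0 e x * pd k f x) = - ball_int (fun x => ev 0 0 (dX k e) x * f x).
Proof. by move=> e3 tf; exact: (weak_pd_ev m5 beta 0 k e3). Qed.

(** The coefficients of [phi], its gradient and its second derivatives have poles at most 4, 3 and
    2. Moving back zero, one and two derivatives thus ends at pole at most 4 each time, and the
    total coefficient vanishes off the origin. *)
Lemma weakly_biharmonic_vtilde :
  sin beta ^+ 2 = 5 / 6 * ((m%:R - 1) / (m%:R + 1)) ->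
  weakly_biharmonic (@vtilde R m beta).
Proof.
move=> hq; rewrite vtildeE; split; first exact: sphere_valued_W.
exists (fun a k => ev 0 0 (dX k (Wex a))), (fun a k l => ev 0 0 (dX l (dX k (Wex a)))).
split; first exact: W22_map_jet_W.
move=> phi tphi.
have iA a : ball_integrable (fun x => ev 0 0 (Aex a) x * phi a x).
  by apply: ball_integrable_ev_test => //; exact: pole_Aex.
have iB a k : ball_integrable (fun x => ev 0 0 (Bex a k) x * pd k (phi a) x).
  apply: ball_integrable_ev_test; first by rewrite (leq_trans (pole_Bex a k)).
  exact: test_fun_pd.
have iC a k : ball_integrable (fun x => ev 0 0 (Cex a) x * pd k (pd k (phi a)) x).
  apply: ball_integrable_ev_test; first by rewrite (leq_trans (pole_Cex a)).
  exact/test_fun_pd/test_fun_pd.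
have iB' a k : ball_integrable (fun x => ev 0 0 (dX k (Bex a k)) x * phi a x).
  by apply: ball_integrable_ev_test => //; rewrite (leq_trans (pole_dX _ _))// ltnS pole_Bex.
have iC' a k : ball_integrable (fun x => ev 0 0 (dX k (dX k (Cex a))) x * phi a x).
  apply: ball_integrable_ev_test => //; rewrite (leq_trans (pole_dX _ _))// ltnS.
  by rewrite (leq_trans (pole_dX _ _))// ltnS pole_Cex.
have iS a : ball_integrable (fun x => ev 0 0 (Aex a) x * phi a x +
    \sum_k ev 0 0 (Bex a k) x * pd k (phi a) x +
    \sum_k ev 0 0 (Cex a) x * pd k (pd k (phi a)) x).
  by do !apply: ball_integrableD => //; exact: ball_integrable_sum.
have E1 : biharmonic_integrand (fun a => ev 0 0 (Wex a)) (fun a k => ev 0 0 (dX k (Wex a)))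
    (fun a k l => ev 0 0 (dX l (dX k (Wex a)))) phi =
  fun x => \sum_a (ev 0 0 (Aex a) x * phi a x + \sum_k ev 0 0 (Bex a k) x * pd k (phi a) x +
          \sum_k ev 0 0 (Cex a) x * pd k (pd k (phi a)) x).
  by apply/funext => x; exact: biharmonic_integrandE.
rewrite E1; split; first exact: ball_integrable_sum.
rewrite -[LHS]/(ball_int _) ball_int_sum// big1// => a _.
rewrite ball_intD; [|by apply: ball_integrableD => //; exact: ball_integrable_sum
  |exact: ball_integrable_sum].
rewrite ball_intD//; last exact: ball_integrable_sum.
rewrite !ball_int_sum//.
have EB : \sum_k ball_int (fun x => ev 0 0 (Bex a k) x * pd k (phi a) x) =
    - ball_int (fun x => \sum_k ev 0 0 (dX k (Bex a k)) x * phi a x).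
  rewrite ball_int_sum// -sumrN; apply: eq_bigr => k _.
  by rewrite ball_int_by_parts// pole_Bex.
have EC : \sum_k ball_int (fun x => ev 0 0 (Cex a) x * pd k (pd k (phi a)) x) =
    ball_int (fun x => \sum_k ev 0 0 (dX k (dX k (Cex a))) x * phi a x).
  rewrite ball_int_sum//; apply: eq_bigr => k _.
  rewrite ball_int_by_parts; [|by rewrite (leq_trans (pole_Cex a))|exact: test_fun_pd].
  rewrite ball_int_by_parts ?opprK//.
  by rewrite (leq_trans (pole_dX _ _))// ltnS pole_Cex.
rewrite [X in _ + X + _]EB [X in _ + _ + X]EC.
have iSB : ball_integrable (fun x => \sum_k ev 0 0 (dX k (Bex a k)) x * phi a x).
  exact: ball_integrable_sum.
have iSC : ball_integrable (fun x => \sum_k ev 0 0 (dX k (dX k (Cex a))) x * phi a x).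
  exact: ball_integrable_sum.
have iN := ball_integrableZ (-1) iSB.
rewrite -mulN1r -ball_intZ// -ball_intD// -ball_intD//; last exact: ball_integrableD.
have mf f : ball_integrable f -> measurable_fun B f.
  by move=> /integrableP[/measurable_EFinP].
transitivity (ball_int (fun _ : E => 0 : R)); last by rewrite /ball_int /Rintegral integral0_eq.
apply: (eq_ball_int_neq0 m5).
- by apply: mf; do !apply: ball_integrableD.
- exact: measurable_cst.
move=> x x0; rewrite -!mulr_suml.
have := ev_biharmonic_coef a hq x0.
move: (ev 0 0 (Aex a) x) (\sum_k _) (\sum_k _) => A S2 S1 h.
rewrite -[RHS](mul0r (phi a x)) -h; ring.
Qed.
End biharmonicity.

(** * Instability *)

Section mean_value.
Context (R : realType).
Implicit Types (f df : R -> R).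

Lemma mean_value_le f df (K a b : R) : (forall t : R, is_derive t 1 f (df t)) ->
  (forall t, `|t - a| <= `|b - a| -> `|df t| <= K) -> `|f b - f a| <= K * `|b - a|.
Proof.
move=> fdf dfK.
have cf (c d : R) : {within `[c, d], continuous f}.
  apply: derivable_within_continuous => t _; by have [] := fdf t.
have [ab|ba|->] := ltgtP a b; last by rewrite !subrr normr0 mulr0.
- have [c] := MVT ab (fun t _ => fdf t) (cf a b); rewrite in_itv/= => /andP[ac cb] ->.
  rewrite normrM ler_wpM2r//; apply: dfK.
  by rewrite !gtr0_norm ?subr_gt0// lerD2r ltW.
- have [c] := MVT ba (fun t _ => fdf t) (cf b a); rewrite in_itv/= => /andP[bc ca].
  rewrite distrC => ->; rewrite normrM [`|b - a|]distrC ler_wpM2r//; apply: dfK.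
  by rewrite (distrC c) (distrC b) !gtr0_norm ?subr_gt0// lerD2l lerN2 ltW.
Qed.

(** The mean value inequality is applied to [df] and then to [f t - t * df s]. *)
Lemma taylor1_le f df ddf (K s h : R) : (forall t : R, is_derive t 1 f (df t)) ->
  (forall t : R, is_derive t 1 df (ddf t)) ->
  (forall t, `|t - s| <= `|h| -> `|ddf t| <= K) ->
  `|f (s + h) - f s - h * df s| <= K * h ^+ 2.
Proof.
move=> fdf dfddf ddfK.
have K0 : 0 <= K by apply: le_trans (ddfK s _); rewrite // subrr normr0.
have dg (t : R) : is_derive t 1 (fun t => f t - t * df s) (df t - df s).
  have d1 : is_derive t 1 (fun t => t * df s) (df s).
    have := is_derive_affine 0 (df s) t; congr is_derive.
    by apply/funext => u; rewrite add0r mulrC.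
  exact: (is_deriveB (fdf t) d1).
have := @mean_value_le _ _ (K * `|h|) s (s + h) dg.
have -> : f (s + h) - (s + h) * df s - (f s - s * df s) = f (s + h) - f s - h * df s by ring.
rewrite [s + h - s]addrC addKr -mulrA -expr2 real_normK ?num_real//; apply => t th.
apply: le_trans (_ : K * `|t - s| <= _); last exact: ler_wpM2l.
apply: mean_value_le dfddf _ => u us; apply: ddfK; exact: le_trans us th.
Qed.

End mean_value.

(** * Smooth dependence on the parameter in W^{2,2} *)

Section variation_regularity.
Context (R : realType) (m : nat) (m5 : (5 <= m)%N) (beta : R).
Local Notation E := 'rV[R]_m.
Local Notation leb := (@lebesgue_rV R m).
Local Notation B := (@uball R m).
Local Notation ex := (ex R m).
Local Notation ev := (ev beta).
Implicit Types (e : ex) (s h : R) (f g : E -> R).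

Let m0 : (0 < m)%N. Proof. exact: leq_trans m5. Qed.

Lemma wt_ge0 (x : E) : 0 <= wt x.
Proof. exact: le_trans (wt_ge1 x). Qed.

(** Since [ds] does not raise the pole, the remainder is no more singular than [e] itself.
    Integrated, this estimate yields both the derivatives of the energy and convergence of
    difference quotients in W^{2,2}. *)
Lemma ev_taylor e (M : R) : exists2 C, 0 <= C & forall s h x, B x -> `|s| <= M -> `|h| <= 1 ->
  `|ev 0 (s + h) e x - ev 0 s e x - h * ev 0 s (ds e) x| <= C * wt x ^+ pole e * h ^+ 2.
Proof.
have [C C0 HC] := ev_bound beta (ds (ds e)) (M + 1); exists C => // s h x Bx sM h1.
apply: (@taylor1_le _ (fun t => ev 0 t e x) (fun t => ev 0 t (ds e) x)
   (fun t => ev 0 t (ds (ds e)) x)) => t.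
- exact: is_derive_s.
- exact: is_derive_s.
move=> th; apply: (@le_trans _ _ (C * wt x ^+ pole (ds (ds e)))).
  apply: HC => //; last exact: uball_nr2.
  by rewrite -(subrK s t) (le_trans (ler_normD _ _))// addrC lerD// (le_trans th).
rewrite ler_wpM2l// ler_weXn2l ?wt_ge1//.
exact: leq_trans (pole_ds _) (pole_ds _).
Qed.

Lemma is_derive_ball_int e s : (pole e <= 4)%N ->
  is_derive s 1 (fun s => ball_int (ev 0 s e)) (ball_int (ev 0 s (ds e))).
Proof.
move=> e4; have [C C0 HC] := ev_taylor e `|s|.
have iw := @ball_integrable_wt4 R m m5.
have ie t := ball_integrable_ev m5 beta t e4.
have ide : ball_integrable (ev 0 s (ds e)).
  by apply: ball_integrable_ev => //; exact: leq_trans (pole_ds _) e4.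
apply: (is_derive_quadratic (C := C * ball_int (fun x : E => wt x ^+ 4))) => h h1.
rewrite [h + s]addrC.
have i1 := ball_integrableZ (-1) (ie s); have i2 := ball_integrableZ (- h) ide.
have i3 := ball_integrableD (ie (s + h)) i1; have i4 := ball_integrableD i3 i2.
have -> : ball_int (ev 0 (s + h) e) - ball_int (ev 0 s e) - h * ball_int (ev 0 s (ds e)) =
    ball_int (fun x => ev 0 (s + h) e x + -1 * ev 0 s e x + - h * ev 0 s (ds e) x).
  by rewrite !ball_intD// !ball_intZ// mulN1r mulNr.
have le x : B x -> `|ev 0 (s + h) e x + -1 * ev 0 s e x + - h * ev 0 s (ds e) x| <=
    C * h ^+ 2 * wt x ^+ 4.
  move=> Bx; rewrite mulN1r mulNr (le_trans (HC s h x Bx _ h1))// mulrAC ler_wpM2l//.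
    by rewrite mulr_ge0// sqr_ge0.
  exact: wt_le4.
have i5 := ball_integrableZ (C * h ^+ 2) iw.
rewrite [C * _ * _]mulrAC -(ball_intZ _ iw) ler_norml.
have i6 := ball_integrableZ (-1) i5.
apply/andP; split; first rewrite -[leLHS]mulN1r -(ball_intZ _ i5).
  apply: le_ball_int => // x /le; rewrite ler_norml => /andP[h2 _].
  by rewrite [leLHS]mulN1r.
by apply: le_ball_int => // x /le; rewrite ler_norml => /andP[].
Qed.

(* The remainder of the difference quotient of [e] in the parameter, at [s]. *)
Definition dquot e s h : ex :=
  Add (Mul (Cst m h^-1) (Add (At (s + h) e) (Mul (Cst m (-1)) (At s e))))
      (Mul (Cst m (-1)) (At s (ds e))).

Lemma pole_dquot e s h : pole (dquot e s h) = pole e.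
Proof. by rewrite /= !add0n maxnn; apply/maxn_idPl; exact: pole_ds. Qed.

Lemma ev_dquot e s h x t : ev 0 t (dquot e s h) x =
  h^-1 * (ev 0 (s + h) e x - ev 0 s e x) - ev 0 s (ds e) x.
Proof. by rewrite /= !mulN1r. Qed.

(** It turns the derivatives of a remainder into remainders of derivatives, so [dquot_le] controls
    all terms of the W^{2,2} norm. *)
Lemma ev_dX_dquot e s h k x t : ev 0 t (dX k (dquot e s h)) x = ev 0 t (dquot (dX k e) s h) x.
Proof. by rewrite [RHS]ev_dquot dsdX /=; ring. Qed.

Lemma ev_dXX_dquot e s h k l x t : nr2 x != 0 ->
  ev 0 t (dX l (dX k (dquot e s h))) x = ev 0 t (dquot (dX l (dX k e)) s h) x.
Proof.
move=> x0; rewrite -ev_dX_dquot; apply: ev_dX_eq => // y _; exact: ev_dX_dquot.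
Qed.

Lemma dquot_le e s : (pole e <= 2)%N -> exists2 C, 0 <= C & forall h x t, B x ->
  h != 0 -> `|h| <= 1 -> ev 0 t (dquot e s h) x ^+ 2 <= h ^+ 2 * C * wt x ^+ 4.
Proof.
move=> e2; have [C C0 HC] := ev_taylor e `|s|; exists (C ^+ 2); first exact: sqr_ge0.
move=> h x t Bx h0 h1; rewrite ev_dquot.
have hp : 0 < `|h| by rewrite normr_gt0.
have H : `|h^-1 * (ev 0 (s + h) e x - ev 0 s e x) - ev 0 s (ds e) x| <= `|h| * C * wt x ^+ 2.
  rewrite -(ler_pM2l hp) -normrM.
  rewrite (_ : h * _ = ev 0 (s + h) e x - ev 0 s e x - h * ev 0 s (ds e) x); last by field.
  rewrite (le_trans (HC s h x Bx _ h1))//.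
  have -> : `|h| * (`|h| * C * wt x ^+ 2) = C * wt x ^+ 2 * h ^+ 2.
    by rewrite -[h ^+ 2]real_normK ?num_real//; ring.
  by rewrite ler_wpM2r ?sqr_ge0// ler_wpM2l// ler_weXn2l ?wt_ge1.
rewrite -[leLHS]real_normK ?num_real//.
have -> : h ^+ 2 * C ^+ 2 * wt x ^+ 4 = (`|h| * C * wt x ^+ 2) ^+ 2.
  by rewrite -[h ^+ 2]real_normK ?num_real//; ring.
have P : 0 <= `|h| * C * wt x ^+ 2 by rewrite !mulr_ge0 ?exprn_ge0 ?wt_ge0.
by rewrite ler_sqr ?nnegrE.
Qed.

Lemma W22_norm_le_dquot (J : finType) (F : J -> ex) (s d : R) : (forall a, pole (F a) = 0%N) ->
  0 < d -> \forall h \near 0^', W22_norm_le (fun a => ev 0 s (dquot (F a) s h)) d.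
Proof.
move=> F0 d0.
have F1 a k : (pole (dX k (F a)) <= 1)%N by rewrite (leq_trans (pole_dX _ _))// F0.
have F2 a k l : (pole (dX l (dX k (F a))) <= 2)%N by rewrite (leq_trans (pole_dX _ _))// ltnS.
have H0 a : exists C, 0 <= C /\ forall h x, B x -> h != 0 -> `|h| <= 1 ->
    ev 0 s (dquot (F a) s h) x ^+ 2 <= h ^+ 2 * C * wt x ^+ 4.
  have [|C C0 HC] := @dquot_le (F a) s; first by rewrite F0.
  by exists C; split => // h x *; exact: HC.
have H1 (p : J * 'I_m) : exists C, 0 <= C /\ forall h x, B x -> h != 0 -> `|h| <= 1 ->
    ev 0 s (dquot (dX p.2 (F p.1)) s h) x ^+ 2 <= h ^+ 2 * C * wt x ^+ 4.
  have [|C C0 HC] := @dquot_le (dX p.2 (F p.1)) s; first by rewrite (leq_trans (F1 _ _)).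
  by exists C; split => // h x *; exact: HC.
have H2 (p : J * 'I_m * 'I_m) : exists C, 0 <= C /\ forall h x, B x -> h != 0 -> `|h| <= 1 ->
    ev 0 s (dquot (dX p.2 (dX p.1.2 (F p.1.1))) s h) x ^+ 2 <= h ^+ 2 * C * wt x ^+ 4.
  have [|C C0 HC] := @dquot_le (dX p.2 (dX p.1.2 (F p.1.1))) s; first exact: F2.
  by exists C; split => // h x *; exact: HC.
have [C0 HC0] := choice H0; have [C1 HC1] := choice H1; have [C2 HC2] := choice H2.
pose K := \sum_a (C0 a + \sum_k C1 (a, k) + \sum_k \sum_l C2 (a, k, l)).
pose A := ball_int (fun x : E => wt x ^+ 4).
have iw := @ball_integrable_wt4 R m m5.
have A0 : 0 <= A by apply: Rintegral_ge0 => x _; rewrite exprn_ge0// wt_ge0.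
have K0 : 0 <= K.
  apply: sumr_ge0 => a _; rewrite !addr_ge0 ?(HC0 a).1//.
    by apply: sumr_ge0 => k _; exact: (HC1 (a, k)).1.
  by apply: sumr_ge0 => k _; apply: sumr_ge0 => l _; exact: (HC2 (a, k, l)).1.
near=> h.
have h0 : h != 0 by near: h; exact: nbhs_dnbhs_neq.
have h1 : `|h| <= 1 by near: h; exact: dnbhs0_le.
(* The squared norm is at most [h^2 K A <= |h| K A], which this bound keeps below [d^2]; the 1 makes
   the denominator positive. *)
have hd : `|h| <= d ^+ 2 / (K * A + 1).
  near: h; apply: dnbhs0_le; rewrite divr_gt0 ?exprn_gt0//.
  by rewrite ltr_wpDl// mulr_ge0.
exists (fun a k => ev 0 s (dX k (dquot (F a) s h))),
  (fun a k l => ev 0 s (dX l (dX k (dquot (F a) s h)))); split.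
  by move=> a; apply: W22_jet_ev => //; rewrite pole_dquot F0.
apply: (@le_trans _ _ (\int[leb]_(x in B) (h ^+ 2 * K * wt x ^+ 4)%:E)%E); last first.
  rewrite ball_int_EFin; last exact: (ball_integrableZ (h ^+ 2 * K) iw).
  rewrite ball_intZ// -/A lee_fin -[h ^+ 2]real_normK ?num_real//.
  rewrite ler_pdivlMr ?ltr_wpDl ?mulr_ge0// in hd.
  rewrite (le_trans _ hd)// expr2 -!mulrA mulrDr mulr1 (le_trans _ (_ : `|h| * (K * A) <= _))//.
    by rewrite ler_piMl ?mulr_ge0.
  by rewrite lerDl.
have mS : measurable_fun B (fun x => \sum_a (ev 0 s (dquot (F a) s h) x ^+ 2 +
    \sum_k ev 0 s (dX k (dquot (F a) s h)) x ^+ 2 +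
    \sum_k \sum_l ev 0 s (dX l (dX k (dquot (F a) s h))) x ^+ 2)).
  apply: measurable_sum => a; apply: measurable_funD; first apply: measurable_funD.
  - by apply: measurable_funX; exact: measurable_evB.
  - by apply: measurable_sum => k; apply: measurable_funX; exact: measurable_evB.
  - apply: measurable_sum => k; apply: measurable_sum => l.
    by apply: measurable_funX; exact: measurable_evB.
apply: ae_ge0_le_integral.
- exact: measurable_uball.
- move=> x _; rewrite lee_fin; apply: sumr_ge0 => a _; rewrite !addr_ge0 ?sqr_ge0//.
    by apply: sumr_ge0 => k _; exact: sqr_ge0.
  by apply: sumr_ge0 => k _; apply: sumr_ge0 => l _; exact: sqr_ge0.
- exact/measurable_EFinP.
- move=> x _; rewrite lee_fin; apply: mulr_ge0; first by rewrite mulr_ge0 ?sqr_ge0.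
  by rewrite exprn_ge0 ?wt_ge0.
- by case/integrableP : (ball_integrableZ (h ^+ 2 * K) iw).
apply: filterS (ae_nr2_neq0 R m0) => x x0 Bx; rewrite lee_fin.
rewrite -mulrA mulr_suml mulr_sumr; apply: ler_sum => a _.
rewrite 2!mulrDl 2!mulrDr !mulr_suml !mulr_sumr; apply: lerD; first apply: lerD.
- by rewrite mulrA; exact: (HC0 a).2.
- by apply: ler_sum => k _; rewrite mulrA ev_dX_dquot; exact: (HC1 (a, k)).2.
- apply: ler_sum => k _; rewrite mulr_suml mulr_sumr; apply: ler_sum => l _.
  by rewrite mulrA ev_dXX_dquot//; exact: (HC2 (a, k, l)).2.
Unshelve. all: by end_near. Qed.

End variation_regularity.

(** * Boundary traces by regularisation *)

Section traces.
Context (R : realType) (m : nat) (m5 : (5 <= m)%N) (beta : R).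
Local Notation E := 'rV[R]_m.
Local Notation leb := (@lebesgue_rV R m).
Local Notation B := (@uball R m).
Local Notation ex := (ex R m).
Local Notation ev := (ev beta).
Implicit Types (e : ex) (s h : R) (f g : E -> R).

Let m0 : (0 < m)%N. Proof. exact: leq_trans m5. Qed.
Let eps (n : nat) : R := n.+1%:R^-1.
Let eps_gt0 n : 0 < eps n. Proof. by rewrite invr_gt0. Qed.

Lemma ball_integrable_sqrB_ev e s n : (pole e <= 2)%N ->
  ball_integrable (fun x => (ev (eps n) s e x - ev 0 s e x) ^+ 2).
Proof.
move=> e2; have [M M0 HM] := continuous_bounded_cube (@continuous_ev R m beta _ s e (eps_gt0 n)).
have [C C0 HC] := ev_boundB beta s e.
apply: (@ball_integrable_wt _ _ _ ((M + C) ^+ 2) 4) => //.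
  apply: measurable_funX; apply: measurable_funB; last exact: measurable_evB.
  by apply: measurable_funTS; apply: measurable_ev; exact: ltW.
move=> x Bx; rewrite ger0_norm ?sqr_ge0// -[leLHS]real_normK ?num_real//.
have -> : (M + C) ^+ 2 * wt x ^+ 4 = ((M + C) * wt x ^+ 2) ^+ 2 by ring.
have w0 : 1 <= wt x ^+ 2 by rewrite exprn_ege1// wt_ge1.
rewrite ler_sqr ?nnegrE//; last by rewrite mulr_ge0 ?addr_ge0// (le_trans _ w0).
rewrite (le_trans (ler_normB _ _))// mulrDl lerD//.
  by rewrite (le_trans (HM x (uball_cube Bx)))// ler_peMr.
by rewrite (le_trans (HC x Bx))// ler_wpM2l// ler_weXn2l ?wt_ge1.
Qed.

(** Expanding the square, the integrals of the regularised square and of the mixed product both tend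
    to the integral [A] of the limit square, and [A - 2 A + A = 0]. *)
Lemma ball_int_sqrB_cvg e s : (pole e <= 2)%N ->
  ball_int (fun x => (ev (eps n) s e x - ev 0 s e x) ^+ 2) @[n --> \oo] --> (0 : R).
Proof.
move=> e2.
have m1 : measurable_fun B (fun=> 1 : R) by [].
have H1 (x : E) : B x -> `|1 : R| <= 1 * wt x ^+ 0 by rewrite mulr1 normr1.
have e40 : (pole (Mul e e) + 0 <= 4)%N by rewrite addn0 /= (leq_add e2 e2).
have [C C0 HC] := ev_boundB beta s e.
have ee4 : (pole e + pole e <= 4)%N by rewrite (leq_add e2 e2).
have c1 := ball_int_ev_cvg m5 (beta := beta) (s := s) e40 m1 H1.
have c2 := ball_int_ev_cvg m5 (beta := beta) (s := s) ee4 (measurable_evB beta s e) HC.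
pose A := ball_int (fun x => ev 0 s e x * ev 0 s e x).
have A1 : ball_int (fun x => ev 0 s (Mul e e) x * 1) = A.
  by apply: eq_ball_int => x _; rewrite mulr1.
have i0 : ball_integrable (fun x => ev 0 s e x * ev 0 s e x).
  exact: (ball_integrable_evM m5 beta s ee4 (measurable_evB beta s e) HC).
rewrite A1 in c1; rewrite -/A in c2.
have {}c1 : ball_int (fun x => ev (eps n) s (Mul e e) x * 1) +
   -2 * ball_int (fun x => ev (eps n) s e x * ev 0 s e x) + A @[n --> \oo] --> (A + -2 * A + A).
  apply: cvgD; last exact: cvg_cst.
  by apply: cvgD => //; apply: cvgM => //; exact: cvg_cst.
rewrite (_ : A + -2 * A + A = 0) in c1; last by ring.
rewrite (_ : (fun n => _) = (fun n => ball_int (fun x => ev (eps n) s (Mul e e) x * 1) +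
   -2 * ball_int (fun x => ev (eps n) s e x * ev 0 s e x) + A))//.
apply/funext => n.
have i1 : ball_integrable (fun x => ev (eps n) s (Mul e e) x * 1).
  by apply: continuous_ball_integrable; apply: contM; [exact: continuous_ev|exact: cont_cst].
have i2 := @ball_integrable_sqrB_ev e s n e2.
have i3 : ball_integrable (fun x => ev (eps n) s e x * ev 0 s e x).
  (* Polarisation: [a b = (a^2 + b^2 - (a - b)^2) / 2]. *)
  have := ball_integrableZ 2^-1 (ball_integrableD (ball_integrableD i1 i0) (ball_integrableZ (-1) i2)).
  by apply: eq_ball_integrable => x _ /=; field.
rewrite -ball_intZ// -ball_intD//; last exact: ball_integrableZ.
rewrite -ball_intD//; last by apply: ball_integrableD => //; exact: ball_integrableZ.
by apply: eq_ball_int => x _ /=; ring.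
Qed.

(** The regularisations are the smooth approximants. They vanish on the sphere for every [eps], so
    the boundary integrals are 0 and only convergence in W^{1,2} has to be shown. *)
Lemma trace_ev e s : (pole e <= 1)%N ->
  (forall eps x, nr2 x = 1 -> ev eps s e x = 0) -> trace (ev 0 s e) (fun=> 0).
Proof.
move=> e1 e0; exists (fun k => ev 0 s (dX k e)); split; first exact: W12_jet_ev.
have e2 k : (pole (dX k e) <= 2)%N by rewrite (leq_trans (pole_dX _ _)).
exists (fun n => ev (eps n) s e); split.
- by move=> n; exact: smooth_ev.
- have i1 n := @ball_integrable_sqrB_ev e s n (leq_trans e1 (leqnSn 1)).
  have i2 n k := @ball_integrable_sqrB_ev (dX k e) s n (e2 k).
  rewrite (_ : (fun n => _) = (fun n => (ball_int (fun x => (ev (eps n) s e x - ev 0 s e x) ^+ 2) +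
    \sum_k ball_int (fun x => (ev (eps n) s (dX k e) x - ev 0 s (dX k e) x) ^+ 2))%:E)).
    apply: cvg_EFin; first exact: nearW.
    rewrite -[X in _ --> X](addr0 0).
    apply: cvgD; first by apply: ball_int_sqrB_cvg; rewrite (leq_trans e1).
    have : (\sum_k ball_int (fun x => (ev (eps n) s (dX k e) x - ev 0 s (dX k e) x) ^+ 2))
        @[n --> \oo] --> \sum_(k < m) (0 : R).
      by apply: cvg_sumr => k; apply: ball_int_sqrB_cvg.
    by rewrite (_ : \sum_(k < m) (0 : R) = 0)//; rewrite big1.
  apply/funext => n; rewrite -ball_int_sum; last by move=> k; exact: i2.
  rewrite -ball_intD//; last by apply: ball_integrable_sum => k; exact: i2.
  rewrite -ball_int_EFin; last first.
    by apply: ball_integrableD => //; apply: ball_integrable_sum => k; exact: i2.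
  apply: eq_integral => x _; congr (_ + _)%:E.
  by apply: eq_bigr => k _; rewrite pd_evE.
- rewrite (_ : (fun n => _) = cst 0%E); first exact: cvg_cst.
  apply/funext => n; rewrite /sphere_integral /=.
  have mY : measurable_fun setT (fun x : E => (enorm x)^-1 *: x).
    apply: measurable_fun_rVP => i.
    rewrite (_ : (fun t => _) = ev 0 s (Yc R i)); first exact: measurable_ev.
    by apply/funext => x; rewrite mxE /= /rho add0r mulrC.
  rewrite (_ : integral _ _ _ = 0%E) ?mule0//.
  rewrite -[RHS](integral0 leb B); apply: ae_eq_integral.
  + exact: measurable_uball.
  + apply/measurable_EFinP; apply: measurable_funTS; apply: measurable_funX.
    apply: measurable_funB => //.
    by apply: (measurableT_comp _ mY); apply: measurable_ev; exact: ltW.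
  + exact: measurable_cst.
  (* Normalisation sends every point except the origin, a null set, to the sphere. *)
  + apply: filterS (ae_nr2_neq0 R m0) => x x0 _.
    rewrite e0 ?subr0 ?expr0n// /nr2.
    under eq_bigr do rewrite mxE exprMn.
    by rewrite -mulr_sumr -/(nr2 x) -enorm_sqr -exprMn mulVf ?expr1n// -sqrf_eq0 enorm_sqr.
Qed.

End traces.

(** * Moments and the sign of the second variation *)

Section second_variation.
Context (R : realType) (m : nat) (m5 : (5 <= m)%N) (beta : R).
Local Notation E := 'rV[R]_m.
Local Notation leb := (@lebesgue_rV R m).
Local Notation B := (@uball R m).
Local Notation ex := (ex R m).
Local Notation ev := (ev beta).
Local Notation Wex := (@Wex R m).
Local Notation lam := (lam R m).
Local Notation r1 x := (ev 0 0 (Ri R m) x).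
Implicit Types (e : ex) (s h : R) (f g : E -> R).

Let m0 : (0 < m)%N. Proof. exact: leq_trans m5. Qed.
Let M5 : (5 : R) <= m%:R. Proof. by rewrite ler_nat. Qed.

(** The estimate is [m / (m + 1)^2 < 1 / 2]. A cube serves as neighbourhood of the origin because
    its measure is explicit. *)
Lemma small_cube_nr2 (x : E) : cube m (m.+1%:R^-1) x -> nr2 x < 2^-1.
Proof.
move=> xc; have M0 : 0 < m.+1%:R :> R by [].
have le i : x ord0 i ^+ 2 <= m.+1%:R^-1 ^+ 2.
  by rewrite -[leLHS]real_normK ?num_real// ler_sqr ?nnegrE ?invr_ge0// xc.
apply: le_lt_trans (ler_sum _ (fun i _ => le i)) _.
rewrite sumr_const card_ord -[_ *+ m]mulr_natl exprVn ltr_pdivrMr ?exprn_gt0//.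
rewrite -natrX ltr_pdivlMl// -natrM ltr_nat.
by rewrite -[m.+1]addn1 sqrnD muln1 -[X in (X < _)%N]add0n ltn_add2r addn1.
Qed.

(** If the integral vanished, [f] would vanish almost everywhere, and the small cube, of measure
    [(2 / (m + 1))^m], would be a null set. *)
Lemma ball_int_gt0 f : ball_integrable f -> (forall x, B x -> 0 <= f x) ->
  (forall x, cube m (m.+1%:R^-1) x -> nr2 x != 0 -> 0 < f x) -> 0 < ball_int f.
Proof.
move=> fi f0 fpos; rewrite lt_neqAle; apply/andP; split; last first.
  by apply: Rintegral_ge0.
apply/eqP => fz.
have : ae_eq leb B (EFin \o f) (cst 0%E).
  apply/(ae_eq_integral_abs _ (@measurable_uball R m)).
    by case/integrableP : fi.
  rewrite -[RHS]/(0%:E) fz -ball_int_EFin//; apply: eq_integral => x /set_mem Bx.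
  by rewrite /= ger0_norm// f0.
move=> aef; have aem := ae_nr2_neq0 R m0.
have cB x : cube m (m.+1%:R^-1 : R) x -> B x.
  move=> xc; rewrite uballE /=.
  by have := small_cube_nr2 xc; lra.
have [N [mN N0 HN]] : {ae leb, forall x, ~ cube m (m.+1%:R^-1) x}.
  apply: filterS2 aef aem => x h x0 xc; have /= [fx] := h (cB _ xc).
  by have := fpos x xc x0; rewrite fx ltxx.
have : (leb (cube m (m.+1%:R^-1)) <= leb N)%E.
  apply: le_measure; rewrite ?inE//; first exact: measurable_cube.
  by move=> x xc; apply: HN => /=; apply.
rewrite N0 lebesgue_rV_cube ?invr_ge0// lee_fin leNgt exprn_gt0//.
Qed.

Lemma ev_dX_pwU s k n (x : E) : ev 0 s (dX k (pw (Uc R m) n.+1)) x =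
  n.+1%:R * (1 - nr2 x) ^+ n * (-2 * x ord0 k).
Proof.
elim: n => [|n IH]; first by rewrite /=; ring.
rewrite -[LHS]/(-2 * x ord0 k * ev 0 s (pw (Uc R m) n.+1) x + (1 - nr2 x) *
  ev 0 s (dX k (pw (Uc R m) n.+1)) x) IH ev_pw -[ev 0 s (Uc R m) x]/(1 - nr2 x).
rewrite -[n.+2%:R]natr1 !exprS; move: (n.+1%:R) (_ ^+ n) => N w; ring.
Qed.

Definition moment (n : nat) : R := ball_int (ev 0 0 (Mul (pw (Ri R m) 4) (pw (Uc R m) n))).

Lemma pole_pwU n : pole (pw (Uc R m) n) = 0%N.
Proof. by elim: n. Qed.

Lemma integrable_moment n : ball_integrable (ev 0 0 (Mul (pw (Ri R m) 4) (pw (Uc R m) n))).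
Proof. by apply: ball_integrable_ev => //; rewrite [pole _]/= pole_pwU. Qed.

Lemma ev_moment n (x : E) :
  ev 0 0 (Mul (pw (Ri R m) 4) (pw (Uc R m) n)) x = r1 x ^+ 4 * (1 - nr2 x) ^+ n.
Proof.
by rewrite -[LHS]/(ev 0 0 (pw (Ri R m) 4) x * ev 0 0 (pw (Uc R m) n) x) !ev_pw.
Qed.

Lemma momentS n : (m%:R - 4 + 2 * n.+1%:R) * moment n.+1 = 2 * n.+1%:R * moment n.
Proof.
(* Written with [Yc] the field [x_k rho^-4 (1 - |x|^2)^(n+1)] has pole 3; with [Xc] and a fourth
   power of [Ri] it would count as 4, beyond the reach of [ball_int_dX_eq0]. *)
pose e k := Mul (Mul (Yc R k) (pw (Ri R m) 3)) (pw (Uc R m) n.+1).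
have pe k : pole (e k) = 3%N by rewrite /e [pole _]/= pole_pwU.
have i0 k : ball_int (ev 0 0 (dX k (e k))) = 0.
  apply: ball_int_dX_eq0 => //; first by rewrite pe.
  by move=> eps x x1; rewrite /= x1 subrr mul0r mulr0.
have ie k : ball_integrable (ev 0 0 (dX k (e k))).
  by apply: ball_integrable_ev => //; rewrite (leq_trans (pole_dX _ _))// pe.
apply/eqP; rewrite -subr_eq0; apply/eqP.
have := integrable_moment n; have := integrable_moment n.+1 => i1 i2.
rewrite -ball_intZ// -mulNr -ball_intZ// -ball_intD; [|exact: ball_integrableZ..].
have : ball_int (fun x => \sum_k ev 0 0 (dX k (e k)) x) = 0 by rewrite ball_int_sum// big1.
move=> Z; rewrite -[RHS]Z; apply: eq_ball_int_neq0 => //.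
- by apply: measurable_funD; apply: measurable_funM => //; apply (measurable_evB beta 0).
- by apply: measurable_sum => k; apply (measurable_evB beta 0).
move=> x x0; have r0 : 0 < 0 + nr2 x by rewrite add0r lt_neqAle eq_sym x0 nr2_ge0.
have rE : r1 x ^+ 2 * nr2 x = 1 by rewrite exprVn rho_sqr ?ltW// add0r mulVf.
rewrite !ev_moment.
transitivity (\sum_k (r1 x ^+ 4 * (1 - nr2 x) ^+ n.+1 +
   (- 4 * r1 x ^+ 4 * (1 - nr2 x) ^+ n.+1) * ev 0 0 (Yc R k) x ^+ 2 +
   (-2 * n.+1%:R * (1 - nr2 x) ^+ n * r1 x ^+ 4) * x ord0 k ^+ 2)).
  rewrite !big_split /= -!mulr_sumr -/(nr2 x) (sum_Y2 beta 0 x0) sumr_const card_ord -mulr_natl.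
  rewrite !exprS; move: (_ ^+ n) n.+1%:R => w N; ring.
apply: eq_bigr => k _.
rewrite -[RHS]/(_ * ev 0 0 (pw (Uc R m) n.+1) x + _ * ev 0 0 (dX k (pw (Uc R m) n.+1)) x).
rewrite ev_dX_pwU ev_pw /= eqxx /= !exprS; move: (_ ^+ n) n.+1%:R => w N; ring.
Qed.

Lemma moment_gt0 n : 0 < moment n.
Proof.
apply: ball_int_gt0; first exact: integrable_moment.
- move=> x Bx; rewrite ev_moment; apply: mulr_ge0.
    by rewrite exprn_ge0// invr_ge0 sqrtr_ge0.
  by rewrite exprn_ge0// subr_ge0; exact: uball_nr2.
- move=> x xc x0; rewrite ev_moment; apply: mulr_gt0.
    by rewrite exprn_gt0// invr_gt0 rho_gt0// add0r lt_neqAle eq_sym x0 nr2_ge0.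
  rewrite exprn_gt0// subr_gt0.
  by have := small_cube_nr2 xc; lra.
Qed.

(** It is the bienergy density of the variation at every point, the origin included, whereas the
    square of [Pex] is compared with it only off the origin. *)
Definition Dex : ex := Add (Qex R m) (Mul (Cst m (-1)) (Mul (Gex R m) (Gex R m))).

Lemma pole_Dex : (pole Dex <= 4)%N.
Proof. by rewrite /= geq_max pole_Qex add0n (leq_add (pole_Gex R m) (pole_Gex R m)). Qed.

Lemma bienergy_density_ev s : bienergy_density (fun a k => ev 0 s (dX k (Wex a)))
  (fun a k l => ev 0 s (dX l (dX k (Wex a)))) = ev 0 s Dex.
Proof.
apply/funext => x; rewrite /bienergy_density.
rewrite -[RHS]/(ev 0 s (Qex R m) x + -1 * (ev 0 s (Gex R m) x * ev 0 s (Gex R m) x)).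
rewrite mulN1r -expr2; congr (_ - _ ^+ 2).
  by rewrite ev_Sum; apply: eq_bigr => a _; rewrite /= ev_Sum expr2.
rewrite ev_Sum; apply: eq_bigr => a _; rewrite ev_Sum; apply: eq_bigr => k _.
by rewrite expr2.
Qed.

Lemma ev_ds_eq e1 e2 (x : E) : (forall s, ev 0 s e1 x = ev 0 s e2 x) ->
  forall s, ev 0 s (ds e1) x = ev 0 s (ds e2) x.
Proof.
move=> e12 s; have [_ <-] := is_derive_s beta 0 s e1 x.
have [_ <-] := is_derive_s beta 0 s e2 x.
by congr ('D_1 _ s); apply/funext => t; exact: e12.
Qed.

Lemma ev_dds_sqr s e (x : E) : ev 0 s (ds (ds (Mul e e))) x =
  2 * ev 0 s (ds (ds e)) x * ev 0 s e x + 2 * ev 0 s (ds e) x ^+ 2.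
Proof. by rewrite /=; ring. Qed.

(* Here [nr2 x] was eliminated in favour of [u = 1 - nr2 x]: the quadratic
   polynomial is [224 (1 - u)^2 - 16 m (1 - u) u + 2 (m - 4) u^2], that is
   [u^-6 r^2 (Delta eta + 2 (m - 4) eta / r^2)] with [eta = u^8]. *)
Lemma ev_ddsDex (x : E) : sin beta ^+ 2 = 5 / 6 * ((m%:R - 1) / (m%:R + 1)) -> nr2 x != 0 ->
  ev 0 0 (ds (ds Dex)) x =
  2 * r1 x ^+ 4 * (1 - nr2 x) ^+ 12 *
  ((224 - (448 + 16 * m%:R) * (1 - nr2 x) + (216 + 18 * m%:R) * (1 - nr2 x) ^+ 2) ^+ 2
   - (lam ^+ 2 - 4 * (m%:R - 4) ^+ 2) * (1 - nr2 x) ^+ 4).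
Proof.
move=> hq x0.
have DP s : ev 0 s Dex x = ev 0 s (Mul (Pex R m) (Pex R m)) x.
  by rewrite -bienergy_density_ev bienergy_density_W// expr2.
rewrite (ev_ds_eq (ev_ds_eq DP)) ev_dds_sqr.
have r0 : 0 < 0 + nr2 x by rewrite add0r lt_neqAle eq_sym x0 nr2_ge0.
have rE : r1 x ^+ 2 * nr2 x = 1 by rewrite exprVn rho_sqr ?ltW// add0r mulVf.
have E0 : ev 0 0 (Pex R m) x = - lam * r1 x ^+ 2 * (sin beta * cos beta).
  by rewrite /= /angle !mul0r ?addr0; ring.
have E1 : ev 0 0 (ds (Pex R m)) x = ev 0 0 (lapl_eta R m) x -
    lam * r1 x ^+ 2 * (cos beta ^+ 2 - sin beta ^+ 2) * (1 - nr2 x) ^+ 8.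
  by rewrite /= /angle !mul0r ?addr0; ring.
have E2 : ev 0 0 (ds (ds (Pex R m))) x =
    4 * lam * r1 x ^+ 2 * (sin beta * cos beta) * (1 - nr2 x) ^+ 16.
  by rewrite /= /angle !mul0r ?addr0; ring.
(* Inserting [r^-2 |x|^2 = 1] gives the Laplacian the same factor [r^-2] as the potential term. *)
have L0 : ev 0 0 (lapl_eta R m) x = r1 x ^+ 2 * (nr2 x *
    (224 * (1 - nr2 x) ^+ 6 * nr2 x - 16 * m%:R * (1 - nr2 x) ^+ 7)).
  by rewrite mulrA rE /=; ring.
rewrite E0 E1 E2 L0.
have c2 : cos beta ^+ 2 = 1 - sin beta ^+ 2 by rewrite -(cos2Dsin2 beta) addrK.
have hl : 2 * lam * sin beta ^+ 2 = lam + 2 * (m%:R - 4).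
  by rewrite hq /lam; field; have := M5; lra.
(* In terms of the double angle: [lam cos (2 beta) = - 2 (m - 4)], and therefore, as [h2], [lam^2
   sin^2 (2 beta) = lam^2 - 4 (m - 4)^2]. *)
have h1 : lam * (cos beta ^+ 2 - sin beta ^+ 2) = - 2 * (m%:R - 4).
  by rewrite c2; move: hl; move: (sin beta ^+ 2) lam => q l hl; lra.
have h2 : 4 * lam ^+ 2 * (sin beta ^+ 2 * cos beta ^+ 2) = lam ^+ 2 - 4 * (m%:R - 4) ^+ 2.
  have -> : 4 * (m%:R - 4) ^+ 2 = (2 * lam * sin beta ^+ 2 - lam) ^+ 2 by rewrite hl; ring.
  by rewrite c2; ring.
rewrite -h2.
transitivity (2 * (r1 x ^+ 2 * (nr2 x *
    (224 * (1 - nr2 x) ^+ 6 * nr2 x - 16 * m%:R * (1 - nr2 x) ^+ 7)) -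
    lam * (cos beta ^+ 2 - sin beta ^+ 2) * r1 x ^+ 2 * (1 - nr2 x) ^+ 8) ^+ 2 -
    2 * (4 * lam ^+ 2 * (sin beta ^+ 2 * cos beta ^+ 2)) * r1 x ^+ 4 * (1 - nr2 x) ^+ 16).
  by move: (r1 x) (nr2 x) (sin beta) (cos beta) lam => r t s c l; ring.
rewrite h1; move: (4 * _ * _) (r1 x) (nr2 x) => D r t; ring.
Qed.

Lemma second_variation_lt0 : (m <= 18)%N ->
  sin beta ^+ 2 = 5 / 6 * ((m%:R - 1) / (m%:R + 1)) ->
  ball_int (ev 0 0 (ds (ds Dex))) < 0.
Proof.
move=> m18 hq.
(* With [u = 1 - |x|^2] the integrand is [2 r^-4 u^12 ((224 - A1 u + A2 u^2)^2 - D u^4)], so exactly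
   the moments 12 to 16 enter. *)
pose A1 : R := 448 + 16 * m%:R; pose A2 : R := 216 + 18 * m%:R.
pose D : R := lam ^+ 2 - 4 * (m%:R - 4) ^+ 2.
have i n := integrable_moment n.
pose f n (x : E) := ev 0 0 (Mul (pw (Ri R m) 4) (pw (Uc R m) n)) x.
have iZ n c : ball_integrable (fun x => c * f n x) by apply: ball_integrableZ; exact: i.
have iD g1 g2 : ball_integrable g1 -> ball_integrable g2 ->
    ball_integrable (fun x : E => g1 x + g2 x).
  exact: ball_integrableD.
have SE : ball_int (ev 0 0 (ds (ds Dex))) = 2 * (224 ^+ 2 * moment 12 - 448 * A1 * moment 13
    + (A1 ^+ 2 + 448 * A2) * moment 14 - 2 * A1 * A2 * moment 15 + (A2 ^+ 2 - D) * moment 16).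
  transitivity (ball_int (fun x => 2 * 224 ^+ 2 * f 12 x + (- (896 * A1) * f 13 x +
     (2 * (A1 ^+ 2 + 448 * A2) * f 14 x + (- (4 * A1 * A2) * f 15 x + 2 * (A2 ^+ 2 - D) * f 16 x))))).
    apply: eq_ball_int_neq0 => //; first exact: measurable_evB.
      by do !apply: measurable_funD; apply: measurable_funM => //; apply: measurable_evB.
    move=> x x0; rewrite ev_ddsDex// /f !ev_moment /A1 /A2 -/D; ring.
  have j5 := iZ 16%N (2 * (A2 ^+ 2 - D)).
  have j4 := iD _ _ (iZ 15%N (- (4 * A1 * A2))) j5.
  have j3 := iD _ _ (iZ 14%N (2 * (A1 ^+ 2 + 448 * A2))) j4.
  have j2 := iD _ _ (iZ 13%N (- (896 * A1))) j3.
  rewrite ball_intD// ball_intD// ball_intD// ball_intD//.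
  have bZ n c : ball_int (fun x => c * f n x) = c * moment n by exact: (ball_intZ c (i n)).
  by rewrite !bZ; ring.
have := momentS 12; have := momentS 13; have := momentS 14; have := momentS 15.
have := moment_gt0 12; rewrite SE /D /A1 /A2 /lam.
move: (moment 12) (moment 13) (moment 14) (moment 15) (moment 16) => I2 I3 I4 I5 I6.
(* For each numeral [m] the recursions and the claim are linear in the five moments, and the
   recursions express the last four through the positive first one. *)
have : m \in iota 5 14 by rewrite mem_iota m5 ltnS.
rewrite !inE; do 13 (case/predU1P => [->|]; first by lra).
by move=> /eqP ->; lra.
Qed.
End second_variation.

(** * Admissibility of the variation *)

Section instability.
Context (R : realType) (m : nat) (m5 : (5 <= m)%N) (beta : R).
Local Notation E := 'rV[R]_m.
Local Notation ex := (ex R m).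
Local Notation ev := (ev beta).
Local Notation I := (option ('I_m * 'I_m * 'I_m)).
Local Notation Wex := (@Wex R m).
Local Notation Dex := (Dex R m).

Definition Zex (a : I) : ex := Add (Wex a) (Mul (Cst m (-1)) (At 0 (Wex a))).

Lemma pole_Zex a : pole (Zex a) = 0%N.
Proof. by rewrite [pole _]/= pole_Wex. Qed.

Lemma angle_sphere s (x : E) : nr2 x = 1 -> angle beta s x = beta.
Proof. by move=> x1; rewrite /angle x1 subrr expr0n mulr0 addr0. Qed.

Lemma Zex_sphere a s eps x : nr2 x = 1 -> ev eps s (Zex a) x = 0.
Proof. by move=> x1; case: a => [[[i j] l]|]; rewrite /= !angle_sphere//; ring. Qed.

(** The gradient of the angle contains [(1 - |x|^2)^7], and the remaining terms cancel against the
    copy frozen at parameter 0, which is regularised by the same [eps]. *)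
Lemma dZex_sphere a k s eps x : nr2 x = 1 -> ev eps s (dX k (Zex a)) x = 0.
Proof. by move=> x1; case: a => [[[i j] l]|]; rewrite /= !angle_sphere// x1; ring. Qed.

Lemma zero_boundary_data_W s :
  zero_boundary_data (fun (a : I) x => ev 0 s (Wex a) x - vtilde beta a x).
Proof.
have -> : (fun (a : I) x => ev 0 s (Wex a) x - vtilde beta a x) = fun a => ev 0 s (Zex a).
  by apply/funext => a; apply/funext => x; rewrite vtildeE /= mulN1r.
exists (fun a k => ev 0 s (dX k (Zex a))), (fun a k l => ev 0 s (dX l (dX k (Zex a)))).
split; first by move=> a; apply: W22_jet_ev => //; rewrite pole_Zex.
move=> a; split.
  by apply: trace_ev => //; [rewrite pole_Zex|move=> *; exact: Zex_sphere].
move=> k; apply: trace_ev => //; last by move=> *; exact: dZex_sphere.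
by rewrite (leq_trans (pole_dX _ _))// pole_Zex.
Qed.

Lemma pole_iter_ds p a : pole (iter p (@ds R m) (Wex a)) = 0%N.
Proof.
elim: p => [|p IH]; first exact: pole_Wex.
by apply/eqP; rewrite -leqn0 -IH iterS pole_ds.
Qed.

(** The [p]-th derivative is the [p]-fold [ds] of the expression; its pole stays 0, so the same
    estimate works at every order. *)
Lemma smooth_W22_curve_W : smooth_W22_curve 1 (fun s (a : I) => ev 0 s (Wex a)).
Proof.
exists (fun p s a => ev 0 s (iter p (@ds R m) (Wex a))); split => // p s _.
split.
  exists (fun a k => ev 0 s (dX k (iter p (@ds R m) (Wex a)))),
    (fun a k l => ev 0 s (dX l (dX k (iter p (@ds R m) (Wex a))))) => a.
  by apply: W22_jet_ev => //; rewrite pole_iter_ds.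
move=> d d0.
have := W22_norm_le_dquot m5 beta s (pole_iter_ds p) d0.
apply: filterS => h; congr W22_norm_le.
by apply/funext => a; apply/funext => x; rewrite ev_dquot.
Qed.

Definition energy (s : R) : R := 2^-1 * ball_int (ev 0 s Dex).

Lemma is_derive_half_ball_int (e : ex) (s : R) : (pole e <= 4)%N ->
  is_derive s 1 (fun s => 2^-1 * ball_int (ev 0 s e)) (2^-1 * ball_int (ev 0 s (ds e))).
Proof. by move=> e4; apply: is_deriveZ; exact: is_derive_ball_int. Qed.

Lemma derive1_energy : derive1 energy = fun s => 2^-1 * ball_int (ev 0 s (ds Dex)).
Proof.
apply/funext => s; rewrite derive1E.
by have [] := is_derive_half_ball_int s (pole_Dex R m).
Qed.

Lemma is_derive2_energy (s : R) :
  is_derive s 1 (derive1 energy) (2^-1 * ball_int (ev 0 s (ds (ds Dex)))).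
Proof.
rewrite derive1_energy; apply: is_derive_half_ball_int.
exact: leq_trans (pole_ds _) (pole_Dex R m).
Qed.

Lemma unstable_vtilde : (m <= 18)%N ->
  sin beta ^+ 2 = 5 / 6 * ((m%:R - 1) / (m%:R + 1)) -> unstable (@vtilde R m beta).
Proof.
move=> m18 hq; exists 1, (fun s (a : I) => ev 0 s (Wex a)), energy.
split=> //; split; first by apply: nearW => x _ a; rewrite vtildeE.
split; first exact: smooth_W22_curve_W.
split.
  move=> s _; split.
  - split; first exact: sphere_valued_W.
    by do 2 eexists; exact: W22_map_jet_W.
  - exact: zero_boundary_data_W.
  exists (fun a k => ev 0 s (dX k (Wex a))), (fun a k l => ev 0 s (dX l (dX k (Wex a)))).
  split; first exact: W22_map_jet_W.
  - by rewrite bienergy_density_ev; apply: ball_integrable_ev => //; exact: pole_Dex.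
  - by rewrite bienergy_density_ev.
split; first by exists 1 => //= s _; have [] := is_derive_half_ball_int s (pole_Dex R m).
have [de vde] := is_derive2_energy 0; split => //.
rewrite /derive1n /= derive1E vde pmulr_rlt0 ?invr_gt0//.
exact: second_variation_lt0.
Qed.
End instability.

(** * Non-harmonicity *)

Section nonharmonicity.
Context (R : realType) (m : nat) (m5 : (5 <= m)%N) (beta : R).
Local Notation E := 'rV[R]_m.
Local Notation leb := (@lebesgue_rV R m).
Local Notation B := (@uball R m).
Local Notation ex := (ex R m).
Local Notation ev := (ev beta).
Local Notation I := (option ('I_m * 'I_m * 'I_m)).
Local Notation Wex := (@Wex R m).
Implicit Types (e : ex) (eps s : R) (f g : E -> R).

Definition bump (x : E) : R := flat 0 (2^-1 - nr2 x).

Lemma bump_ge0 x : 0 <= bump x. Proof. exact: flat_ge0. Qed.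

Lemma bump_gt0 x : nr2 x < 2^-1 -> 0 < bump x.
Proof. by move=> x1; rewrite /bump /flat subr_gt0 x1 mulr_gt0 ?exprn_gt0 ?invr_gt0 ?subr_gt0 ?expR_gt0. Qed.

(** The free factor [e] makes truncated regularisations of derivatives of the map available as test
    functions. *)
Lemma test_fun_bump eps s e : 0 < eps -> test_fun (ev eps s (Mul (Fl R m 0) e)).
Proof.
move=> e0; split; first exact: smooth_ev.
exists (cube m 1 `&` [set x | nr2 x <= 2^-1]); split.
- have cl : closed [set x : E | nr2 x <= 2^-1].
    have -> : [set x : E | nr2 x <= 2^-1] = @nr2 R m @^-1` [set t | t <= 2^-1] by [].
    apply: closed_comp; last exact: closed_le.
    by move=> x _; exact: continuous_nr2.
  apply: (subclosed_compact _ (@compact_cube R m)); last by move=> x [].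
  apply: closedI => //; apply: compact_closed; [exact: norm_hausdorff|exact: compact_cube].
- by move=> x [_ /= x1]; rewrite uballE /=; lra.
- move=> x xK; rewrite [LHS]/= /flat; case: ifPn; last by rewrite mul0r.
  rewrite subr_gt0 => x1; exfalso; apply: xK; split; last exact: ltW.
  by apply: nr2_cube; lra.
Qed.

Lemma L2_sqr g : L2 g -> ball_integrable (fun x => g x ^+ 2).
Proof.
move=> [mg gi]; apply/integrableP; split.
  by apply/measurable_EFinP; exact: measurable_funX.
apply: le_lt_trans gi; rewrite le_eqVlt; apply/orP; left; apply/eqP.
by apply: eq_integral => x _; rewrite /= ger0_norm// sqr_ge0.
Qed.

Lemma L2_mul g f (M : R) : L2 g -> measurable_fun B f -> (forall x, B x -> `|f x| <= M) ->
  ball_integrable (fun x => g x * f x).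
Proof.
move=> Lg mf fM; apply: (le_ball_integrable (g := fun x => `|M| * (1 + g x ^+ 2))).
- by apply: measurable_funM => //; case: Lg.
- move=> x Bx; rewrite normrM mulrC ler_pM//.
    by rewrite (le_trans (fM x Bx))// ler_norm.
  rewrite -[g x ^+ 2]real_normK ?num_real//; move: `|g x| => t.
  have := sqr_ge0 (t - 2^-1); rewrite -subr_ge0 => h.
  by rewrite -subr_ge0 (_ : 1 + t ^+ 2 - t = (t - 2^-1) ^+ 2 - 0 + 3 / 4); [lra|field].
apply: ball_integrableZ; apply: ball_integrableD; last exact: L2_sqr.
by apply: continuous_ball_integrable; exact: cont_cst.
Qed.

Lemma L2_test g f : L2 g -> test_fun f -> ball_integrable (fun x => g x * f x).
Proof.
move=> Lg tf; have [C C0 HC] := test_fun_bound tf.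
apply: (L2_mul (M := C)) => //; first exact: test_fun_measurable.
by move=> x Bx; have := HC x Bx; rewrite mulr1.
Qed.

Lemma ball_int_pd_test k f : test_fun f -> ball_int (pd k f) = 0.
Proof.
move=> tf; apply: ball_int_pd_eq0.
- exact: test_fun_cont.
- by move=> x; exact: test_fun_derivable.
- exact/test_fun_cont/test_fun_pd.
- by move=> x; exact: test_fun_sphere.
Qed.

(* Testing the last component, which is constant, against a bump function shows
   that a weakly harmonic [vtilde] would have zero gradient near the origin. *)
Lemma weakly_harmonic_grad : cos beta != 0 -> weakly_harmonic (@vtilde R m beta) ->
  exists Dw, W12_map_jet (@vtilde R m beta) Dw /\
    forall a k, {ae leb, forall x, B x -> Dw a k x * bump x = 0}.
Proof.
move=> c0 [_ [Dw [jet H]]]; exists Dw; split => //.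
have LD a k : L2 (Dw a k) by case: (jet a) => _ /(_ k)[].
(* The bump in the last component and 0 elsewhere; neither [Ri] nor [Yc] occurs, so any positive
   [eps] gives the same map. *)
pose phi (a : I) := ev 1 0 (Mul (Fl R m 0) (Cst m (a == None)%:R)).
have tphi a : test_fun (phi a) by exact: test_fun_bump.
have phiE a x : phi a x = (a == None)%:R * bump x by rewrite /phi /= mulrC.
have dphiE a k x : pd k (phi a) x = (a == None)%:R * pd k (phi None) x.
  by rewrite /phi !pd_evE//= !mulr0 !addr0 mulr1 mulrC.
have iD k : ball_integrable (fun x => Dw None k x * pd k (phi None) x).
  by apply: L2_test => //; exact: test_fun_pd.
have iDS : ball_integrable (fun x => \sum_k Dw None k x * pd k (phi None) x).
  exact: ball_integrable_sum.
have ig : ball_integrable (fun x => grad_sq Dw x * bump x).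
  apply: (le_ball_integrable (g := fun x => grad_sq Dw x)).
  - apply: measurable_funM; last first.
      by have := test_fun_measurable (tphi None); apply: eq_measurable_fun => x _; rewrite phiE mul1r.
    apply: measurable_sum => a; apply: measurable_sum => k; apply: measurable_funX.
    by case: (LD a k).
  - move=> x _; have g0 : 0 <= grad_sq Dw x.
      by apply: sumr_ge0 => a _; apply: sumr_ge0 => k _; exact: sqr_ge0.
    rewrite ger0_norm ?mulr_ge0 ?bump_ge0// ler_piMr//.
    by rewrite (le_trans (flat_le _ _)).
  - apply: ball_integrable_sum => a; apply: ball_integrable_sum => k.
    exact: L2_sqr.
have Z : ball_int (fun x => grad_sq Dw x * bump x) = 0.
  have E1 : (fun x => \sum_a ((\sum_k Dw a k x * pd k (phi a) x) -
      grad_sq Dw x * vtilde beta a x * phi a x)) =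
    fun x => \sum_k Dw None k x * pd k (phi None) x + (- cos beta) * (grad_sq Dw x * bump x).
    apply/funext => x; rewrite big_option [X in _ + X]big1 ?addr0.
      by rewrite phiE mul1r /=; ring.
    move=> p _; rewrite phiE mul0r mulr0 subr0 big1// => k _.
    by rewrite dphiE mul0r mulr0.
  have := H phi tphi; rewrite -[X in X = 0 -> _]/(ball_int (fun x => \sum_a
    ((\sum_k Dw a k x * pd k (phi a) x) - grad_sq Dw x * vtilde beta a x * phi a x))) E1.
  rewrite ball_intD//; last exact: ball_integrableZ.
  (* The last component is the constant [cos beta]: testing its weak derivative against
     [pd k (phi None)] gives, up to sign, [cos beta] times the integral of a second derivative of
     the bump, which is 0. *)
  rewrite ball_int_sum// big1 ?add0r; last first.
    move=> k _; have [_ /(_ k)[_ W]] := jet None.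
    have {W} : ball_int (fun x => cos beta * pd k (pd k (phi None)) x) =
      - ball_int (fun x => Dw None k x * pd k (phi None) x) by exact: (W _ (test_fun_pd k (tphi None))).
    rewrite ball_intZ; last first.
      by apply: continuous_ball_integrable; exact/test_fun_cont/test_fun_pd/test_fun_pd.
    rewrite ball_int_pd_test ?mulr0; last exact: test_fun_pd.
    by move/eqP; rewrite eq_sym oppr_eq0 => /eqP.
  rewrite ball_intZ// => /eqP; rewrite mulf_eq0 oppr_eq0 (negPf c0) => /eqP.
  by [].
have aeg : ae_eq leb B (EFin \o (fun x => grad_sq Dw x * bump x)) (cst 0%E).
  apply/(ae_eq_integral_abs _ (@measurable_uball R m)).
    by case/integrableP : ig.
  rewrite -[RHS]/(0%:E) -[in RHS]Z -ball_int_EFin//; apply: eq_integral => x _.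
  rewrite /= ger0_norm// mulr_ge0 ?bump_ge0//.
  by apply: sumr_ge0 => a _; apply: sumr_ge0 => k _; exact: sqr_ge0.
move=> a k; apply: filterS aeg => x hx Bx; have [/eqP] := hx Bx.
rewrite mulf_eq0 => /orP[|/eqP ->]; last by rewrite mulr0.
rewrite psumr_eq0; last by move=> b _; apply: sumr_ge0 => l _; exact: sqr_ge0.
move=> /allP/(_ a (mem_index_enum a)) /=.
rewrite psumr_eq0; last by move=> l _; exact: sqr_ge0.
by move=> /allP/(_ k (mem_index_enum k)) /=; rewrite sqrf_eq0 => /eqP ->; rewrite mul0r.
Qed.

(** The weak gradient [Dw] comes from the hypothesis and need not be the pointwise one. Both are
    tested against the bump times a regularised derivative of the map; in the limit the integral of
    the bump times the squared pointwise derivative is 0, contrary to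
    [|grad w|^2 = lam sin^2 beta / r^2]. *)
Lemma not_weakly_harmonic_vtilde : cos beta != 0 -> sin beta != 0 ->
  ~ weakly_harmonic (@vtilde R m beta).
Proof.
move=> c0 s0 /(weakly_harmonic_grad c0)[Dw [jet aeD]].
have pdW a k : (pole (dX k (Wex a)) <= 1)%N by exact: pole_dW.
have Z0 a k : ball_int (fun x => ev 0 0 (Mul (Fl R m 0) (dX k (Wex a))) x *
    ev 0 0 (dX k (Wex a)) x) = 0.
  have [C C0 HC] := ev_boundB beta 0 (dX k (Wex a)).
  have p4 : (pole (Mul (Fl R m 0) (dX k (Wex a))) + pole (dX k (Wex a)) <= 4)%N.
    by rewrite /= add0n (leq_trans (leq_add (pdW a k) (pdW a k))).
  have c1 := ball_int_ev_cvg m5 (beta := beta) (s := 0) p4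
    (measurable_evB beta 0 (dX k (Wex a))) HC.
  rewrite -(cvg_lim (@Rhausdorff R) c1); apply/lim_near_cst => //; apply: nearW => n /=.
  pose Psi := ev n.+1%:R^-1 0 (Mul (Fl R m 0) (dX k (Wex a))).
  have tPsi : test_fun Psi by apply: test_fun_bump; rewrite invr_gt0.
  have e1 := weak_pd_ev m5 beta 0 k (leq_trans (eq_leq (pole_Wex R a)) (leq0n 3)) tPsi.
  have [_ /(_ k)[_ /(_ _ tPsi) e2]] := jet a.
  rewrite vtildeE e1 in e2; move/oppr_inj : e2.
  rewrite -[LHS]/(ball_int (fun x => ev 0 0 (dX k (Wex a)) x * Psi x)).
  rewrite -[RHS]/(ball_int (fun x => Dw a k x * Psi x)) => e2.
  transitivity (ball_int (fun x => ev 0 0 (dX k (Wex a)) x * Psi x)).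
    by apply: eq_ball_int => x _; rewrite mulrC.
  rewrite e2 /ball_int /Rintegral (_ : integral _ _ _ = 0%E)//.
  rewrite -[RHS](integral0 leb B); apply: ae_eq_integral.
  - exact: measurable_uball.
  - apply/measurable_EFinP; apply: measurable_funM; last exact: test_fun_measurable.
    by case: (jet a) => _ /(_ k)[[]].
  - exact: measurable_cst.
  apply: filterS (aeD a k) => x hx Bx.
  by rewrite /Psi [ev _ _ _ _]/= -/(bump x) mulrA hx// mul0r.
have iW a k : ball_integrable (fun x => ev 0 0 (Mul (Fl R m 0) (dX k (Wex a))) x *
    ev 0 0 (dX k (Wex a)) x).
  apply: (ball_integrable_ev m5 beta 0 (e := Mul (Mul (Fl R m 0) (dX k (Wex a))) (dX k (Wex a)))).
  by rewrite /= add0n (leq_trans (leq_add (pdW a k) (pdW a k))).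
pose F (x : E) := \sum_a \sum_k ev 0 0 (Mul (Fl R m 0) (dX k (Wex a))) x * ev 0 0 (dX k (Wex a)) x.
have FE x : F x = bump x * grad_sq (fun a k => ev 0 0 (dX k (Wex a))) x.
  rewrite /F /grad_sq mulr_sumr; apply: eq_bigr => a _; rewrite mulr_sumr.
  by apply: eq_bigr => k _; rewrite [ev _ _ (Mul _ _) _]/= -/(bump x) -mulrA expr2.
have iF : ball_integrable F.
  by apply: ball_integrable_sum => a; exact: ball_integrable_sum.
have : 0 < ball_int F.
  apply: (ball_int_gt0 m5) => // x.
    move=> _; rewrite FE mulr_ge0 ?bump_ge0//.
    by apply: sumr_ge0 => a _; apply: sumr_ge0 => k _; exact: sqr_ge0.
  move=> xc x0; rewrite FE mulr_gt0 ?bump_gt0 ?small_cube_nr2// grad_sq_W//.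
  rewrite dangle0 add0r /angle mul0r addr0.
  have r0 : 0 < ev 0 0 (Ri R m) x.
    by rewrite invr_gt0 rho_gt0// add0r lt_neqAle eq_sym x0 nr2_ge0.
  have l0 : 0 < lam R m by rewrite /lam mulr_gt0// ltr_wpDl.
  have s2 : 0 < sin beta ^+ 2 by rewrite exprn_even_gt0.
  by rewrite mulr_gt0// mulr_gt0// exprn_gt0.
rewrite ball_int_sum; last by move=> a; exact: ball_integrable_sum.
rewrite big1 ?ltxx// => a _; rewrite ball_int_sum// big1//.
Qed.

End nonharmonicity.

Theorem theorem1p5 (R : realType) (m : nat) (beta : R)
  (hm : (5 <= m <= 18)%N)
  (hbeta : 0 < beta < pi / 2)
  (hsin : sin beta ^+ 2 = 5 / 6 * ((m%:R - 1) / (m%:R + 1))) :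
  proper_weakly_biharmonic (@vtilde R m beta) /\ unstable (@vtilde R m beta).
Proof.
have /andP[m5 m18] := hm; have /andP[b0 b1] := hbeta.
have c0 : cos beta != 0 by rewrite gt_eqF// cos_gt0_pihalf// b1 andbT; lra.
have s0 : sin beta != 0 by rewrite gt_eqF// sin_gt0_pihalf// b0.
split; last exact: unstable_vtilde.
split; first exact: weakly_biharmonic_vtilde.
exact: not_weakly_harmonic_vtilde.
Qed.
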